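(* Let $n\ge3$, let $G$ be an edge-ordered graph without self-loops with $n+1$ vertices and $2n$ edges, and let $l,d\in\{1,\dots,2n\}$ with $l\ne d$. Then $$I_{\mathrm{RW}}(G)=(2n-1)\frac{(-1)^{l+d+(l<d)}}{(2\pi i)^{n-1}}\int_{Z_n}\log\left(\frac{|z_l|^2}{|z_d|^2}\right)\bigwedge_{e\ne l,d}d\log\left(\frac{|z_e|^2}{|z_d|^2}\right).$$
   Context: Label the vertices of $G$ by $1,\dots,n+1$ and the edges by $1,\dots,2n$ according to the edge order; orient the edges arbitrarily. $Z_n=\{z\in\mathbb{C}^{n+1}\mid z_i\ne z_j \text{ for } i\neq j\}/(\mathbb{C}^*\ltimes\mathbb{C})$ is the quotient by translations, rotations and positive scalings, with its standard complex orientation. For an edge $e=(u,v)$ put $z_e=z_u-z_v$; $(l<d)$ is $1$ if $l<d$ and $0$ otherwise; wedge products are taken in the edge order. The RW-integral is $$I_{\mathrm{RW}}(G)=\frac{1}{(2\pi i)^{n-1}}\int_{Z_n}\sum_{l=1}^{2n}\sum_{\substack{d=1\\ d\ne l}}^{2n}(-1)^{l+d+(l<d)}\log(|z_l|^2)\bigwedge_{e\neq l,d}d\log(|z_e|^2).$$ If $G$ is disconnected, $I_{\mathrm{RW}}(G)=0$ by convention. *)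

(* Defs.v *)
From HB Require Import structures.
From mathcomp Require Import all_boot all_order all_algebra.
From mathcomp Require Import all_classical all_reals all_analysis.
From mathcomp.real_closed Require Import complex.
From mathcomp Require Import zify.

Set Implicit Arguments.
Unset Strict Implicit.
Unset Printing Implicit Defensive.

Import Order.TTheory GRing.Theory Num.Theory.
Import numFieldNormedType.Exports.

Local Open Scope classical_set_scope.
Local Open Scope ring_scope.
Local Open Scope complex_scope.

Section power_measure_step.
Context d (T : measurableType d) (R : realType) (n : nat).
Variables (mu : {sigma_finite_measure set T -> \bar R})
  (nu : {sigma_finite_measure set (n.-tuple T) -> \bar R}).

Definition tuple_cons (p : T * n.-tuple T) : n.+1.-tuple T :=
  [tuple of p.1 :: p.2].

Lemma measurable_tuple_cons : measurable_fun setT tuple_cons.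
Proof. exact: measurable_cons. Qed.

Definition cons_measure : set (n.+1.-tuple T) -> \bar R :=
  pushforward (mu \x nu)%E tuple_cons.

Let measurable_preimage_cons A : measurable A -> measurable (tuple_cons @^-1` A).
Proof.
by move=> mA; rewrite -[X in measurable X]setTI; exact: measurable_tuple_cons.
Qed.

Let cons_measure0 : cons_measure set0 = 0%E.
Proof. by rewrite /cons_measure /pushforward preimage_set0 measure0. Qed.

Let cons_measure_ge0 A : (0 <= cons_measure A)%E.
Proof. by rewrite /cons_measure /pushforward; exact: measure_ge0. Qed.

Let cons_measure_sigma_additive : semi_sigma_additive cons_measure.
Proof.
move=> F mF tF mUF; rewrite /cons_measure /pushforward preimage_bigcup.
apply: measure_semi_sigma_additive.
- by move=> k; exact: measurable_preimage_cons.
- apply/trivIsetP => /= i j _ _ ij; rewrite -preimage_setI.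
  by move/trivIsetP : tF => /(_ _ _ _ _ ij) ->//; rewrite preimage_set0.
- by rewrite -preimage_bigcup; exact: measurable_preimage_cons.
Qed.

HB.instance Definition _ := isMeasure.Build _ _ _ cons_measure
  cons_measure0 cons_measure_ge0 cons_measure_sigma_additive.

Let cons_measureX (A : set T) (B : set (n.-tuple T)) :
  measurable A -> measurable B ->
  cons_measure [set t | A (thead t) /\ B [tuple of behead t]] = (mu A * nu B)%E.
Proof.
move=> mA mB; rewrite -product_measure1E// /cons_measure /pushforward.
have beheadK (x : T) (t : n.-tuple T) : [tuple of behead (tuple_cons (x, t))] = t.
  exact: val_inj.
by congr ((mu \x nu)%E _); apply/seteqP; split => -[x t] /= []; rewrite beheadK.
Qed.

Let cons_measure_sigma_finite : sigma_finite setT cons_measure.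
Proof.
have /sigma_finiteP[F [TF ndF Foo]] := sigma_finiteT mu.
have /sigma_finiteP[G [TG ndG Goo]] := sigma_finiteT nu.
exists (fun k => [set t | F k (thead t) /\ G k [tuple of behead t]]).
  apply/esym; rewrite -subTset => t _.
  have : setT (thead t) by [].
  rewrite TF => -[i _ Fi].
  have : setT [tuple of behead t] by [].
  rewrite TG => -[j _ Gj].
  exists (maxn i j) => //; split.
    by move: Fi; exact/subsetPset/ndF/leq_maxl.
  by move: Gj; exact/subsetPset/ndG/leq_maxr.
move=> k; have [mF fF] := Foo k; have [mG fG] := Goo k; split.
  apply: measurableI.
    rewrite -[X in measurable X]setTI.
    exact: (@measurable_tnth _ T n.+1 ord0).
  by rewrite -[X in measurable X]setTI; exact: measurable_behead.
by rewrite cons_measureX// lte_mul_pinfty// ge0_fin_numE.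
Qed.

HB.instance Definition _ := Measure_isSigmaFinite.Build _ _ _ cons_measure
  cons_measure_sigma_finite.

End power_measure_step.

Fixpoint power_measure d (T : measurableType d) (R : realType)
    (mu : {sigma_finite_measure set T -> \bar R}) (n : nat) :
    {sigma_finite_measure set (n.-tuple T) -> \bar R} :=
  if n is m.+1 then cons_measure mu (power_measure mu m)
  else dirac [tuple].

Lemma power_measure_box d (T : measurableType d) (R : realType)
    (mu : {sigma_finite_measure set T -> \bar R}) (n : nat)
    (A : nat -> set T) : (forall i, measurable (A i)) ->
  power_measure mu n [set t : n.-tuple T | forall i : 'I_n, A i (tnth t i)] =
  (\prod_(i < n) mu (A i))%E.
Proof.
elim: n A => [|n IH] A mA.
  by rewrite big_ord0 /= diracE mem_set//= => -[].
rewrite big_ord_recl /= /cons_measure /pushforward.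
set B := [set t : n.-tuple T | forall i : 'I_n, A i.+1 (tnth t i)].
have -> : @tuple_cons _ T n @^-1` [set t | forall i : 'I_n.+1, A i (tnth t i)] = A 0%N `*` B.
  apply/seteqP; split => [[x t] /= h|[x t] [/= h0 h] i].
    split => /=; first exact: (h ord0).
    by move=> i; have := h (lift ord0 i); rewrite tnthS.
  have [j ->|->] := unliftP ord0 i; last by [].
  by rewrite tnthS; exact: h.
have mB : measurable B.
  have -> : B = \bigcap_(i in [set: 'I_n]) ((@tnth n T ^~ i) @^-1` A i.+1).
    apply/seteqP; split => t /= h i; first by move=> _; exact: h.
    exact: h i I.
  apply: fin_bigcap_measurable => // i _.
  by rewrite -[X in measurable X]setTI; exact: measurable_tnth.
rewrite product_measure1E//.
by rewrite (IH (fun i => A i.+1)).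
Qed.


(* Multigraphs: labelled vertices, labelled (hence ordered) edges, and an
   orientation e = (src e, tgt e) of every edge; parallel edges are allowed. *)

Record edge_ordered_graph (nv ne : nat) := EdgeOrderedGraph {
  src : 'I_ne -> 'I_nv;
  tgt : 'I_ne -> 'I_nv }.

Section graphs.
Variables nv ne : nat.
Implicit Type G : edge_ordered_graph nv ne.

Definition loopless G := forall e, src G e != tgt G e.

Definition adjacent G : rel 'I_nv := [rel u v |
  [exists e, ((src G e == u) && (tgt G e == v))
          || ((src G e == v) && (tgt G e == u))]].

Definition connected_graph G : bool :=
  [forall u, forall v, connect (adjacent G) u v].

End graphs.

(* The edges different from l and d, in the edge order. *)
Definition other_edges (ne : nat) (l d : 'I_ne) : seq 'I_ne :=
  [seq e <- enum 'I_ne | (e != l) && (e != d)].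

Lemma size_other_edges ne (l d : 'I_ne) :
  l != d -> size (other_edges l d) = ne.-2.
Proof.
move=> ld; have -> : size (other_edges l d) = #|~: [set l; d]%SET|.
  rewrite cardE /other_edges enumT; congr size; apply: eq_filter => e.
  by rewrite !inE negb_or.
by rewrite cardsCs finset.setCK cards2 ld card_ord subn2.
Qed.

Section configurations.
Variables (R : realType) (n : nat).

(* C^(n+1) as a real normed space: row i is (Re z_i, Im z_i). *)
Notation config := 'M[R]_(n.+1, 2).

Definition point (z : config) (i : 'I_n.+1) : R[i] := z i ord0 +i* z i ord_max.

Definition distinct_points : set config := [set z | injective (point z)].

(* Orbits of the affine group C^* |x C. *)
Definition same_orbit (z w : config) : Prop :=
  exists a b : R[i], a != 0 /\ forall i, point w i = a * point z i + b.

(* Every orbit of distinct points contains exactly one configuration with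
   z_1 = 0 and z_2 = 1 (see slice_orbit), so slice is a global chart of Z_n; it
   is holomorphic in w = (Re z_3, Im z_3, ..., Re z_(n+1), Im z_(n+1)). *)
Definition slice (w : (n.-1).*2.-tuple R) : config :=
  \matrix_(i, c) nth 0 [:: 0, 0, 1, 0 & w] (i.*2 + c).

(* The partial derivatives of slice (see slice_frameE), that is
   d/dx_3, d/dy_3, ..., d/dx_(n+1), d/dy_(n+1): a positively oriented frame for
   the standard complex orientation. *)
Definition slice_frame (j : 'I_(n.-1).*2) : config :=
  delta_mx (inord (j./2).+2) (inord (odd j)).

(* Differential k-forms, evaluated at a configuration and k tangent vectors. *)
Definition form (k : nat) : Type := config -> ('I_k -> config) -> R.

Definition function_d (f : config -> R) : config -> config -> R :=
  fun z => 'd f z.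

(* Normalized so that dx_1 /\ ... /\ dx_k is 1 on the standard frame. *)
Definition wedge (k : nat) (theta : 'I_k -> config -> config -> R) : form k :=
  fun z v => \det (\matrix_(i, j) theta i z (v j)).

(* Forms on Z_n are represented by their pullbacks to configuration space; the
   integral over Z_n is computed in the chart slice. *)
Definition Z_integral (omega : form (n.-1).*2) : R :=
  \int[power_measure (@lebesgue_measure R) (n.-1).*2]_(w in
      slice @^-1` distinct_points) omega (slice w) slice_frame.

Let point_slice (w : (n.-1).*2.-tuple R) (i : 'I_n.+1) :
  point (slice w) i = nth 0 [:: 0, 0, 1, 0 & w] i.*2
                   +i* nth 0 [:: 0, 0, 1, 0 & w] i.*2.+1.
Proof. by rewrite /point !mxE /= addn0 addn1. Qed.

Let coord (j : nat) (c : R[i]) : R := if odd j then complex.Im c else complex.Re c.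

Let tnth_slice (w : (n.-1).*2.-tuple R) (j : 'I_(n.-1).*2) :
  tnth w j = coord j (point (slice w) (inord (j./2).+2)).
Proof.
have jn : ((j./2).+2 < n.+1)%N.
  by move: (nat_of_ord j) (ltn_ord j) => k; lia.
rewrite point_slice inordK// !doubleS /= (tnth_nth 0) /coord.
have := odd_double_half j.
by case: odd => /= E; rewrite -[X in nth _ _ X = _]E.
Qed.

(* The slice meets every orbit of configurations of distinct points once. *)
Lemma slice_orbit (z : config) : (0 < n)%N -> distinct_points z ->
  exists! w, same_orbit z (slice w).
Proof.
move=> n0 zinj; pose i1 : 'I_n.+1 := inord 1.
have i1E : i1 = 1%N :> nat by rewrite /i1 inordK.
have z01 : point z i1 - point z ord0 != 0.
  by rewrite subr_eq0; apply/eqP => /zinj /(congr1 val) /=; rewrite i1E.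
pose a := (point z i1 - point z ord0)^-1; pose b := - (a * point z ord0).
pose w : (n.-1).*2.-tuple R :=
  [tuple coord j (a * point z (inord (j./2).+2) + b) | j < (n.-1).*2].
have slice0 v : point (slice v) ord0 = 0 by rewrite point_slice.
have slice1 v : point (slice v) i1 = 1 by rewrite point_slice i1E.
have nthw k (ik : (k.+2 < n.+1)%N) :
    (nth 0 w k.*2 = complex.Re (a * point z (Ordinal ik) + b)) *
    (nth 0 w k.*2.+1 = complex.Im (a * point z (Ordinal ik) + b)).
  have k1 : (k.*2.+1 < (n.-1).*2)%N by lia.
  have k0 : (k.*2 < (n.-1).*2)%N by exact: ltnW.
  have -> : Ordinal ik = inord k.+2 by apply: val_inj; rewrite /= inordK.
  split.
    have := tnth_mktuple (fun j : 'I_(n.-1).*2 =>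
      coord j (a * point z (inord (j./2).+2) + b)) (Ordinal k0).
    by rewrite (tnth_nth 0) /= => ->; rewrite /coord odd_double doubleK.
  have := tnth_mktuple (fun j : 'I_(n.-1).*2 =>
    coord j (a * point z (inord (j./2).+2) + b)) (Ordinal k1).
  by rewrite (tnth_nth 0) /= => ->; rewrite /coord /= odd_double /= uphalf_double.
exists w; split.
  exists a, b; split; first by rewrite invr_eq0.
  move=> [[|[|k]] ik].
  - have -> : Ordinal ik = ord0 by exact: val_inj.
    by rewrite slice0 subrr.
  - have -> : Ordinal ik = i1 by apply: val_inj; rewrite /= i1E.
    by rewrite slice1 -mulrBr mulVf.
  - by rewrite point_slice /= !(nthw _ ik); case: (_ + b).
move=> v [a' [b' [a'0 zv]]].
have b'E : b' = - (a' * point z ord0).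
  by have := zv ord0; rewrite slice0 => /esym/eqP; rewrite addrC addr_eq0 => /eqP.
have a'E : a' = a.
  have := zv i1; rewrite slice1 b'E -mulrBr => /esym h.
  by apply: (mulIf z01); rewrite h mulVf.
by apply: eq_from_tnth => j; rewrite tnth_mktuple (tnth_slice v) zv b'E a'E //.
Qed.

Lemma slice_distinct (z w : config) :
  same_orbit z w -> distinct_points z -> distinct_points w.
Proof.
move=> [a [b [a0 zw]]] inj_z i j; rewrite !zw => /addIr/(mulfI a0).
exact: inj_z.
Qed.

(* Column j of the Jacobian of slice: the entry (i, c) of slice w is
   coordinate 2 i + c - 4 of w (counting from 0). *)
Lemma slice_frameE (j : 'I_(n.-1).*2) i c :
  slice_frame j i c = ((i.*2 + c)%N == j.+4)%:R.
Proof.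
have jn : ((j./2).+2 < n.+1)%N.
  by move: (nat_of_ord j) (ltn_ord j) => k; lia.
rewrite mxE -!val_eqE /= inordK// inordK; last by case: odd.
congr (_%:R); have := odd_double_half j; have := ltn_ord c.
by move: (nat_of_ord i) (nat_of_ord c) => p q; lia.
Qed.

End configurations.

Section RW_integral.
Variables (R : realType) (n : nat) (G : edge_ordered_graph n.+1 (2 * n)).

(* |z_e|^2 *)
Definition edge_sqnorm (e : 'I_(2 * n)) (z : 'M[R]_(n.+1, 2)) : R :=
  complex.Re (`|point z (src G e) - point z (tgt G e)| ^+ 2).

(* Since l != d, other_edges l d has 2 n - 2 elements (size_other_edges), so
   the default value of nth plays no role. *)
Definition wedge_except (l d : 'I_(2 * n))
    (theta : 'I_(2 * n) -> 'M[R]_(n.+1, 2) -> 'M[R]_(n.+1, 2) -> R) :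
    form R n (n.-1).*2 :=
  wedge (fun i => theta (nth l (other_edges l d) i)).

(* Edges are numbered from 0, which changes l + d by 2 and not the sign. *)
Definition RW_form : form R n (n.-1).*2 := fun z v =>
  \sum_(l < 2 * n) \sum_(d < 2 * n | d != l)
    (-1) ^+ (l + d + (l < d)) * ln (edge_sqnorm l z)
    * wedge_except l d (fun e => function_d (fun x => ln (edge_sqnorm e x))) z v.

Definition RW_integral : R[i] :=
  if connected_graph G then
    (0 +i* (2 * pi)) ^- n.-1 * (Z_integral RW_form)%:C
  else 0.

End RW_integral.

(* Main.v *)
(* In the chart z_1 = 0, z_2 = 1 both sides are signed sums of the integrals
   I(a; e_1, ..., e_N) = int log|z_a|^2 d log|z_{e_1}|^2 /\ ... /\ d log|z_{e_N}|^2
   with N = 2n - 2.  Each of them converges absolutely: the complex structure J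
   carries every d log|z_e| to d arg z_e and |det J| = 1, so arguments may replace
   moduli, and the slopes Im z_e / Re z_e may serve as coordinates; on sectors
   where they are bounded (after multiplying edges by i) the integrand is dominated
   by inverse square roots of polynomials that are affine in each slope.  Stokes' theorem
   with a logarithmic cutoff then makes I antisymmetric in (a, e_r), hence
   alternating in all N + 1 slots, so that it only depends, up to sign, on the
   edge that is left out.  Both sides of the formula reduce to the same multiple
   of the alternating sum over the omitted edge.  If G is disconnected, rotating
   and translating one component gives a tangent vector that all d log(|z_e|/|z_d|)
   annihilate, so the right-hand side vanishes as well. *)
Require Import Defs.
From HB Require Import structures.
From mathcomp Require Import all_boot all_order all_algebra fingroup perm.
From mathcomp Require Import all_classical all_reals all_analysis measurable_realfun.
From mathcomp.real_closed Require Import complex.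
From mathcomp Require Import zify ring lra.

Set Implicit Arguments.
Unset Strict Implicit.
Unset Printing Implicit Defensive.

Import Order.TTheory GRing.Theory Num.Theory.
Import numFieldNormedType.Exports.

Local Open Scope classical_set_scope.
Local Open Scope ring_scope.

(** * Tonelli on tuples and the volume of parallelepipeds *)

(** Where no X_i vanishes, t is the slope vector of w exactly when (B - tA) w is a prescribed
    vector. The substitution is thus linear algebra, with Jacobian |det(B - tA)| / prod |X_i|, and
    on a sector the determinant of the d log|z_e|^2 is at most 2^N times this. Only log|X_a| remains
    to be integrated over a cube, and by Cramer's rule it is the logarithm of a quotient of
    polynomials affine in each slope. The exponent 1/2 survives iteration: integrating |A +
    sB|^(-1/2) over a bounded interval gives at most a constant times |A|^(-1/2), and also at most
    one times |B|^(-1/2).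

    A cutoff near z_u = z_v and near infinity creates error terms in Stokes' theorem. If it is a
    function of x_k = log|z_k|^2 / L, its differential is a bounded function times d log|z_k|^2 / L,
    again logarithmic; the 1/L turns log|z_a|^2 into x_a, which is bounded on the support. So the
    errors are dominated by finitely many integrable forms and tend to 0 pointwise. Here k runs over
    all pairs of vertices, which is why integrability is proved for arbitrary complex affine
    functions and not just for edges. *)

Definition RT (R : realType) : measurableType _ := measurableTypeR R.
Notation Tup R n := (n.-tuple (RT R)).
Notation Leb R n := (@power_measure _ (RT R) R (@lebesgue_measure R) n).

Section tonelli.
Context (R : realType).
Implicit Types n : nat.

Lemma ge0_integral_tuple_cons n (f : Tup R n.+1 -> \bar R) :
  measurable_fun setT f -> (forall t, 0 <= f t)%E ->
  (\int[Leb R n.+1]_t f t =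
   \int[Leb R n]_t \int[lebesgue_measure]_s f (tuple_cons (s, t)))%E.
Proof.
move=> mf f0.
rewrite /= ge0_integral_pushforward//; last exact: measurable_tuple_cons.
rewrite preimage_setT fubini_tonelli2//.
  by apply: measurableT_comp => //; exact: measurable_tuple_cons.
by move=> x; exact: f0.
Qed.

Lemma ge0_integral_tuple_cons' n (f : Tup R n.+1 -> \bar R) :
  measurable_fun setT f -> (forall t, 0 <= f t)%E ->
  (\int[Leb R n.+1]_t f t =
   \int[lebesgue_measure]_s \int[Leb R n]_t f (tuple_cons (s, t)))%E.
Proof.
move=> mf f0; rewrite ge0_integral_tuple_cons//.
rewrite -(fubini_tonelli (f \o @tuple_cons _ _ _))//.
  by apply: measurableT_comp => //; exact: measurable_tuple_cons.
by move=> x; exact: f0.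
Qed.

Lemma integral_tuple0 (f : Tup R 0 -> \bar R) :
  (\int[Leb R 0]_t f t = f [tuple])%E.
Proof.
rewrite /= integral_dirac//= ?diracT ?mul1e//.
have -> : f = cst (f [tuple]) by apply/funext => t; rewrite tuple0.
exact: measurable_cst.
Qed.

(** Both sides are measures in [A], so half-open intervals suffice; a negative [a] swaps the open
    end of the preimage. *)
Lemma lebesgue_measure_affine (a c : R) (A : set (measurableTypeR R)) : a != 0 ->
  measurable A ->
  (lebesgue_measure A = `|a|%:E *
     lebesgue_measure ((fun s => a * s + c : R)%R @^-1` A) :> \bar R)%E.
Proof.
move=> a0 mA; pose phi : measurableTypeR R -> measurableTypeR R := fun s => a * s + c.
have mphi : measurable_fun setT phi.
  by apply: measurable_funD => //; exact: measurable_funM.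
pose nu := mscale (NngNum (normr_ge0 a)) [the measure _ _ of pushforward (@lebesgue_measure R) phi].
rewrite -[RHS]/(nu mphi A).
apply: lebesgue_measure_unique => //= _ [[x y]] _ <-.
rewrite /nu /mscale /= /pushforward /=.
have [ap|an|ae] := ltgtP a 0; last by rewrite ae eqxx in a0.
  have -> : phi @^-1` `]x, y] = `[(y - c) / a, (x - c) / a[%classic.
    apply/seteqP; split => s /=; rewrite !in_itv/= /phi.
      by rewrite ler_ndivrMr// ltr_ndivlMr// [s * a]mulrC => /andP[? ?]; lra.
    by rewrite ler_ndivrMr// ltr_ndivlMr// [s * a]mulrC => /andP[? ?]; lra.
  rewrite !lebesgue_measure_itv/= !lte_fin ltr_nM2r ?invr_lt0// ltrD2r.
  case: ifPn => _; rewrite ?mule0// -!EFinD -EFinM; congr EFin.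
  by rewrite ltr0_norm//; field.
have -> : phi @^-1` `]x, y] = `](x - c) / a, (y - c) / a]%classic.
  apply/seteqP; split => s /=; rewrite !in_itv/= /phi.
    by rewrite ler_pdivlMr// ltr_pdivrMr// [s * a]mulrC => /andP[? ?]; lra.
  by rewrite ler_pdivlMr// ltr_pdivrMr// [s * a]mulrC => /andP[? ?]; lra.
rewrite !lebesgue_measure_itv/= !lte_fin ltr_pM2r ?invr_gt0// ltrD2r.
case: ifPn => _; rewrite ?mule0// -!EFinD -EFinM; congr EFin.
by rewrite gtr0_norm//; field.
Qed.

Lemma ge0_integral_affine (a c : R) (f : R -> \bar R) : a != 0 ->
  measurable_fun setT f -> (forall s, 0 <= f s)%E ->
  (`|a|%:E * \int[lebesgue_measure]_s f (a * s + c)%R =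
   \int[lebesgue_measure]_s f s)%E.
Proof.
move=> a0 mf f0.
pose phi : measurableTypeR R -> measurableTypeR R := fun s => a * s + c.
have mphi : measurable_fun setT phi.
  by apply: measurable_funD => //; exact: measurable_funM.
pose nu := mscale (NngNum (normr_ge0 a)) [the measure _ _ of pushforward (@lebesgue_measure R) phi].
have nuE A : measurable A -> lebesgue_measure A = nu mphi A.
  by move=> mA; rewrite (lebesgue_measure_affine c a0).
transitivity (\int[nu mphi]_s f s)%E; last first.
  by apply: eq_measure_integral => A mA _; exact/esym/nuE.
rewrite /nu ge0_integral_mscale//=; congr (_ * _)%E.
by rewrite ge0_integral_pushforward.
Qed.
End tonelli.

Section box.
Context (R : realType).

Lemma measurable_sup_box d (T : measurableType d) (I : finType) (f : I -> T -> R)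
  (e : R) : (forall i, measurable_fun setT (f i)) ->
  measurable [set z | forall i, `|f i z| < e].
Proof.
move=> mf.
have -> : [set z | forall i, `|f i z| < e] =
          \bigcap_(i in [set: I]) [set z | `|f i z| < e].
  by apply/seteqP; split => [z h i _|z h i]; [exact: h|exact: (h i)].
apply: fin_bigcap_measurable => // i _.
rewrite -[X in measurable X]setTI; apply: measurable_fun_ltr => //.
exact: measurableT_comp.
Qed.

Lemma measurable_fun_tnth d (T : measurableType d) n (g : T -> Tup R n) i :
  measurable_fun setT g -> measurable_fun setT (fun x => tnth (g x) i : R).
Proof. by move=> /measurable_fun_tnthP; exact. Qed.

Lemma measurable_fun_affine n (a : 'I_n -> R) (b : R) :
  measurable_fun setT (fun w : Tup R n => \sum_j a j * tnth w j + b).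
Proof.
apply: measurable_funD => //; apply: measurable_sum => j.
by apply: measurable_funM => //; exact: measurable_tnth.
Qed.

(** The unitriangular [U] subtracts multiples of column 0 to clear row [p] outside its pivot;
    expanding along that row leaves the Schur complement. *)
Lemma det_pivot n (M : 'M[R]_n.+1) p : M p ord0 != 0 ->
  `|\det M| = `|M p ord0| * `|\det (\matrix_(i, j) (M (lift p i) (lift ord0 j)
     - M (lift p i) ord0 / M p ord0 * M p (lift ord0 j)))|.
Proof.
move=> a0.
pose U : 'M[R]_n.+1 := \matrix_(j, k) ((j == k)%:R -
  ((j == ord0) && (k != ord0))%:R * (M p k / M p ord0)).
have dU : \det U = 1.
  rewrite -det_tr det_trig; last first.
    apply/is_trig_mxP => i j ij; rewrite !mxE.
    have -> : (j == i) = false by apply/negbTE; rewrite -val_eqE /=; lia.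
    have -> : (j == ord0) = false by apply/negbTE; rewrite -val_eqE /=; lia.
    by rewrite mul0r subr0.
  rewrite big1// => i _; rewrite !mxE eqxx.
  by case: eqP => //= _; rewrite ?mul0r subr0.
have MU i k : (M *m U) i k = M i k - (k != ord0)%:R * (M i ord0 / M p ord0 * M p k).
  rewrite mxE; under eq_bigr do rewrite mxE mulrBr.
  rewrite big_split /= (bigD1 k)//= eqxx mulr1 big1 ?addr0; last first.
    by move=> j jk; rewrite (negbTE jk) mulr0.
  rewrite (bigD1 ord0)//= big1 ?addr0; last first.
    by move=> j j0; rewrite (negbTE j0) mul0r mulr0 oppr0.
  by field.
have -> : \det M = \det (M *m U) by rewrite det_mulmx dU mulr1.
rewrite (expand_det_row _ p) (bigD1 ord0)//= big1 ?addr0; last first.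
  move=> k k0; rewrite MU k0 mul1r divff// mul1r subrr mul0r//.
rewrite MU eqxx mul0r subr0 normrM; congr (_ * _).
rewrite /cofactor normrM normrX normrN1 expr1n mul1r; congr (`| \det _ |).
by apply/matrixP => i j; rewrite mxE [in LHS]mxE MU /= mul1r mxE.
Qed.

(** The inequality also covers a singular [M], where the set may have infinite measure but is
    multiplied by 0. In the induction, the value of a form that involves the first coordinate
    replaces that coordinate, and the other forms become the Schur complement. *)
Lemma box_volume n (M : 'M[R]_n) (b : 'I_n -> R) (e : R) : 0 <= e ->
  (`|\det M|%:E * Leb R n [set w : Tup R n |
      forall i, (`|\sum_j M i j * tnth w j + b i| < e)%R]
    <= ((2 * e) ^+ n)%:E)%E.
Proof.
move=> e0; elim: n M b => [|n IH] M b.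
  rewrite det_mx00 normr1 mul1e expr0 /= diracE.
  by case: (_ \in _); rewrite lee_fin.
have [/forallP/= M0|] := boolP [forall p, M p ord0 == 0].
  have -> : \det M = 0.
    by rewrite (expand_det_col _ ord0) big1// => i _; rewrite (eqP (M0 i)) mul0r.
  by rewrite normr0 mul0e lee_fin exprn_ge0// mulr_ge0.
rewrite negb_forall => /existsP[p a0]; set a := M p ord0 in a0.
set S := [set w | _].
have mS : measurable S.
  by apply: measurable_sup_box => i; exact: measurable_fun_affine.
pose M2 : 'M[R]_n := \matrix_(i, j) (M (lift p i) (lift ord0 j)
     - M (lift p i) ord0 / a * M p (lift ord0 j)).
(* Here [s] is the value of the whole form [p]; eliminating the first coordinate moves its
   contribution to the constant terms. *)
pose b2 i s : R := M (lift p i) ord0 / a * (s - b p) + b (lift p i).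
pose S2 : set (RT R * Tup R n) := [set z | (`|z.1| < e) /\
   forall i, `|\sum_j M2 i j * tnth z.2 j + b2 i z.1| < e].
have mS2 : measurable S2.
  apply: measurableI.
    rewrite -[X in measurable X]setTI; apply: measurable_fun_ltr => //.
    exact: measurableT_comp.
  apply: measurable_sup_box => i; apply: measurable_funD.
    apply: measurable_sum => j; apply: measurable_funM => //.
    exact: (measurable_fun_tnth _ measurable_snd).
  apply: measurable_funD => //; apply: measurable_funM => //.
  exact: measurable_funB.
have key t s i : \sum_j M2 i j * tnth t j +
    b2 i (a * s + (\sum_(j < n) M p (lift ord0 j) * tnth t j + b p)) =
    \sum_j M (lift p i) j * tnth (tuple_cons (s, t)) j + b (lift p i).
  rewrite big_ord_recl /= /b2; under [in RHS]eq_bigr do rewrite tnthS.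
  have -> : \sum_j M2 i j * tnth t j =
      \sum_j M (lift p i) (lift ord0 j) * tnth t j -
      M (lift p i) ord0 / a * \sum_(j < n) M p (lift ord0 j) * tnth t j.
    rewrite mulr_sumr -sumrB; apply: eq_bigr => j _; rewrite mxE; ring.
  have -> : tnth (tuple_cons (s, t)) ord0 = s by [].
  by rewrite /=; field.
have mS2t t : measurable_fun setT (fun s : RT R => (\1_S2 (s, t))%:E : \bar R).
  by apply/measurable_EFinP; apply: measurableT_comp.
have IS t : (`|a|%:E * \int[lebesgue_measure]_s (\1_S (tuple_cons (s, t)))%:E
   = \int[lebesgue_measure]_s (\1_S2 (s, t))%:E)%E.
  pose c := \sum_(j < n) M p (lift ord0 j) * tnth t j + b p.
  rewrite -(@ge0_integral_affine R a c (fun s => (\1_S2 (s, t))%:E))//;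
    last exact: mS2t.
  congr (_ * _)%E; apply: eq_integral => s _; congr (_%:E).
  have E : a * s + c = \sum_j M p j * tnth (tuple_cons (s, t)) j + b p.
    rewrite big_ord_recl /= addrA; congr (_ + _ + _).
    by apply: eq_bigr => j _; rewrite tnthS.
  rewrite !indicE; congr (nat_of_bool _)%:R; apply/idP/idP; rewrite !inE.
    move=> wS; split => /=; first by rewrite E; exact: wS.
    by move=> i; rewrite key; exact: wS.
  move=> [/= h1 h2] i; have [j ->|->] := unliftP p i; last by rewrite -E.
  by rewrite -key; exact: h2.
have ? : measurable_fun setT (fun w => (\1_S w)%:E : \bar R).
  by apply/measurable_EFinP; exact: measurable_indic.
have ? : measurable_fun setT (fun w => (\1_S2 w)%:E : \bar R).
  by apply/measurable_EFinP; exact: measurable_indic.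
rewrite (det_pivot a0) -/a -/M2 -[X in Leb R _ X]setIT -integral_indic//.
rewrite ge0_integral_tuple_cons//.
rewrite [X in X%:E]mulrC EFinM -muleA -ge0_integralZl//; last 2 first.
  apply: (measurable_fun_fubini_tonelli_G
    (fun z : RT R * Tup R n => (\1_S (tuple_cons z))%:E)) => //.
  apply: (@measurableT_comp _ _ _ _ _ _ (fun w => (\1_S w)%:E)) => //.
  exact: measurable_tuple_cons.
  by move=> t _; apply: integral_ge0.
under eq_integral do rewrite IS.
rewrite -(fubini_tonelli (fun z => (\1_S2 z)%:E))//.
rewrite -ge0_integralZl//; last 2 first.
  exact: (measurable_fun_fubini_tonelli_F (fun z => (\1_S2 z)%:E)).
  by move=> t _; apply: integral_ge0.
(* The slice at [s] is empty unless |s| < e, so the outer integral supplies the remaining factor 2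
   e. *)
have IH2 s : (`|\det M2|%:E * \int[Leb R n]_t (\1_S2 (s, t))%:E <=
    ((2 * e) ^+ n * \1_(`]-e, e[ : set R) s)%:E)%E.
  have [se|se] := boolP (`|s| < e); last first.
    rewrite integral0_eq ?mule0 ?lee_fin ?mulr_ge0 ?exprn_ge0 ?mulr_ge0//.
    move=> t _; rewrite indicE memNset//= => -[/= s1 _].
    by rewrite s1 in se.
  rewrite indicE mem_set ?mulr1/=; last by rewrite in_itv/= -ltr_norml.
  apply: le_trans (IH M2 (b2 ^~ s)); rewrite lee_pmul//; first exact: integral_ge0.
  rewrite -[X in Leb R _ X]setIT -integral_indic//; last first.
    by apply: measurable_sup_box => i; exact: measurable_fun_affine.
  rewrite le_eqVlt; apply/orP; left; apply/eqP.
  apply: eq_integral => t _; congr (_%:E); rewrite !indicE.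
  congr (nat_of_bool _)%:R; apply/idP/idP; rewrite !inE /S2 /=; first by case.
  by move=> ?; split.
apply: (@le_trans _ _ (\int[lebesgue_measure]_s
    ((2 * e) ^+ n * \1_(`]-e, e[ : set R) s)%:E)%E).
  apply: ge0_le_integral => //.
  - by move=> s _; rewrite mule_ge0// integral_ge0.
  - apply: measurable_funeM.
    exact: (measurable_fun_fubini_tonelli_F (fun z => (\1_S2 z)%:E)).
  - by apply/measurable_EFinP; apply: measurable_funM.
under eq_integral do rewrite EFinM.
rewrite ge0_integralZl//=; last 2 first.
  by apply/measurable_EFinP; exact: measurable_indic.
  by rewrite lee_fin exprn_ge0// mulr_ge0.
rewrite integral_indic// setIT.
rewrite [X in (_ * X)%E](_ : _ = lebesgue_measure (`]-e, e[%classic : set R))//.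
rewrite lebesgue_measure_itv/= lte_fin.
case: ifPn => _; rewrite ?mule0 ?lee_fin ?exprn_ge0 ?mulr_ge0//.
by rewrite exprS opprK -mulr2n mulr_natl mulrC.
Qed.
End box.

(** * Inverse square roots of multiaffine functions *)

Section invsqrt.
Context (R : realType).
Implicit Types x y a b r s : R.

Definition rsqrt x : R := (Num.sqrt `|x|)^-1.

(* [1 / sqrt |x|], with its limit [+oo] at the origin. *)
Definition ersqrt x : \bar R := if x == 0 then +oo%E else (rsqrt x)%:E.

Lemma rsqrt_ge0 x : 0 <= rsqrt x.
Proof. by rewrite invr_ge0 sqrtr_ge0. Qed.

Lemma ersqrt_ge0 x : (0 <= ersqrt x)%E.
Proof. by rewrite /ersqrt; case: ifP => // _; rewrite lee_fin rsqrt_ge0. Qed.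

Lemma rsqrt_le_ersqrt x : ((rsqrt x)%:E <= ersqrt x)%E.
Proof. by rewrite /ersqrt; case: ifP => // _; rewrite leey. Qed.

Lemma measurable_rsqrt : measurable_fun setT rsqrt.
Proof.
have -> : rsqrt = (fun x => x `^ (- 2^-1)) \o Num.norm.
  by apply/funext => x /=; rewrite powRN powR12_sqrt.
by apply: measurableT_comp => //.
Qed.

Lemma measurable_ersqrt : measurable_fun setT ersqrt.
Proof.
apply: measurable_fun_ifT => //.
  exact: measurable_fun_eqr.
by apply/measurable_EFinP; exact: measurable_rsqrt.
Qed.

Lemma rsqrtM x y : rsqrt (x * y) = rsqrt x * rsqrt y.
Proof. by rewrite /rsqrt normrM sqrtrM// invfM. Qed.

Lemma ersqrtM x y : x != 0 -> ersqrt (x * y) = ((rsqrt x)%:E * ersqrt y)%E.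
Proof.
move=> x0; rewrite /ersqrt mulf_eq0 (negbTE x0)/=; case: ifP => _.
  by rewrite gt0_muley// lte_fin invr_gt0 sqrtr_gt0 normr_gt0.
by rewrite rsqrtM EFinM.
Qed.

Lemma rsqrt_le x y : x != 0 -> `|x| <= `|y| -> rsqrt y <= rsqrt x.
Proof.
move=> x0 xy; rewrite /rsqrt lef_pV2 ?posrE ?sqrtr_gt0 ?normr_gt0//.
  by rewrite ler_wsqrtr.
by rewrite -normr_gt0 (lt_le_trans _ xy)// normr_gt0.
Qed.

Lemma rsqrt_le1 x : 1 <= `|x| -> rsqrt x <= 1.
Proof.
move=> x1; have := @rsqrt_le 1 x (oner_neq0 _); rewrite normr1 => /(_ x1).
by rewrite {2}/rsqrt normr1 sqrtr1 invr1.
Qed.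

Lemma rsqrt_quarter x : rsqrt (4^-1 * x) = 2 * rsqrt x.
Proof.
rewrite rsqrtM; congr (_ * _); rewrite /rsqrt ger0_norm ?invr_ge0//.
have -> : 4^-1 = (2^-1) ^+ 2 :> R by field.
by rewrite sqrtr_sqr ger0_norm ?invr_ge0// invrK.
Qed.

(** The intervals [F n] avoid the singularity and exhaust []0, 1]]; on each of them the primitive 2
    sqrt s gives at most 2. *)
Lemma integral_ersqrt_oc :
  (\int[lebesgue_measure]_(s in `]0%R, 1%R]) ersqrt s <= 2%:E)%E.
Proof.
pose F n : set R := `[(n.+1%:R)^-1, 1]%classic.
have UF : `]0, 1]%classic = \bigcup_n F n.
  apply/seteqP; split => [x /=|x [n _ /=]].
    rewrite in_itv/= => /andP[x0 x1]; exists (Num.truncn x^-1) => //=.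
    rewrite /F /= in_itv/= x1 andbT -[leRHS]invrK lef_pV2 ?posrE ?invr_gt0//.
    by rewrite ltW// truncnS_gt.
  rewrite /F /= !in_itv/= => /andP[nx ->]; rewrite andbT.
  by apply: lt_le_trans nx; rewrite invr_gt0.
have ndF : nondecreasing_seq F.
  move=> m n mn; apply/subsetPset => x; rewrite /F /= !in_itv/= => /andP[mx ->].
  rewrite andbT (le_trans _ mx)// lef_pV2 ?posrE// ler_nat//.
have mF i : measurable (F i) by exact: measurable_itv.
have := @ge0_nondecreasing_set_cvg_integral _ (RT R) R F ersqrt (@lebesgue_measure R) ndF mF.
rewrite -UF => /(_ _ _)/cvg_lim <-//; last 2 first.
  by move=> i; apply: measurable_funTS; exact: measurable_ersqrt.
  by move=> *; exact: ersqrt_ge0.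
apply: lime_le.
  apply: ereal_nondecreasing_is_cvgn.
  apply: ge0_nondecreasing_set_nondecreasing_integral => //.
    by move=> i; apply: measurable_funTS; exact: measurable_ersqrt.
  by move=> *; exact: ersqrt_ge0.
apply: nearW => n.
have [->|n0] := eqVneq n 0%N.
  by rewrite /F invr1 set_itv1 integral_set1.
have n1 : (n.+1%:R)^-1 < 1 :> R by rewrite invf_lt1// ltr1n ltnS lt0n.
have np : 0 < (n.+1%:R)^-1 :> R by rewrite invr_gt0.
have E : {in F n, ersqrt =1 (fun s => (Num.sqrt s)^-1%:E)}.
  move=> s; rewrite inE /F/= in_itv/= => /andP[s1 _].
  have s0 : 0 < s by apply: lt_le_trans s1.
  by rewrite /ersqrt gt_eqF// /rsqrt gtr0_norm.
rewrite [leLHS](_ : _ = \int[lebesgue_measure]_(s in `[(n.+1%:R^-1)%R, 1%R])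
  (Num.sqrt s)^-1%:E)%E; last by apply: eq_integral => s; exact: E.
rewrite (@continuous_FTC2 R (fun s => (Num.sqrt s)^-1) (fun s => 2 * Num.sqrt s))//.
- rewrite -EFinD lee_fin sqrtr1 mulr1 lerBlDr lerDl mulr_ge0//.
- apply: continuous_in_subspaceT => s; rewrite inE/= in_itv/= => /andP[s1 _].
  have s0 : 0 < s by apply: lt_le_trans s1.
  by apply: continuousV; [rewrite gt_eqF// sqrtr_gt0|exact: sqrt_continuous].
- split => [s||].
  + rewrite in_itv/= => /andP[s1 _]; have s0 : 0 < s by apply: lt_trans s1.
    by apply: derivableM => //; apply: ex_derive; exact: is_derive1_sqrt.
  + apply: cvg_at_right_filter; apply: cvgM; first exact: cvg_cst.
    exact: sqrt_continuous.
  + apply: cvg_at_left_filter; apply: cvgM; first exact: cvg_cst.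
    exact: sqrt_continuous.
- move=> s; rewrite in_itv/= => /andP[s1 _].
  have s0 : 0 < s by apply: lt_trans s1.
  rewrite derive1E deriveM//=; last by apply: ex_derive; exact: is_derive1_sqrt.
  rewrite derive_cst scaler0 addr0 derive_sqrt// /GRing.scale/=.
  by rewrite invfM mulrA divff// mul1r.
Qed.
End invsqrt.

Lemma integral_indicM d (T : measurableType d) (R : realType)
    (mu : {measure set T -> \bar R}) (D : set T) (f : T -> \bar R) :
  (\int[mu]_x ((\1_D x)%:E * f x) = \int[mu]_(x in D) f x)%E.
Proof.
rewrite [RHS]integral_mkcond; apply: eq_integral => x _.
by rewrite patchE indicE; case: (x \in D); rewrite ?mul1e ?mul0e.
Qed.

Section invsqrt_integral.
Context (R : realType).
Implicit Types a b r s : R.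

Let mM (D : set R) (g : R -> \bar R) : measurable D -> measurable_fun setT g ->
  measurable_fun setT (fun s => (\1_D s)%:E * g s)%E.
Proof.
move=> mD mg; apply: emeasurable_funM => //.
by apply/measurable_EFinP; exact: measurable_indic.
Qed.

(** Reflection turns the negative half into the positive one; the value +oo at the origin sits on a
    null set. *)
Lemma integral_ersqrt :
  (\int[lebesgue_measure]_s ((\1_(`[-1, 1] : set R) s)%:E * ersqrt s) <= 4%:E)%E.
Proof.
pose h s : \bar R := ((\1_(`]0, 1] : set R) s)%:E * ersqrt s)%E.
pose k s : \bar R := ((\1_([set 0] : set R) s)%:E * ersqrt s)%E.
have mh : measurable_fun setT h by apply: mM => //; exact: measurable_ersqrt.
have mk : measurable_fun setT k by apply: mM => //; exact: measurable_ersqrt.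
have h0 s : (0 <= h s)%E by rewrite mule_ge0// ?lee_fin// ersqrt_ge0.
have k0 s : (0 <= k s)%E by rewrite mule_ge0// ?lee_fin// ersqrt_ge0.
have mhN : measurable_fun setT (fun s => h (-1 * s + 0)).
  by apply: measurableT_comp => //; apply: measurable_funD.
have -> : (\int[lebesgue_measure]_s ((\1_(`[-1, 1] : set R) s)%:E * ersqrt s) =
   \int[lebesgue_measure]_s (h s + (h (-1 * s + 0)%R + k s)))%E.
  apply: eq_integral => s _; rewrite /h /k !indicE.
  have -> : ersqrt (-1 * s + 0) = ersqrt s.
    by rewrite mulN1r addr0 /ersqrt oppr_eq0 /rsqrt normrN.
  have [s0|s0|->] := ltgtP s 0.
  - have -> : (s \in [set (0:R)]) = false by apply/memNset => /= ?; lra.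
    rewrite !mem_setE !in_itv/=.
    have -> : 0 < s = false by lra.
    have -> : (0 < -1 * s + 0) by lra.
    have -> : (-1 <= s <= 1) = (-1 * s + 0 <= 1) by lra.
    by rewrite !mul0e !adde0 add0e.
  - have -> : (s \in [set (0:R)]) = false by apply/memNset => /= ?; lra.
    rewrite !mem_setE !in_itv/=.
    have -> : (0 < -1 * s + 0) = false by lra.
    have -> : (-1 <= s <= 1) = (s <= 1) by lra.
    by rewrite s0 !mul0e !adde0.
  - have -> : ((0 : R) \in [set (0 : R)]) = true by apply/mem_set.
    rewrite !mem_setE !in_itv/= mulr0 addr0 ltxx/= !mul0e !add0e.
    by rewrite oppr_le0 ler01.
rewrite ge0_integralD//; last 2 first.
  by move=> s _; rewrite adde_ge0.
  exact: emeasurable_funD.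
rewrite ge0_integralD//.
have := @ge0_integral_affine R (-1) 0 h _ mh h0.
rewrite normrN1 mul1e oppr_eq0 oner_eq0 => /(_ isT) ->.
rewrite /h /k !integral_indicM integral_set1 adde0.
apply: (@le_trans _ _ (2%:E + 2%:E)%E).
  by rewrite leeD// integral_ersqrt_oc.
by rewrite -EFinD lee_fin; lra.
Qed.

(** The bound is uniform in [r]: 4 from the part |u| <= 1, and 4 from the length of an interval on
    the rest of which the integrand is at most 1. *)
Let integral_ersqrt_shift r :
  (\int[lebesgue_measure]_s ((\1_(`[-2, 2] : set R) s)%:E * ersqrt (s + r))
     <= 8%:E)%E.
Proof.
pose f u : \bar R := ((\1_(`[r - 2, r + 2] : set R) u)%:E * ersqrt u)%E.
have f0 u : (0 <= f u)%E by rewrite mule_ge0// ?lee_fin// ersqrt_ge0.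
have mf : measurable_fun setT f by apply: mM => //; exact: measurable_ersqrt.
have -> : (\int[lebesgue_measure]_s ((\1_(`[-2, 2] : set R) s)%:E * ersqrt (s + r))
    = \int[lebesgue_measure]_u f u)%E.
  have := @ge0_integral_affine R 1 r f (oner_neq0 _) mf f0.
  rewrite normr1 mul1e => <-; apply: eq_integral => s _; rewrite /f mul1r.
  congr (_ * _)%E; rewrite !indicE !mem_setE !in_itv/=.
  by congr (nat_of_bool _)%:R%:E; lra.
apply: (@le_trans _ _ (\int[lebesgue_measure]_u
   ((\1_(`[-1, 1] : set R) u)%:E * ersqrt u +
    (\1_(`[r - 2, r + 2] : set R) u)%:E))%E).
  apply: ge0_le_integral => //.
    apply: emeasurable_funD; first by apply: mM => //; exact: measurable_ersqrt.
    by apply/measurable_EFinP; exact: measurable_indic.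
  move=> u _; rewrite /f.
  have [u1|u1] := boolP (`|u| <= 1).
    rewrite [in leRHS]indicE mem_set ?mul1e/=; last by rewrite in_itv/= -ler_norml.
    rewrite indicE; case: (_ \in _); rewrite ?mul1e ?mul0e.
      by rewrite leeDl// lee_fin.
    by rewrite adde0 ersqrt_ge0.
  rewrite [X in (_ <= X%:E * _ + _)%E]indicE memNset; last first.
    by rewrite /= in_itv/= -ler_norml; apply/negP.
  rewrite mul0e add0e -[leRHS]mule1 lee_pmul//; first exact: ersqrt_ge0.
  rewrite /ersqrt; case: eqP => [u0|_]; first by rewrite u0 normr0 ler01 in u1.
  by rewrite lee_fin rsqrt_le1// ltW// ltNge.
rewrite ge0_integralD//; last 3 first.
- by move=> s _; rewrite mule_ge0// ?lee_fin// ersqrt_ge0.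
- by apply: mM => //; exact: measurable_ersqrt.
- by apply/measurable_EFinP; exact: measurable_indic.
apply: (@le_trans _ _ (4%:E + 4%:E)%E); last by rewrite -EFinD lee_fin; lra.
rewrite leeD ?integral_ersqrt// integral_indic// setIT.
rewrite [leLHS](_ : _ = lebesgue_measure (`[r - 2, r + 2]%classic : set R))//.
rewrite lebesgue_measure_itv/= lte_fin.
case: ifPn => _; rewrite -?EFinD lee_fin; lra.
Qed.

(** A bound by either coefficient lets the iteration continue with whichever is not identically
    zero. For b, rescale to the shifted case. For a, either |b| >= |a| / 4 and the bound by b
    suffices, or |s b| <= |a| / 2 keeps the argument away from 0. If the chosen coefficient is 0,
    the right-hand side is +oo. *)
Lemma integral_ersqrt_affine a b :
  (\int[lebesgue_measure]_s ((\1_(`[-2, 2] : set R) s)%:E * ersqrt (a + s * b))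
     <= 16%:E * ersqrt a)%E /\
  (\int[lebesgue_measure]_s ((\1_(`[-2, 2] : set R) s)%:E * ersqrt (a + s * b))
     <= 16%:E * ersqrt b)%E.
Proof.
have I0 : (0 <= \int[lebesgue_measure]_s
    ((\1_(`[-2, 2] : set R) s)%:E * ersqrt (a + s * b)))%E.
  by apply: integral_ge0 => s _; rewrite mule_ge0// ?lee_fin// ersqrt_ge0.
have Ib : b != 0 -> (\int[lebesgue_measure]_s
    ((\1_(`[-2, 2] : set R) s)%:E * ersqrt (a + s * b)) <= 8%:E * ersqrt b)%E.
  move=> b0.
  under eq_integral => s _.
    have -> : a + s * b = b * (s + a / b) by field.
    rewrite ersqrtM// muleCA; over.
  rewrite ge0_integralZl//; last 3 first.
  - apply: mM => //; apply: measurableT_comp; first exact: measurable_ersqrt.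
    exact: measurable_funD.
  - by move=> s _; rewrite mule_ge0// ?lee_fin// ersqrt_ge0.
  - by rewrite lee_fin rsqrt_ge0.
  rewrite muleC [ersqrt b]/ersqrt (negbTE b0).
  rewrite lee_pmul ?lee_fin ?rsqrt_ge0 ?integral_ersqrt_shift//.
  by apply: integral_ge0 => s _; rewrite mule_ge0// ?lee_fin// ersqrt_ge0.
split; last first.
  have [->|b0] := eqVneq b 0.
    by rewrite [ersqrt 0]/ersqrt eqxx gt0_muley ?leey// lte_fin.
  apply: le_trans (Ib b0) _; rewrite lee_pmul ?ersqrt_ge0// lee_fin; lra.
have [->|a0] := eqVneq a 0.
  by rewrite [ersqrt 0]/ersqrt eqxx gt0_muley ?leey// lte_fin.
have [ab|ab] := leP (4^-1 * `|a|) `|b|.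
  have b0 : b != 0.
    by rewrite -normr_gt0 (lt_le_trans _ ab)// mulr_gt0// normr_gt0.
  apply: le_trans (Ib b0) _; rewrite /ersqrt (negbTE b0) (negbTE a0).
  rewrite -!EFinM lee_fin.
  have : rsqrt b <= 2 * rsqrt a.
    rewrite -rsqrt_quarter rsqrt_le ?mulf_neq0//.
    by rewrite normrM ger0_norm.
  lra.
apply: (@le_trans _ _ (\int[lebesgue_measure]_s
   ((\1_(`[-2, 2] : set R) s)%:E * (2 * rsqrt a)%:E))%E).
  apply: ge0_le_integral => //.
  - by move=> s _; rewrite mule_ge0// ?lee_fin// ersqrt_ge0.
  - apply: mM => //; apply: measurableT_comp; first exact: measurable_ersqrt.
    by apply: measurable_funD => //; exact: measurable_funM.
  - exact: mM.
  move=> s _; rewrite indicE; case: (boolP (_ \in _)) => s2; last by rewrite !mul0e.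
  rewrite !mul1e; move: s2; rewrite mem_setE in_itv/= -ler_norml => s2.
  have H : `|4^-1 * a| <= `|a + s * b|.
    rewrite normrM ger0_norm//.
    have := lerB_dist a (- (s * b)); rewrite opprK normrN normrM => H.
    have := normr_ge0 a; have := normr_ge0 b; have := normr_ge0 s; nra.
  have q0 : 4^-1 * a != 0 by rewrite mulf_neq0.
  have n0 : a + s * b != 0.
    by rewrite -normr_gt0 (lt_le_trans _ H)// normr_gt0.
  by rewrite -rsqrt_quarter /ersqrt (negbTE n0) lee_fin rsqrt_le.
rewrite ge0_integralZr//; last 2 first.
  by apply/measurable_EFinP; exact: measurable_indic.
  by rewrite lee_fin mulr_ge0// rsqrt_ge0.
rewrite integral_indic// setIT.
rewrite [X in (X * _)%E](_ : _ = lebesgue_measure (`[-2, 2]%classic : set R))//.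
rewrite lebesgue_measure_itv/= lte_fin /ersqrt (negbTE a0).
have := rsqrt_ge0 a.
by case: ifPn => _ ?; rewrite -?EFinD -?EFinM lee_fin; lra.
Qed.

End invsqrt_integral.

Definition cube (R : realType) (n : nat) (K : R) : set (Tup R n) :=
  [set t | forall i, `|tnth t i| <= K].

Arguments cube {R} n K.

(** Polynomials of degree at most 1 in each variable, described by splitting off the first variable,
    which is the one that the iterated integrals remove. *)
Fixpoint multiaffine (R : realType) (n : nat) : (Tup R n -> R) -> Prop :=
  match n with
  | 0%N => fun _ => True
  | m.+1 => fun Q => exists A B : Tup R m -> R,
      [/\ multiaffine A, multiaffine B &
          forall s t, Q (tuple_cons (s, t)) = A t + s * B t]
  end.

Section multiaffine.
Context (R : realType).

Lemma measurable_cube n (K : R) : measurable (cube n K).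
Proof.
have -> : cube n K = \bigcap_(i in [set: 'I_n]) [set t | `|tnth t i| <= K].
  by apply/seteqP; split => [z h i _|z h i]; [exact: h|exact: (h i)].
apply: fin_bigcap_measurable => // i _.
rewrite -[X in measurable X]setTI; apply: measurable_fun_ler => //.
by apply: measurableT_comp => //; exact: measurable_fun_tnth.
Qed.

Lemma cube_cons n (K : R) s t :
  (\1_(cube n.+1 K) (tuple_cons (s, t)) = \1_(`[- K, K] : set R) s * \1_(cube n K) t :> R)%R.
Proof.
rewrite !indicE mem_setE in_itv/= -ler_norml -natrM mulnb; congr (nat_of_bool _)%:R.
apply/idP/andP; rewrite !inE.
  move=> h; split; first exact: (h ord0).
  by move=> i; have := h (lift ord0 i); rewrite tnthS.
move=> [h0 h] i; have [j ->|->] := unliftP ord0 i; last exact: h0.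
by rewrite tnthS; exact: h.
Qed.

Lemma tuple_cons_eta n (w : Tup R n.+1) :
  tuple_cons (thead w, [tuple of behead w]) = w.
Proof. by rewrite [RHS]tuple_eta; exact/val_inj. Qed.

Lemma measurable_multiaffine n (Q : Tup R n -> R) :
  multiaffine Q -> measurable_fun setT Q.
Proof.
elim: n Q => [|n IH] Q.
  move=> _; have -> : Q = cst (Q [tuple]) by apply/funext => t; rewrite tuple0.
  exact: measurable_cst.
move=> [A [B [/IH mA /IH mB QE]]].
have -> : Q = fun w => A [tuple of behead w] + thead w * B [tuple of behead w].
  by apply/funext => w; rewrite -QE tuple_cons_eta.
apply: measurable_funD.
  by apply: measurableT_comp => //; exact: measurable_behead.
apply: measurable_funM; first exact: (@measurable_fun_tnth _ _ _ n.+1 id ord0).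
by apply: measurableT_comp => //; exact: measurable_behead.
Qed.

(** Integrating out the first variable replaces [Q] by one of its two coefficients, at the cost of a
    factor 16. *)
Lemma integral_ersqrt_multiaffine n (Q : Tup R n -> R) :
  multiaffine Q -> (exists t, Q t != 0) ->
  (\int[Leb R n]_t ((\1_(cube n 2) t)%:E * ersqrt (Q t)) < +oo)%E.
Proof.
elim: n Q => [|n IH] Q maQ [t0 Qt0].
  rewrite integral_tuple0 -(tuple0 t0) /ersqrt (negbTE Qt0).
  by rewrite -EFinM ltry.
have [A [B [maA maB QE]]] := maQ.
have mm m (P : Tup R m -> R) : multiaffine P ->
  measurable_fun setT (fun t => (\1_(cube m 2) t)%:E * ersqrt (P t))%E.
  move=> /measurable_multiaffine mP; apply: emeasurable_funM.
    by apply/measurable_EFinP; apply: measurable_indic; exact: measurable_cube.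
  by apply: measurableT_comp => //; exact: measurable_ersqrt.
have m0 m (P : Tup R m -> R) t : (0 <= (\1_(cube m 2) t)%:E * ersqrt (P t))%E.
  by rewrite mule_ge0// ?lee_fin// ersqrt_ge0.
(* Since Q does not vanish at [t0], one of its coefficients does not vanish at the tail of [t0]. *)
have [P [maP Pn0 le_P]] : exists P : Tup R n -> R,
  [/\ multiaffine P, exists t, P t != 0 & forall t,
   (\int[lebesgue_measure]_s ((\1_(`[-2, 2] : set R) s)%:E * ersqrt (A t + s * B t))
     <= 16%:E * ersqrt (P t))%E].
  pose t' : Tup R n := [tuple of behead t0].
  have [At|At] := eqVneq (A t') 0.
    exists B; split => //; last by move=> t; exact: (integral_ersqrt_affine _ _).2.
    exists t'; apply: contra_neq Qt0 => Bt.
    by rewrite -(tuple_cons_eta t0) QE -/t' At Bt mulr0 addr0.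
  exists A; split => //; first by exists t'.
  by move=> t; exact: (integral_ersqrt_affine _ _).1.
rewrite ge0_integral_tuple_cons//; last exact: mm.
apply: (@le_lt_trans _ _ (\int[Leb R n]_t (16%:E *
   ((\1_(cube n 2) t)%:E * ersqrt (P t))))%E); last first.
  rewrite ge0_integralZl//; last exact: mm.
  by rewrite lte_mul_pinfty// IH.
apply: ge0_le_integral => //.
- by move=> t _; apply: integral_ge0.
- apply: (measurable_fun_fubini_tonelli_G (fun z : RT R * Tup R n =>
    (\1_(cube n.+1 2) (tuple_cons z))%:E * ersqrt (Q (tuple_cons z)))%E) => //.
  apply: (@measurableT_comp _ _ _ _ _ _
    (fun w => (\1_(cube n.+1 2) w)%:E * ersqrt (Q w))%E); first exact: mm.
  exact: measurable_tuple_cons.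
- by apply: measurable_funeM; exact: mm.
move=> t _.
under eq_integral do rewrite cube_cons QE EFinM muleAC muleC.
rewrite ge0_integralZl//; last 2 first.
- apply: emeasurable_funM.
    by apply/measurable_EFinP; exact: measurable_indic.
  apply: measurableT_comp; first exact: measurable_ersqrt.
  by apply: measurable_funD => //; exact: measurable_funM.
- by move=> s _; rewrite mule_ge0// ?lee_fin// ersqrt_ge0.
by rewrite muleCA lee_pmul//; apply: integral_ge0 => s _; rewrite mule_ge0// ?lee_fin// ersqrt_ge0.
Qed.
End multiaffine.

Section multiaffine_det.
Context (R : realType).

Lemma multiaffine_cst n (c : R) : multiaffine (fun _ : Tup R n => c).
Proof.
elim: n c => [//|n IH] c.
by exists (fun=> c), (fun=> 0); split => // s t; rewrite mulr0 addr0.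
Qed.

(** Each variable enters a single row, in which the determinant is linear. The offset [k] serves the
    induction: the first entry of [t] belongs to row k, and the earlier rows are already
    constant. *)
Lemma multiaffine_det n m k (a b : 'M[R]_m) :
  multiaffine (fun t : Tup R n => \det (\matrix_(i, j)
    (a i j + (if (k <= i)%N then nth 0 t (i - k) else 0) * b i j))).
Proof.
elim: n k a => [//|n IH] k a.
have [mk|km] := leqP m k.
  exists (fun=> \det a), (fun=> 0); split; try exact: multiaffine_cst.
  move=> s t; rewrite mulr0 addr0; congr (\det _); apply/matrixP => i j.
  by rewrite mxE leqNgt (leq_trans (ltn_ord i) mk) /= mul0r addr0.
pose p : 'I_m := Ordinal km.
pose a' : 'M[R]_m := \matrix_(i, j) (if i == p then b p j else a i j).
exists (fun t => \det (\matrix_(i, j)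
    (a i j + (if (k.+1 <= i)%N then nth 0 t (i - k.+1) else 0) * b i j))).
exists (fun t => \det (\matrix_(i, j)
    (a' i j + (if (k.+1 <= i)%N then nth 0 t (i - k.+1) else 0) * b i j))).
split; [exact: IH|exact: IH|move=> s t].
have key i : i != k -> (if (k < i)%N then nth 0 t (i - k.+1) else 0) =
    (if (k <= i)%N then nth 0 (tuple_cons (s, t)) (i - k) else 0) :> R.
  move=> ik; have [ki|ki] := ltnP k i.
    by rewrite (ltnW ki) -[(i - k)%N]prednK ?subn_gt0// subnS.
  by rewrite leqNgt ltn_neqAle ik ki.
rewrite -[X in X + _]mul1r; apply: (@determinant_multilinear _ _ _ _ _ p).
- apply/rowP => j; rewrite !mxE /= leqnn ltnn subnn eqxx !mul0r /=.
  by rewrite !addr0 mul1r.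
- apply/matrixP => i j; rewrite !mxE; congr (_ + _ * _).
  by apply: key; have := neq_lift p i; rewrite eq_sym -val_eqE.
- apply/matrixP => i j; rewrite !mxE eq_sym (negbTE (neq_lift _ _)); congr (_ + _ * _).
  by apply: key; have := neq_lift p i; rewrite eq_sym -val_eqE.
Qed.

Lemma multiaffine_det0 n m (a b : 'M[R]_m) :
  multiaffine (fun t : Tup R n =>
    \det (\matrix_(i, j) (a i j + nth 0 t i * b i j))).
Proof.
have := @multiaffine_det n m 0 a b; congr (multiaffine _); apply/funext => t.
by congr (\det _); apply/matrixP => i j; rewrite !mxE subn0.
Qed.

(** The neighbourhood filter of [t0] for the maximum norm. *)
Definition box_nbhs n (t0 : Tup R n) : set_system (Tup R n) :=
  [set A | exists2 e : R, 0 < e &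
     forall t, (forall i, `|tnth t i - tnth t0 i| < e) -> A t].

Global Instance box_nbhs_filter n (t0 : Tup R n) : Filter (box_nbhs t0).
Proof.
split => [|P Q [e e0 Pe] [f f0 Qf]|P Q PQ [e e0 Pe]].
- by exists 1.
- exists (Num.min e f); first by rewrite lt_min e0.
  move=> t tt0; split; [apply: Pe|apply: Qf] => i.
    by have := tt0 i; rewrite lt_min => /andP[].
  by have := tt0 i; rewrite lt_min => /andP[].
- by exists e => // t /Pe/PQ.
Qed.

Lemma multiaffine_cvg n (Q : Tup R n -> R) t0 :
  multiaffine Q -> Q t @[t --> box_nbhs t0] --> Q t0.
Proof.
elim: n Q t0 => [|n IH] Q t0.
  move=> _; have -> : Q = cst (Q t0) by apply/funext => t; rewrite tuple0 (tuple0 t0).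
  exact: cvg_cst.
move=> [A [B [mA mB QE]]].
have -> : Q = fun w => A [tuple of behead w] + thead w * B [tuple of behead w].
  by apply/funext => w; rewrite -QE tuple_cons_eta.
have bh : (fun w : Tup R n.+1 => [tuple of behead w] : Tup R n) @ box_nbhs t0 -->
    box_nbhs ([tuple of behead t0] : Tup R n).
  move=> P [e e0 Pe]; exists e => // t tt0; apply: Pe => i.
  have bE (w : Tup R n.+1) : tnth [tuple of behead w] i = tnth w (lift ord0 i).
    by rewrite -[in RHS](tuple_cons_eta w) tnthS.
  by rewrite !bE; exact: tt0.
apply: cvgD; first exact: (cvg_comp _ _ bh (IH _ _ mA)).
apply: cvgM; last exact: (cvg_comp _ _ bh (IH _ _ mB)).
apply/cvgrPdist_lt => e e0; exists e => // t /(_ ord0).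
by rewrite distrC.
Qed.
End multiaffine_det.

(** * Integration over slopes *)

Lemma limn_einf_ge (R : realType) (u : (\bar R)^nat) (c : \bar R) :
  (\forall n \near \oo, (c <= u n)%E) -> (c <= limn_einf u)%E.
Proof.
move=> [N _ Nu]; rewrite limn_einf_lim.
rewrite (cvg_lim _ (@cvg_einfs_sup _ u))//.
apply: (@le_trans _ _ (einfs u N)); last by apply: ereal_sup_ubound; exists N.
by apply: le_ereal_inf_tmp => _ [k /= Nk <-]; exact: Nu.
Qed.

Lemma limn_einf_le (R : realType) (u : (\bar R)^nat) (c : \bar R) :
  (forall n, (u n <= c)%E) -> (limn_einf u <= c)%E.
Proof.
move=> uc; rewrite limn_einf_lim (cvg_lim _ (@cvg_einfs_sup _ u))//.
apply: ge_ereal_sup => _ [n _ <-]; apply: le_trans (uc n).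
by apply: ereal_inf_lbound; exists n => /=.
Qed.

Section slope_integral.
Context (R : realType).
Local Notation mu n := (Leb R n).

(** Used with a := B and b := - A: row i is then the gradient in w of Y_i - t_i X_i. *)
Definition slope_mx m n (a b : 'M[R]_m) (t : Tup R n) : 'M[R]_m :=
  \matrix_(i, j) (a i j + nth 0 t i * b i j).

Lemma power_measure_itv n (c e : 'I_n -> R) : (forall i, 0 < e i) ->
  mu n [set t : Tup R n | forall i, `|tnth t i - c i| < e i] =
  (\prod_(i < n) (2 * e i))%:E.
Proof.
move=> e0.
pose A k : set (measurableTypeR R) :=
  if insub k is Some i then `]c i - e i, c i + e i[%classic else set0.
have -> : [set t : Tup R n | forall i, `|tnth t i - c i| < e i] =
  [set t : Tup R n | forall i : 'I_n, A i (tnth t i)].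
  apply/seteqP; split => t /= h i; have := h i; rewrite /A valK/= in_itv/=.
    by rewrite ltr_distl => /andP[-> ->].
  by rewrite ltr_distl.
rewrite power_measure_box; last first.
  by move=> k; rewrite /A; case: insubP.
rewrite -prodEFin; apply: eq_bigr => i _; rewrite /A valK.
rewrite [LHS](_ : _ = lebesgue_measure (`]c i - e i, c i + e i[%classic : set R))//.
rewrite lebesgue_measure_itv/= lte_fin ifT; last first.
  by have := e0 i; lra.
by rewrite -EFinD; congr (_%:E); lra.
Qed.

(** The change of variables t = slope w, as an upper bound, which is all that integrability
    requires. The condition on t and w is linear in w for fixed t and defines a box in t for fixed
    w, so one kernel can be integrated in either order. *)
Theorem slope_integral_le n (A B : 'M[R]_n) (a b : 'I_n -> R)
    (X := fun i (w : Tup R n) => \sum_j A i j * tnth w j + a i)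
    (Y := fun i (w : Tup R n) => \sum_j B i j * tnth w j + b i)
    (slope := fun w => [tuple Y i w / X i w | i < n] : Tup R n)
    (E : set (Tup R n)) (W g : Tup R n -> R) :
  measurable E -> measurable_fun setT W -> (forall t, 0 <= W t) ->
  measurable_fun E g -> (forall w, E w -> 0 <= g w) ->
  (forall w, E w -> forall i, X i w != 0 /\ `|Y i w| <= `|X i w|) ->
  (forall w, E w -> W t @[t --> box_nbhs (slope w)] --> W (slope w)) ->
  (forall w, E w -> g w <=
     W (slope w) * `|\det (slope_mx B (- A) (slope w))| / \prod_i `|X i w|) ->
  (\int[mu n]_(w in E) (g w)%:E <=
   \int[mu n]_t ((\1_(cube n 2) t)%:E * (W t)%:E))%E.
Proof.
move=> mE mW W0 mg g0 EX Wcvg gW.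
pose D (t : Tup R n) : R := `|\det (slope_mx B (- A) t)|.
have maD : multiaffine (fun t : Tup R n => \det (slope_mx B (- A) t)).
  exact: multiaffine_det0.
have mD : measurable_fun setT D.
  by apply: measurableT_comp => //; exact: measurable_multiaffine.
pose V (t : Tup R n) : R := W t * D t.
have mV : measurable_fun setT V by exact: measurable_funM.
have V0 t : 0 <= V t by rewrite /V mulr_ge0 // /D normr_ge0.
pose eps k : R := k.+1%:R^-1.
have eps0 k : 0 < eps k by rewrite invr_gt0.
pose S k : set (Tup R n * Tup R n) := [set z | forall i,
   `|Y i z.2 - tnth z.1 i * X i z.2| < eps k].
have mX i : measurable_fun setT (X i) by exact: measurable_fun_affine.
have mY i : measurable_fun setT (Y i) by exact: measurable_fun_affine.
have mS k : measurable (S k).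
  apply: measurable_sup_box => i; apply: measurable_funB.
    exact: measurableT_comp.
  apply: measurable_funM; last exact: measurableT_comp.
  exact: measurable_fun_tnth.
(* An approximation of V (t) times the delta function of the equations Y_i - t_i X_i = 0. *)
pose h k (z : Tup R n * Tup R n) : R :=
  \1_(cube n 2) z.1 * V z.1 / (2 * eps k) ^+ n * \1_(S k) z.
have e2n k : 0 < (2 * eps k) ^+ n by rewrite exprn_gt0// mulr_gt0.
have cge0 k t : 0 <= \1_(cube n 2) t * V t / (2 * eps k) ^+ n.
  by rewrite divr_ge0 ?(ltW (e2n k))// mulr_ge0.
have h0 k z : 0 <= h k z by rewrite /h mulr_ge0.
have mh k : measurable_fun setT (h k).
  apply: measurable_funM => //; apply: measurable_funM => //.
  apply: measurable_funM; last exact: measurableT_comp.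
  by apply: measurableT_comp => //; apply: measurable_indic; exact: measurable_cube.
pose F k (w : Tup R n) := (\int[mu n]_t (h k (t, w))%:E)%E.
have mF k : measurable_fun setT (F k).
  apply: (measurable_fun_fubini_tonelli_G (fun z => (h k z)%:E)) => //.
    exact/measurable_EFinP.
  by move=> z; rewrite lee_fin.
have F0 k w : (0 <= F k w)%E by apply: integral_ge0 => t _; rewrite lee_fin.
(* Integrating in w first, [box_volume] cancels the factor D of V against (2 eps)^n and leaves W. *)
have le_F k : (\int[mu n]_w F k w <=
    \int[mu n]_t ((\1_(cube n 2) t)%:E * (W t)%:E))%E.
  rewrite -(fubini_tonelli (fun z => (h k z)%:E))//; last 2 first.
    exact/measurable_EFinP.
    by move=> z; rewrite lee_fin.
  apply: ge0_le_integral => //.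
  - by move=> t _; apply: integral_ge0 => w _; rewrite lee_fin.
  - apply: (measurable_fun_fubini_tonelli_F (fun z => (h k z)%:E)) => //.
      exact/measurable_EFinP.
    by move=> z; rewrite lee_fin.
  - apply: emeasurable_funM; last exact/measurable_EFinP.
    by apply/measurable_EFinP; apply: measurable_indic; exact: measurable_cube.
  move=> t _; set c := \1_(cube n 2) t * V t / (2 * eps k) ^+ n.
  have c0 : 0 <= c by exact: cge0.
  rewrite /h /= -/c; under eq_integral do rewrite EFinM.
  pose bt i := b i - tnth t i * a i.
  have SE w : \1_(S k) (t, w) = \1_[set w : Tup R n | forall i,
      `|\sum_j slope_mx B (- A) t i j * tnth w j + bt i| < eps k] w :> R.
    have E1 i : \sum_j slope_mx B (- A) t i j * tnth w j + bt i =
        Y i w - tnth t i * X i w.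
      rewrite /X /Y /bt mulrDr opprD addrACA mulr_sumr -sumrB; congr (_ + _).
      apply: eq_bigr => j _; rewrite !mxE (tnth_nth 0 t); ring.
    rewrite !indicE; congr (nat_of_bool _)%:R.
    by apply/idP/idP; rewrite !inE => + i => /(_ i)/=; rewrite E1.
  under eq_integral do rewrite SE.
  rewrite ge0_integralZl//; last first.
    apply/measurable_EFinP; apply: measurable_indic.
    by apply: measurable_sup_box => i; exact: measurable_fun_affine.
  rewrite integral_indic//; last first.
    by apply: measurable_sup_box => i; exact: measurable_fun_affine.
  rewrite setIT.
  have := box_volume (slope_mx B (- A) t) bt (ltW (eps0 k)).
  rewrite -/(D t); set m := power_measure _ _ _ => Dm.
  have m0 : (0 <= m)%E by exact: measure_ge0.
  rewrite /c /V (_ : _ / _ = \1_(cube n 2) t * W t / (2 * eps k) ^+ n * D t);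
    last by ring.
  rewrite EFinM -muleA; apply: le_trans (lee_wpmul2l _ Dm) _.
    by rewrite lee_fin divr_ge0 ?exprn_ge0 ?mulr_ge0// ltW.
  rewrite -!EFinM lee_fin divfK// expf_neq0// mulf_neq0//.
  by rewrite gt_eqF.
(* For fixed w the kernel is supported in a box around slope w with sides 2 eps / |X_i|, on which V
   is close to its value at the centre; Fatou's lemma then gives the claim. *)
have liminf_F w : E w -> ((V (slope w) / \prod_i `|X i w|)%:E <=
    limn_einf (F ^~ w))%E.
  move=> Ew; set t1 := slope w; set P := \prod_i `|X i w|.
  have X0 i : 0 < `|X i w| by rewrite normr_gt0; exact: (EX w Ew i).1.
  have P0 : 0 < P by exact: prodr_gt0.
  have t1E i : tnth t1 i = Y i w / X i w by rewrite tnth_mktuple.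
  have t1_le i : `|tnth t1 i| <= 1.
    by rewrite t1E normrM normfV ler_pdivrMr// mul1r; exact: (EX w Ew i).2.
  apply/lee_addgt0Pr => e e0; rewrite -leeBlDr// -EFinD.
  have Vcvg : V t @[t --> box_nbhs t1] --> V t1.
    by apply: cvgM; [exact: Wcvg|apply: cvg_norm; exact: multiaffine_cvg].
  have [d d0 Vd] : box_nbhs t1 [set t | V t1 - e * P <= V t].
    have /cvgrPdist_lt/(_ (e * P)) := Vcvg; rewrite mulr_gt0// => /(_ isT).
    apply: filterS => t /=; rewrite ltr_norml => /andP[_ ?]; lra.
  apply: limn_einf_ge.
  have : \forall k \near \oo, forall i, eps k < `|X i w| * Num.min d 1.
    apply: filter_forall => i; have r0 : 0 < `|X i w| * Num.min d 1.
      by rewrite mulr_gt0// lt_min d0 ltr01.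
    near=> k; rewrite /eps invf_plt ?posrE//.
    apply: lt_le_trans (truncnS_gt _) _; rewrite ler_nat ltnS.
    by near: k; exact: nbhs_infty_ge.
  apply: filterS => k kX.
  (* If V comes out below e P, the lower bound is negative and nothing is to be shown. *)
  have [c0|c0] := ltP (V t1 - e * P) 0.
    apply: le_trans (F0 k w); rewrite lee_fin.
    have : (V t1 - e * P) / P < 0 by rewrite pmulr_llt0// invr_gt0.
    by rewrite mulrBl mulfK ?gt_eqF//; lra.
  have Bd i (t : Tup R n) : (forall i, `|tnth t i - tnth t1 i| < eps k / `|X i w|) ->
      `|tnth t i - tnth t1 i| < Num.min d 1.
    by move=> tt1; apply: lt_trans (tt1 i) _; rewrite ltr_pdivrMr// mulrC.
  pose Bx := [set t : Tup R n | forall i, `|tnth t i - tnth t1 i| < eps k / `|X i w|].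
  have mBx : measurable Bx.
    have -> : Bx = \bigcap_(i in [set: 'I_n])
        [set t | `|tnth t i - tnth t1 i| < eps k / `|X i w|].
      by apply/seteqP; split => [z H i _|z H i]; [exact: H|exact: (H i)].
    apply: fin_bigcap_measurable => // i _.
    rewrite -[X in measurable X]setTI; apply: measurable_fun_ltr => //.
    apply: measurableT_comp => //; apply: measurable_funB => //.
    exact: measurable_fun_tnth.
  have -> : (V t1 / P - e)%:E =
     (\int[mu n]_t (((V t1 - e * P) / (2 * eps k) ^+ n)%:E * (\1_Bx t)%:E))%E.
    rewrite ge0_integralZl//; last 2 first.
      by apply/measurable_EFinP; exact: measurable_indic.
      by rewrite lee_fin divr_ge0 ?exprn_ge0 ?mulr_ge0// ltW.
    rewrite integral_indic// setIT.
    rewrite [X in (_ * X)%E](_ : _ = (\prod_(i < n) (2 * (eps k / `|X i w|)))%:E);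
        last first.
      apply: (@power_measure_itv n (tnth t1) (fun i => eps k / `|X i w|)) => i.
      by rewrite divr_gt0.
    rewrite -EFinM; congr (_%:E).
    under eq_bigr do rewrite mulrA.
    rewrite big_split /= prodr_const card_ord prodfV -/P.
    rewrite mulrA divfK ?mulrBl ?mulfK ?gt_eqF//.
  apply: ge0_le_integral => //.
  - by move=> t _; rewrite -EFinM lee_fin mulr_ge0// divr_ge0 ?exprn_ge0 ?mulr_ge0// ltW.
  - by apply: measurable_funeM; apply/measurable_EFinP; exact: measurable_indic.
  - apply/measurable_EFinP; apply: measurableT_comp; first exact: mh.
    exact: pair2_measurable.
  move=> t _; rewrite -EFinM lee_fin [in leLHS]indicE.
  have [tB|_] := boolP (t \in Bx); last by rewrite mulr0.
  move: tB; rewrite inE => tB; rewrite mulr1 /h /=.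
  (* The slopes are at most 1 and the box has radius below 1, which is why the cube has half-width
     2. *)
  have -> : \1_(cube n 2) t = 1 :> R.
    rewrite indicE mem_set// => i; have := Bd i t tB; rewrite lt_min => /andP[_ h1].
    have := ler_normD (tnth t i - tnth t1 i) (tnth t1 i); rewrite subrK.
    have := t1_le i; lra.
  have -> : \1_(S k) (t, w) = 1 :> R.
    rewrite indicE mem_set// => i /=; have := tB i; rewrite ltr_pdivlMr// -normrM t1E.
    rewrite mulrBl divfK; last exact: (EX w Ew i).1.
    by rewrite distrC.
  rewrite mulr1 mul1r ler_pM2r ?invr_gt0 ?exprn_gt0 ?mulr_gt0//.
  apply: Vd => i; have := Bd i t tB; by rewrite lt_min => /andP[].
apply: (@le_trans _ _ (\int[mu n]_(w in E) limn_einf (F ^~ w))%E).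
  apply: ge0_le_integral => //.
  - exact/measurable_EFinP.
  - rewrite /limn_einf; apply: measurableT_comp => //.
    apply: measurable_fun_limn_esup => k; apply: measurableT_comp => //.
    exact: measurable_funTS.
  - by move=> w Ew; apply: le_trans (liminf_F w Ew); rewrite lee_fin gW.
apply: le_trans (fatou _ mE _ _) _ => //.
  by move=> k; exact: measurable_funTS.
apply: limn_einf_le => k; apply: le_trans (le_F k).
exact: ge0_subset_integral.
Unshelve. all: by end_near. Qed.
End slope_integral.

(** * Integrability of logarithmic forms *)

Section bounds.
Context (R : realType).

Lemma multiaffine_bounded n (K : R) (Q : Tup R n -> R) : multiaffine Q ->
  exists2 C, 0 <= C & forall t, cube n K t -> `|Q t| <= C.
Proof.
elim: n Q => [|n IH] Q.
  move=> _; exists `|Q [tuple]| => // t _; by rewrite tuple0.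
move=> [A [B [/IH [C C0 AC] /IH [C' C'0 BC] QE]]].
exists (C + `|K| * C') => [|t tK]; first by rewrite addr_ge0// mulr_ge0.
rewrite -(tuple_cons_eta t) QE.
have bK : cube n K ([tuple of behead t] : Tup R n).
  move=> i; have := tK (lift ord0 i).
  by rewrite -[in tnth t _](tuple_cons_eta t) tnthS.
apply: le_trans (ler_normD _ _) _; apply: lerD; first exact: AC.
rewrite normrM ler_pM ?BC//.
have := tK ord0; rewrite -/(thead t) => ?; apply: le_trans (ler_norm _); exact: tK.
Qed.

(** Apply ln y <= y to x and to 1 / sqrt x. *)
Lemma norm_ln_le (x : R) : 0 < x -> `|ln x| <= x + 2 * rsqrt x.
Proof.
move=> x0; have r0 := rsqrt_ge0 x.
have ln1 (y : R) : 0 < y -> ln y <= y.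
  by move=> y0; rewrite ltW// ln_sublinear.
have := ln1 _ x0.
have : ln (rsqrt x) <= rsqrt x.
  by apply: ln1; rewrite invr_gt0 sqrtr_gt0 normr_gt0 gt_eqF.
have -> : ln (rsqrt x) = - (2^-1 * ln x).
  rewrite /rsqrt gtr0_norm// lnV ?posrE ?sqrtr_gt0//.
  by rewrite -[Num.sqrt x]powR12_sqrt ?ln_powR// ltW.
by move=> ? ?; rewrite ler_norml; lra.
Qed.

Lemma cube_lty n (K : R) : (Leb R n (cube n K) < +oo)%E.
Proof.
pose B := [set t : Tup R n | forall i, `|tnth t i - 0| < `|K| + 1].
have BE : Leb R n B = (\prod_(i < n) (2 * (`|K| + 1)))%:E.
  apply: (@power_measure_itv R n (fun=> 0) (fun=> `|K| + 1)) => i.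
  by have := normr_ge0 K; lra.
have mB : measurable B.
  have -> : B = [set t : Tup R n | forall i, `|tnth t i| < `|K| + 1].
    by apply/seteqP; split => t /= h i; have := h i; rewrite subr0.
  by apply: measurable_sup_box => i; exact: measurable_fun_tnth.
apply: (@le_lt_trans _ _ (Leb R n B)); last by rewrite BE ltry.
apply: le_measure; rewrite ?inE//; first exact: measurable_cube.
move=> t tK i /=; rewrite subr0; have := tK i; have := ler_norm K; lra.
Qed.

Lemma cvg_rsqrt T (F : set_system T) (FF : Filter F) (f : T -> R) (l : R) :
  l != 0 -> f @ F --> l -> rsqrt (f x) @[x --> F] --> rsqrt l.
Proof.
move=> l0 fl; apply: cvgV; first by rewrite gt_eqF// sqrtr_gt0 normr_gt0.
apply: (cvg_comp _ _ (cvg_norm fl)); exact: sqrt_continuous.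
Qed.
End bounds.

(** * Complex affine functions and their logarithmic forms *)

Section complex_affine.
Context (R : realType) (n : nat) (J : 'M[R]_n).

(* The complex affine function [reX + i imX] on R^n, for the complex structure
   given by right multiplication of covectors by J. *)
Record caff := Caff { crow : 'rV[R]_n; cre : R; cim : R }.

Definition reX (p : caff) (w : Tup R n) : R :=
  \sum_j crow p 0 j * tnth w j + cre p.
Definition imX (p : caff) (w : Tup R n) : R :=
  \sum_j (crow p *m J) 0 j * tnth w j + cim p.
Definition sqn p w := reX p w ^+ 2 + imX p w ^+ 2.
Definition dsqn p w j := 2 * (reX p w * crow p 0 j + imX p w * (crow p *m J) 0 j).
Definition dlog p w j := dsqn p w j / sqn p w.

(** Multiplication by the imaginary unit: X + iY becomes - Y + iX. *)
Definition muli (p : caff) := Caff (- (crow p *m J)) (- cim p) (cre p).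

Lemma sqn_ge0 p w : 0 <= sqn p w.
Proof. by rewrite addr_ge0// sqr_ge0. Qed.

Lemma measurable_reX p : measurable_fun setT (reX p).
Proof. exact: measurable_fun_affine. Qed.

Lemma measurable_imX p : measurable_fun setT (imX p).
Proof. exact: measurable_fun_affine. Qed.

Lemma measurable_sqn p : measurable_fun setT (sqn p).
Proof.
by apply: measurable_funD; apply: measurable_funX;
  [exact: measurable_reX|exact: measurable_imX].
Qed.

Lemma measurable_dlog p j : measurable_fun setT (dlog p ^~ j).
Proof.
apply: measurable_funM.
  apply: measurable_funM => //; apply: measurable_funD; apply: measurable_funM => //.
    exact: measurable_reX.
  exact: measurable_imX.
have -> : (fun w => (sqn p w)^-1) = (fun x => x `^ (-1)) \o sqn p.
  by apply/funext => w /=; rewrite powR_inv1// sqn_ge0.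
by apply: measurableT_comp => //; exact: measurable_sqn.
Qed.

(** The density of log|a|^2 times the wedge of the d log|e_i|^2 with respect to Lebesgue measure. *)
Definition logform (a : caff) (e : 'I_n -> caff) (w : Tup R n) : R :=
  ln (sqn a w) * \det (\matrix_(i, j) dlog (e i) w j).

Lemma measurable_det m (A : Tup R n -> 'M[R]_m) :
  (forall i j, measurable_fun setT (fun w => A w i j)) ->
  measurable_fun setT (fun w => \det (A w)).
Proof.
move=> mA; apply: measurable_sum => s; apply: measurable_funM => //.
exact: measurable_prod.
Qed.

Lemma measurable_logform a e : measurable_fun setT (logform a e).
Proof.
apply: measurable_funM.
  by apply: measurableT_comp => //; exact: measurable_sqn.
apply: measurable_det => i j; under eq_fun do rewrite mxE.
exact: measurable_dlog.
Qed.

Hypothesis JJ : J *m J = - 1%:M.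

Lemma reX_muli p w : reX (muli p) w = - imX p w.
Proof.
rewrite /reX /imX /= opprD -sumrN; congr (_ + _).
by apply: eq_bigr => j _; rewrite mxE mulNr.
Qed.

Lemma imX_muli p w : imX (muli p) w = reX p w.
Proof. by rewrite /reX /imX /= mulNmx -mulmxA JJ mulmxN mulmx1 opprK. Qed.

Lemma sqn_muli p w : sqn (muli p) w = sqn p w.
Proof. by rewrite /sqn reX_muli imX_muli sqrrN addrC. Qed.

Lemma dlog_muli p w j : dlog (muli p) w j = dlog p w j.
Proof.
rewrite /dlog sqn_muli /dsqn reX_muli imX_muli /=.
rewrite mulNmx -mulmxA JJ mulmxN mulmx1 opprK mxE mulrNN addrC//.
Qed.

Lemma norm_detJ : `|\det J| = 1.
Proof.
have : `|\det J| ^+ 2 = 1.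
  by rewrite -normrX expr2 -det_mulmx JJ -scaleN1r detZ det1 mulr1 normrX normrN1 expr1n.
by move/eqP; rewrite sqrp_eq1// => /eqP.
Qed.
End complex_affine.

(** Factor out x^2: the remaining ln (1 + r) with 0 <= r <= 1 contributes at most 1. *)
Lemma norm_ln_sqrD (R : realType) (x y : R) : x != 0 -> `|y| <= `|x| ->
  `|ln (x ^+ 2 + y ^+ 2)| <= 1 + 2 * `|ln `|x| |.
Proof.
rewrite -normr_gt0 => x0 yx.
have x20 : 0 < `|x| ^+ 2 by rewrite exprn_gt0.
have : `|y| ^+ 2 <= `|x| ^+ 2 by rewrite lerXn2r ?nnegrE.
have : 0 <= `|y| ^+ 2 by rewrite exprn_ge0.
rewrite -[x ^+ 2]real_normK ?num_real// -[y ^+ 2]real_normK ?num_real//.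
move: (`|y| ^+ 2) => z z0 zx.
have -> : `|x| ^+ 2 + z = `|x| ^+ 2 * (1 + z / `|x| ^+ 2).
  by field; rewrite gt_eqF.
set r := z / _; have r0 : 0 <= r by rewrite divr_ge0// ltW.
have r1 : r <= 1 by rewrite ler_pdivrMr// mul1r.
rewrite lnM ?posrE//; last by rewrite ltr_wpDr.
have l0 : 0 <= ln (1 + r) by rewrite ln_ge0// lerDl.
have l1 : ln (1 + r) <= 1 by apply: le_trans r1; rewrite le_ln1Dx// (lt_le_trans _ r0)// ltrN10.
apply: le_trans (ler_normD _ _) _; rewrite addrC lerD//.
  by rewrite ger0_norm.
by rewrite lnXn// normrMn mulr_natl.
Qed.

Section integrability.
Context (R : realType) (n : nat) (J : 'M[R]_n).
Hypothesis JJ : J *m J = - 1%:M.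
Local Notation caff := (caff R n).
Local Notation mu := (Leb R n).

Section sector.
Variables (a : caff) (e : 'I_n -> caff).

Let A : 'M[R]_n := \matrix_(i, j) crow (e i) 0 j.
Let B : 'M[R]_n := \matrix_(i, j) (crow (e i) *m J) 0 j.
Let slope (w : Tup R n) : Tup R n := [tuple imX J (e i) w / reX (e i) w | i < n].
Let D (t : Tup R n) : R := \det (slope_mx B (- A) t).
Let bcol : 'cV[R]_n := \col_i cim (e i).
Let acol : 'cV[R]_n := \col_i cre (e i).
(* Cramer: [P (slope w) = reX a w * D (slope w)] *)
Let P (t : Tup R n) : R := \det (slope_mx
  (block_mx B bcol (crow a) (cre a)%:M) (block_mx (- A) (- acol) 0 0 : 'M[R]_(n + 1)) t).

Let slopeE w (i : 'I_n) : nth 0 (slope w) i = imX J (e i) w / reX (e i) w.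
Proof. by rewrite -tnth_nth tnth_mktuple. Qed.

(** Right multiplication by J turns X dX + Y dY into X dY - Y dX = X (dY - t dX) with t = Y / X, and
    it preserves |det|. *)
Let DE w : (forall i, reX (e i) w != 0) ->
  `|D (slope w)| = `|\det (\matrix_(i, j) dsqn J (e i) w j)| /
     (2 ^+ n * \prod_i `|reX (e i) w|).
Proof.
move=> X0.
pose G : 'M[R]_n := \matrix_(i, j) (reX (e i) w * A i j + imX J (e i) w * B i j).
have -> : (\matrix_(i, j) dsqn J (e i) w j) = 2 *: G.
  by apply/matrixP => i j; rewrite !mxE /dsqn !mxE.
have GJ i j : (G *m J) i j =
    reX (e i) w * (crow (e i) *m J) 0 j - imX J (e i) w * crow (e i) 0 j.
  have -> : crow (e i) 0 j = - (crow (e i) *m J *m J) 0 j.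
    by rewrite -mulmxA JJ mulmxN mulmx1 mxE opprK.
  rewrite !mxE mulrN opprK !mulr_sumr -big_split /=; apply: eq_bigr => k _.
  by rewrite !mxE; ring.
have DG : slope_mx B (- A) (slope w) = diag_mx (\row_i (reX (e i) w)^-1) *m (G *m J).
  apply/matrixP => i j; rewrite mul_diag_mx mxE [RHS]mxE GJ.
  rewrite [(- A) i j]mxE [A i j]mxE [B i j]mxE slopeE [(\row__ _) _ _]mxE.
  by field.
rewrite /D DG !det_mulmx det_diag detZ !normrM (norm_detJ JJ) mulr1.
rewrite normrX [`|2|]ger0_norm// normr_prod.
under eq_bigr do rewrite mxE normfV.
rewrite prodfV; field.
rewrite expf_neq0// andbT; apply/prodf_neq0 => i _.
by rewrite normr_eq0.
Qed.

(** A unipotent column operation adds the combination of the first n columns with coefficients w to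
    the last one; the equations for the slopes clear its upper part and leave X_a (w) at the
    bottom. *)
Let PE w : (forall i, reX (e i) w != 0) ->
  P (slope w) = reX a w * D (slope w).
Proof.
move=> X0; set M := slope_mx B (- A) (slope w).
pose wc : 'cV[R]_n := \col_j tnth w j.
pose b0 : 'cV[R]_n := \col_i (cim (e i) - imX J (e i) w / reX (e i) w * cre (e i)).
have -> : P (slope w) = \det (block_mx M b0 (crow a) (cre a)%:M).
  congr (\det _); apply/matrixP => i j; rewrite mxE.
  case: (split_ordP i) => i' ->; case: (split_ordP j) => j' ->.
  - by rewrite !block_mxEul [RHS]mxE.
  - rewrite !block_mxEur [bcol _ _]mxE [b0 _ _]mxE [(- acol) _ _]mxE [acol _ _]mxE.
    by rewrite slopeE; ring.
  - by rewrite !block_mxEdl mxE mulr0 addr0.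
  - by rewrite !block_mxEdr [X in _ * X]mxE mulr0 addr0.
have <- : \det (block_mx M b0 (crow a) (cre a)%:M *m block_mx 1%:M wc 0 1%:M) =
  \det (block_mx M b0 (crow a) (cre a)%:M).
  by rewrite det_mulmx (@det_ublock _ n 1) !det1 !mulr1.
rewrite mulmx_block !mulmx1 !mulmx0 !addr0.
have -> : M *m wc + b0 = 0.
  apply/colP => i; rewrite !mxE.
  have -> : \sum_j M i j * wc j 0 = (imX J (e i) w - cim (e i)) -
     imX J (e i) w / reX (e i) w * (reX (e i) w - cre (e i)).
    rewrite /imX /reX !addrK mulr_sumr -sumrB; apply: eq_bigr => j _.
    by rewrite !mxE slopeE -/(imX J (e i) w) -/(reX (e i) w); ring.
  by field.
rewrite (@det_lblock _ n 1) mulrC; congr (_ * _).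
have -> : crow a *m wc + (cre a)%:M = (reX a w)%:M.
  apply/matrixP => i j; rewrite !ord1 !mxE eqxx !mulr1n; congr (_ + _).
  by apply: eq_bigr => k _; rewrite !mxE.
by rewrite det_scalar1.
Qed.

(** Because q >= X^2, the determinant is at most 2^n |D| / prod |X_i|, hence at most 2^n times the
    Jacobian of the slope map, and ln |X_a| = ln |P| - ln |D| is controlled by inverse square roots
    of P and D. *)
Lemma logform_sector_lty (E : set (Tup R n)) : measurable E ->
  (forall w, E w -> [/\ reX a w != 0, `|imX J a w| <= `|reX a w|,
     forall i, reX (e i) w != 0 /\ `|imX J (e i) w| <= `|reX (e i) w| &
     logform J a e w != 0]) ->
  (\int[mu]_(w in E) `|logform J a e w|%:E < +oo)%E.
Proof.
move=> mE EP.
have [->|/set0P[w0 Ew0]] := eqVneq E set0; first by rewrite integral_set0 ltry.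
have maD : multiaffine D by exact: multiaffine_det0.
have maP : multiaffine P by exact: multiaffine_det0.
have [KD KD0 DK] := multiaffine_bounded 2 maD.
have [KP KP0 PK] := multiaffine_bounded 2 maP.
have detE w : (forall i, reX (e i) w != 0) ->
    `|\det (\matrix_(i, j) dlog J (e i) w j)| =
    `|D (slope w)| * (2 ^+ n * \prod_i `|reX (e i) w|) / \prod_i sqn J (e i) w.
  move=> X0; rewrite (DE X0) divfK; last first.
    rewrite mulf_neq0 ?expf_neq0//; apply/prodf_neq0 => i _.
    by rewrite normr_eq0.
  have -> : (\matrix_(i, j) dlog J (e i) w j) =
      diag_mx (\row_i (sqn J (e i) w)^-1) *m \matrix_(i, j) dsqn J (e i) w j.
    by apply/matrixP => i j; rewrite mul_diag_mx !mxE mulrC.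
  rewrite det_mulmx det_diag normrM mulrC; congr (_ * _).
  under eq_bigr do rewrite mxE.
  rewrite prodfV normfV ger0_norm//; apply: prodr_ge0 => i _; exact: sqn_ge0.
(* Where the form is nonzero, P and D do not vanish at the slope; hence neither is identically zero,
   and [W] is continuous there. *)
have En0 w : E w -> [/\ D (slope w) != 0, P (slope w) != 0 & cube n 2 (slope w)].
  move=> /EP [Xa Ya XY L0]; have X0 i := (XY i).1.
  have D0 : D (slope w) != 0.
    apply: contra_neq L0 => D0; have := detE w X0.
    rewrite D0 normr0 !mul0r => /eqP; rewrite normr_eq0 /logform => /eqP ->.
    by rewrite mulr0.
  split => //; first by rewrite (PE X0) mulf_neq0.
  move=> i; rewrite tnth_mktuple normrM normfV.
  rewrite ler_pdivrMr ?normr_gt0//; have := (XY i).2; have := normr_ge0 (reX (e i) w).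
  lra.
(* From |ln q| <= 1 + 2 |ln |X_a||, with |ln |X_a|| <= KD + KP + 2 (rsqrt P + rsqrt D), times the
   2^n of the determinant. *)
pose c0 : R := 2 ^+ n * (1 + 2 * (KD + KP)); pose c1 : R := 2 ^+ n * 4.
have c00 : 0 <= c0 by rewrite mulr_ge0 ?exprn_ge0// addr_ge0// mulr_ge0// addr_ge0.
have c10 : 0 <= c1 by rewrite mulr_ge0 ?exprn_ge0.
pose W (t : Tup R n) : R := c0 + c1 * (rsqrt (P t) + rsqrt (D t)).
have W0 t : 0 <= W t by rewrite addr_ge0// mulr_ge0// addr_ge0// rsqrt_ge0.
have mrs (Q : Tup R n -> R) : multiaffine Q -> measurable_fun setT (fun t => rsqrt (Q t)).
  move=> /measurable_multiaffine mQ; apply: measurableT_comp => //.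
  exact: measurable_rsqrt.
have mW : measurable_fun setT W.
  apply: measurable_funD => //; apply: measurable_funM => //.
  by apply: measurable_funD; exact: mrs.
have AX i w : \sum_j A i j * tnth w j + cre (e i) = reX (e i) w.
  by congr (_ + _); apply: eq_bigr => j _; rewrite mxE.
have BY i w : \sum_j B i j * tnth w j + cim (e i) = imX J (e i) w.
  by congr (_ + _); apply: eq_bigr => j _; rewrite mxE.
have slopeS w : [tuple (\sum_j B i j * tnth w j + cim (e i)) /
    (\sum_j A i j * tnth w j + cre (e i)) | i < n] = slope w.
  by apply: eq_from_tnth => i; rewrite !tnth_mktuple AX BY.
apply: (@le_lt_trans _ _ (\int[mu]_t ((\1_(cube n 2) t)%:E * (W t)%:E))%E).
  apply: (@slope_integral_le R n A B (fun i => cre (e i)) (fun i => cim (e i))) => //=.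
  - apply: measurable_funTS; apply: measurableT_comp => //.
    exact: measurable_logform.
  - by move=> w /EP[_ _ XY _] i; rewrite AX BY; exact: XY.
  - move=> w /En0[D0 P0 _]; rewrite slopeS; apply: cvgD; first exact: cvg_cst.
    apply: cvgM; first exact: cvg_cst.
    by apply: cvgD; apply: cvg_rsqrt => //; exact: multiaffine_cvg.
  - move=> w Ew; have [D0 P0 wK] := En0 w Ew; have [Xa Ya XY _] := EP w Ew.
    have X0 i := (XY i).1; rewrite slopeS -/(D (slope w)).
    under eq_bigr do rewrite AX.
    set Pi := \prod_i _.
    have Pi0 : 0 < Pi by apply: prodr_gt0 => i _; rewrite normr_gt0.
    have le_det : `|\det (\matrix_(i, j) dlog J (e i) w j)| <= 2 ^+ n * `|D (slope w)| / Pi.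
      rewrite (detE w X0) -/Pi mulrCA -!mulrA ler_wpM2l ?exprn_ge0//.
      rewrite ler_wpM2l//.
      have q0 i : `|reX (e i) w| ^+ 2 <= sqn J (e i) w.
        by rewrite real_normK ?num_real// lerDl sqr_ge0.
      have Pq0 : 0 < \prod_i sqn J (e i) w.
        by apply: prodr_gt0 => i _; apply: lt_le_trans (q0 i); rewrite exprn_gt0// normr_gt0.
      rewrite ler_pdivrMr// ler_pdivlMl// -big_split /=.
      by apply: ler_prod => i _; rewrite -expr2 q0 exprn_ge0.
    have lnX : `|ln `|reX a w| | <= KD + KP + 2 * (rsqrt (P (slope w)) + rsqrt (D (slope w))).
      have nD : 0 < `|D (slope w)| by rewrite normr_gt0.
      have nP : 0 < `|P (slope w)| by rewrite normr_gt0.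
      have -> : `|reX a w| = `|P (slope w)| / `|D (slope w)|.
        by rewrite (PE X0) normrM mulfK// gt_eqF.
      rewrite ln_div ?posrE//.
      have rs_norm (x : R) : rsqrt `|x| = rsqrt x by rewrite /rsqrt normr_id.
      have := norm_ln_le nD; have := norm_ln_le nP; rewrite !rs_norm.
      have := DK _ wK; have := PK _ wK.
      have := ler_normB (ln `|P (slope w)|) (ln `|D (slope w)|); lra.
    have lnq := norm_ln_sqrD Xa Ya; rewrite -/(sqn J a w) in lnq.
    rewrite /logform normrM; apply: le_trans (ler_pM _ _ lnq le_det) _ => //.
    rewrite -!mulrA mulrCA mulrA ler_wpM2r//; first by rewrite divr_ge0// ltW.
    by rewrite /W /c0 /c1 -!mulrA -mulrDr ler_wpM2l ?exprn_ge0//; lra.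
have lemm (Q : Tup R n -> R) : multiaffine Q -> (exists t, Q t != 0) ->
    (\int[mu]_t ((\1_(cube n 2) t)%:E * (rsqrt (Q t))%:E) < +oo)%E.
  move=> maQ Q0; apply: le_lt_trans (integral_ersqrt_multiaffine maQ Q0).
  have mQ := measurable_multiaffine maQ; have mc := @measurable_cube R n 2.
  apply: ge0_le_integral => //.
  - by move=> t _; rewrite -EFinM lee_fin mulr_ge0// rsqrt_ge0.
  - by apply/measurable_EFinP; apply: measurable_funM; [exact: measurable_indic|exact: mrs].
  - apply: emeasurable_funM.
      by apply/measurable_EFinP; exact: measurable_indic.
    by apply: measurableT_comp => //; exact: measurable_ersqrt.
  - by move=> t _; rewrite lee_wpmul2l ?lee_fin// rsqrt_le_ersqrt.
have [D0 P0 _] := En0 w0 Ew0; have mc := @measurable_cube R n 2.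
have mi (Q : Tup R n -> R) : measurable_fun setT Q ->
    measurable_fun setT (fun t => (\1_(cube n 2) t)%:E * (Q t)%:E)%E.
  move=> mQ; apply/measurable_EFinP; apply: measurable_funM => //.
have i0 (Q : Tup R n -> R) t : 0 <= Q t -> (0 <= (\1_(cube n 2) t)%:E * (Q t)%:E)%E.
  by move=> Q0; rewrite -EFinM lee_fin mulr_ge0.
have ir (x : R) t : (0 <= (\1_(cube n 2) t)%:E * (rsqrt x)%:E)%E.
  by rewrite -EFinM lee_fin mulr_ge0// rsqrt_ge0.
have WE t : ((\1_(cube n 2) t)%:E * (W t)%:E = (\1_(cube n 2) t)%:E * c0%:E +
    c1%:E * ((\1_(cube n 2) t)%:E * (rsqrt (P t))%:E +
             (\1_(cube n 2) t)%:E * (rsqrt (D t))%:E))%E.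
  by rewrite -!EFinM -?EFinD -?EFinM -?EFinD; congr (_%:E); rewrite /W; ring.
under eq_integral do rewrite WE.
rewrite ge0_integralD//; last 4 first.
- by move=> t _; exact: i0.
- exact: mi.
- move=> t _; apply: mule_ge0; first by rewrite lee_fin.
  by apply: adde_ge0; exact: ir.
- by apply: measurable_funeM; apply: emeasurable_funD; apply: mi; exact: mrs.
rewrite lte_add_pinfty//.
  rewrite ge0_integralZr//; last by apply/measurable_EFinP; exact: measurable_indic.
  rewrite integral_indic// setIT muleC lte_mul_pinfty//.
  exact: cube_lty.
rewrite ge0_integralZl//; last 2 first.
- by apply: emeasurable_funD; apply: mi; exact: mrs.
- by move=> t _; apply: adde_ge0; exact: ir.
rewrite lte_mul_pinfty// ge0_integralD//; last 2 first.
- by apply: mi; exact: mrs.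
- by apply: mi; exact: mrs.
by rewrite lte_add_pinfty//; apply: lemm => //; [exists (slope w0)|exists (slope w0)].
Qed.
End sector.

(** Multiplying by i swaps |X| and |Y|, which brings any nonzero value into the sector |Y| <= |X|
    without changing [sqn] or [dlog]. *)
Let rot (b : bool) (p : caff) := if b then muli J p else p.

Let sqn_rot b p w : sqn J (rot b p) w = sqn J p w.
Proof. by case: b => //=; exact: sqn_muli. Qed.

Let dlog_rot b p w j : dlog J (rot b p) w j = dlog J p w j.
Proof. by case: b => //=; exact: dlog_muli. Qed.

Let rot_sector p w : sqn J p w != 0 ->
  let p' := rot (`|reX p w| < `|imX J p w|) p in
  reX p' w != 0 /\ `|imX J p' w| <= `|reX p' w|.
Proof.
move=> q0 /=; rewrite /rot; case: ltP => [lt|le].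
  rewrite reX_muli (imX_muli JJ) normrN (ltW lt) oppr_eq0; split => //.
  by rewrite -normr_gt0 (le_lt_trans _ lt).
split => //; apply: contra_neq q0 => X0; move: le.
by rewrite X0 normr0 normr_le0 /sqn X0 => /eqP ->; rewrite expr0n addr0.
Qed.

(** Finitely many sectors, one for each choice of the functions to be multiplied by i, cover the
    part of [D] on which the form is nonzero. *)
Theorem integrable_logform (a : caff) (e : 'I_n -> caff) (D : set (Tup R n)) :
  measurable D ->
  (forall w, D w -> sqn J a w != 0 /\ forall i, sqn J (e i) w != 0) ->
  mu.-integrable D (EFin \o logform J a e).
Proof.
move=> mD Dq; have mL := measurable_logform J a e.
(* [None] stands for [a] and [Some i] for [e i]. *)
pose S := {ffun option 'I_n -> bool}.
pose a' (s : S) := rot (s None) a; pose e' (s : S) i := rot (s (Some i)) (e i).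
have LE s w : logform J (a' s) (e' s) w = logform J a e w.
  rewrite /logform sqn_rot; congr (_ * \det _).
  by apply/matrixP => i j; rewrite !mxE dlog_rot.
pose E1 (p : caff) : set (Tup R n) := [set w | reX p w != 0] `&`
  [set w | `|imX J p w| <= `|reX p w|].
have mE1 p : measurable (E1 p).
  apply: measurableI.
    have -> : [set w | reX p w != 0] = ~` (reX p @^-1` [set 0]).
      by apply/seteqP; split => w /= /eqP.
    apply: measurableC; rewrite -[X in measurable X]setTI.
    by apply: measurable_reX => //; exact: measurable_set1.
  rewrite -[X in measurable X]setTI; apply: measurable_fun_ler => //.
    by apply: measurableT_comp => //; exact: measurable_imX.
  by apply: measurableT_comp => //; exact: measurable_reX.
pose E s := E1 (a' s) `&` (\bigcap_(i in [set: 'I_n]) E1 (e' s i)) `&`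
  [set w | logform J a e w != 0].
have mE s : measurable (E s).
  apply: measurableI.
    by apply: measurableI => //; apply: fin_bigcap_measurable.
  have -> : [set w | logform J a e w != 0] = ~` (logform J a e @^-1` [set 0]).
    by apply/seteqP; split => w /= /eqP.
  apply: measurableC; rewrite -[X in measurable X]setTI.
  by apply: mL => //; exact: measurable_set1.
have IE s : (\int[mu]_(w in E s) `|logform J a e w|%:E < +oo)%E.
  under eq_integral do rewrite -(LE s).
  apply: logform_sector_lty => // w [[[Xa Ya] Xe] L0]; split => //.
    by move=> i; exact: Xe.
  by rewrite LE.
apply/integrableP; split.
  by apply/measurable_EFinP; exact: measurable_funTS.
rewrite -integral_indicM.
apply: (@le_lt_trans _ _ (\int[mu]_w (\sum_(s : S)
    (\1_(E s) w)%:E * `|logform J a e w|%:E))%E).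
  apply: ge0_le_integral => //.
  - apply: emeasurable_funM; first by apply/measurable_EFinP; exact: measurable_indic.
    by apply: measurableT_comp => //; exact/measurable_EFinP.
  - apply: emeasurable_sum => s.
    apply: emeasurable_funM; first by apply/measurable_EFinP; exact: measurable_indic.
    by apply/measurable_EFinP; exact: measurableT_comp.
  move=> w _; rewrite indicE; case: (boolP (w \in D)) => wD; last first.
    by rewrite mul0e; apply: sume_ge0 => s _; rewrite mule_ge0// ?lee_fin.
  rewrite mul1e /=; have [L0|L0] := eqVneq (logform J a e w) 0.
    by rewrite L0 normr0; apply: sume_ge0 => s _; rewrite mule_ge0// ?lee_fin.
  move: wD; rewrite inE => /Dq[qa qe].
  pose s : S := [ffun o => if o is Some i then `|reX (e i) w| < `|imX J (e i) w|
     else `|reX a w| < `|imX J a w|].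
  have Es : E s w.
    split => //; split; first by rewrite /a' ffunE; exact: rot_sector.
    by move=> i _; rewrite /e' ffunE; exact: rot_sector.
  rewrite (bigD1 s)//= indicE mem_set// mul1e leeDl//.
  by apply: sume_ge0 => r _; rewrite mule_ge0// ?lee_fin.
rewrite ge0_integral_sum//; last first.
  move=> s; apply: emeasurable_funM; first by apply/measurable_EFinP; exact: measurable_indic.
  by apply/measurable_EFinP; exact: measurableT_comp.
apply: lte_sum_pinfty => s _; rewrite integral_indicM; exact: IE.
Qed.
End integrability.

(** * Stokes for logarithmic forms *)

Section cutoff.
Context (R : realType).
Implicit Types x q : R.

(** A quadratic remainder can be checked by polynomial inequalities, even at 0 for x_+^2, which has
    no second derivative there. *)
Lemma is_derive_quadratic_bound (f : R -> R) x (c C : R) :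
  (forall h, `|f (x + h) - f x - c * h| <= C * h ^+ 2) -> is_derive x 1 f c.
Proof.
move=> fh.
have fc : (fun h => h^-1 *: (f (h *: 1 + x) - f x)) h @[h --> 0^'] --> c.
  apply/cvgrPdist_le => e e0; near=> h.
  have h0 : h != 0 by near: h; exact: nbhs_dnbhs_neq.
  have := fh h; rewrite -[h *: 1]/(h * 1) mulr1 [h + x]addrC.
  have -> : c - h^-1 *: (f (x + h) - f x) = - ((f (x + h) - f x - c * h) / h).
    by rewrite /GRing.scale/=; field.
  rewrite normrN normrM normfV => H; rewrite ler_pdivrMr ?normr_gt0//.
  apply: le_trans H _; rewrite -real_normK ?num_real// expr2 mulrA.
  rewrite ler_wpM2r//.
  have C1 : C <= `|C| + 1 by rewrite (le_trans (ler_norm C))// lerDl.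
  apply: (@le_trans _ _ ((`|C| + 1) * `|h|)); first by rewrite ler_wpM2r.
  rewrite mulrC -ler_pdivlMr ?ltr_wpDl//.
  by near: h; apply: dnbhs0_le; rewrite divr_gt0// ltr_wpDl.
split; first by apply/cvg_ex; exists c.
by apply/cvg_lim.
Unshelve. all: by end_near. Qed.

Definition possqr x : R := Num.max 0 x ^+ 2.

Lemma is_derive_possqr x : is_derive x 1 possqr (2 * Num.max 0 x).
Proof.
apply: (@is_derive_quadratic_bound _ _ _ 1) => h; rewrite mul1r ler_norml /possqr.
rewrite !maxEle; case: ifPn => ?; case: ifPn => ?; apply/andP; split; nra.
Qed.

(** A C^1 cutoff supported in [-1, 1]; no second derivative of the cutoff ever occurs. *)
Definition bump x : R := possqr (1 - x ^+ 2).
Definition dbump x : R := - 4 * x * Num.max 0 (1 - x ^+ 2).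

Lemma is_derive_bump x : is_derive x 1 bump (dbump x).
Proof.
have -> : dbump x = (2 * Num.max 0 (1 - x ^+ 2)) * (- (2 * x)).
  by rewrite /dbump; ring.
apply: (@is_derive1_comp _ possqr (fun x => 1 - x ^+ 2)).
  exact: is_derive_possqr.
apply: (@is_derive_quadratic_bound _ _ _ 1) => h; rewrite mul1r.
have -> : 1 - (x + h) ^+ 2 - (1 - x ^+ 2) - - (2 * x) * h = - h ^+ 2 by ring.
by rewrite normrN ger0_norm// sqr_ge0.
Qed.

Lemma bump_ge0 x : 0 <= bump x. Proof. exact: sqr_ge0. Qed.

Lemma bump_le1 x : bump x <= 1.
Proof.
rewrite /bump /possqr; have := sqr_ge0 x.
rewrite maxEle; case: ifPn => ? ?; last by rewrite expr0n.
by rewrite expr_le1//; lra.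
Qed.

Lemma bump_eq0 x : 1 <= `|x| -> bump x = 0 /\ dbump x = 0.
Proof.
move=> x1; have x2 : 1 <= x ^+ 2.
  by rewrite -real_normK ?num_real// exprn_ege1.
by rewrite /bump /dbump /possqr max_l ?subr_le0// expr0n mulr0.
Qed.

Lemma norm_dbump x : `|dbump x| <= 4 /\ `|x * dbump x| <= 4.
Proof.
have [x1|x1] := leP 1 `|x|.
  by rewrite (bump_eq0 x1).2 mulr0 normr0.
have m1 : `|Num.max 0 (1 - x ^+ 2)| <= 1.
  have := sqr_ge0 x; rewrite ger0_norm ?le_max ?lexx// ge_max ler01/=; lra.
have H : `|dbump x| <= 4.
  rewrite /dbump !normrM normrN [`|4|]ger0_norm//.
  have := ltW x1; have := normr_ge0 x; have := normr_ge0 (Num.max 0 (1 - x ^+ 2)).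
  move: m1 `|x| => /[swap] z; move: `|Num.max _ _| => y ? ? ? ?; nra.
split => //; rewrite normrM; have := normr_ge0 x; have := normr_ge0 (dbump x).
move: H x1; move: `|x| `|dbump x| => y z; nra.
Qed.

Lemma bump0 : bump 0 = 1 /\ dbump 0 = 0.
Proof. by rewrite /bump /possqr /dbump expr0n subr0 max_r// expr1n mulr0 mul0r. Qed.

Lemma continuous_dbump : continuous dbump.
Proof.
move=> x; apply: cvgM; first by apply: cvgM; [exact: cvg_cst|exact: cvg_id].
have mE z : Num.max 0 (1 - z ^+ 2) = 2^-1 * ((1 - z ^+ 2) + `|1 - z ^+ 2|) :> R.
  rewrite maxEle; case: ifPn => [z0|].
    by rewrite ger0_norm//; lra.
  by rewrite -ltNge => z0; rewrite ltr0_norm//; lra.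
under eq_cvg do rewrite mE; rewrite mE.
have c1 : (1 - z ^+ 2) @[z --> x] --> 1 - x ^+ 2.
  by apply: cvgB; [exact: cvg_cst|exact: exprn_continuous].
by apply: cvgM; [exact: cvg_cst|apply: cvgD => //; exact: cvg_norm].
Qed.
End cutoff.

Section log_cutoff.
Context (R : realType).
Implicit Types (q c L : R) (m dm h dh : R -> R).

Definition C1_with h dh := (forall q, is_derive q 1 h (dh q)) /\ continuous dh.

(** For cutoffs given by formulas in q > 0: vanishing below a positive [c] carries them smoothly
    past q = 0. *)
Lemma C1_extend0 h dh c : 0 < c ->
  (forall q, q < c -> h q = 0 /\ dh q = 0) ->
  (forall q, 0 < q -> is_derive q 1 h (dh q)) ->
  (forall q, 0 < q -> {for q, continuous dh}) -> C1_with h dh.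
Proof.
move=> c0 h0 dhP cdh.
have nc q : q <= 0 -> \forall x \near q, x < c.
  by move=> q0; apply: lt_nbhsl; exact: le_lt_trans c0.
split=> q; have [q0|q0] := ltP 0 q; [exact: dhP| |exact: cdh|].
  rewrite (h0 q (le_lt_trans q0 c0)).2.
  apply: (@near_eq_is_derive _ _ _ (cst 0)) => //.
  by near=> x; rewrite /= (h0 x _).1//; near: x; exact: nc.
rewrite /continuous_at (h0 q (le_lt_trans q0 c0)).2.
by apply: cvg_near_cst; near=> x; rewrite (h0 x _).2//; near: x; exact: nc.
Unshelve. all: by end_near. Qed.

(* Cutting off at the scale of ln q / L makes q times the derivative of the cutoff O(1 / L). *)
Definition cut m L q := if 0 < q then m q * bump (ln q / L) else 0.
Definition dcut m dm L q := if 0 < q then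
  dm q * bump (ln q / L) + m q * (dbump (ln q / L) / (L * q)) else 0.

Lemma cut_eq0 m dm L q : 0 < L -> q <= expR (- L) ->
  cut m L q = 0 /\ dcut m dm L q = 0.
Proof.
move=> L0 qL; rewrite /cut /dcut; case: ifP => // q0.
have : 1 <= `|ln q / L|.
  have lq : ln q <= - L by rewrite -[leRHS]expRK ler_ln ?posrE ?expR_gt0.
  rewrite normrM normfV [`|L|]gtr0_norm// ler_pdivlMr// mul1r.
  by rewrite ler0_norm; lra.
by move=> /bump_eq0[-> ->]; rewrite !(mul0r,mulr0) addr0.
Qed.

Lemma cut_large m L q : 0 < L -> expR L <= q -> cut m L q = 0.
Proof.
move=> L0 qL; rewrite /cut; case: ifP => // q0.
have : 1 <= `|ln q / L|.
  have lq : L <= ln q by rewrite -[leLHS]expRK ler_ln ?posrE ?expR_gt0.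
  rewrite normrM normfV [`|L|]gtr0_norm// ler_pdivlMr// mul1r.
  by rewrite ger0_norm; lra.
by move=> /bump_eq0[-> _]; rewrite mulr0.
Qed.

Lemma cut_C1 m dm L : 0 < L ->
  (forall q, 0 < q -> is_derive q 1 m (dm q)) ->
  (forall q, 0 < q -> {for q, continuous m}) ->
  (forall q, 0 < q -> {for q, continuous dm}) ->
  C1_with (cut m L) (dcut m dm L).
Proof.
move=> L0 mP cm cdm; apply: (@C1_extend0 _ _ (expR (- L))).
- exact: expR_gt0.
- by move=> q /ltW; exact: cut_eq0.
- move=> q q0; apply: (@near_eq_is_derive _ _ _ (fun q => m q * bump (L^-1 * ln q))).
  + near=> x; rewrite /cut ifT 1?[ln _ / _]mulrC//.
    by near: x; exact: lt_nbhsr.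
  + have H1 : is_derive q 1 (fun q => L^-1 * ln q) (L^-1 * q^-1).
      exact: (is_deriveZ L^-1 (is_derive1_ln q0)).
    have H2 := @is_derive1_comp _ (@bump R) (fun q => L^-1 * ln q) q _ _
      (is_derive_bump (L^-1 * ln q)) H1.
    apply: is_derive_eq (is_deriveM (mP q q0) H2) _.
    rewrite /dcut q0 /GRing.scale/=.
    by rewrite [ln q / L]mulrC invfM; ring.
- move=> q q0; suff : dcut m dm L x @[x --> q] --> dcut m dm L q by [].
  have cl : ln x / L @[x --> q] --> ln q / L.
    by apply: cvgM; [exact: continuous_ln|exact: cvg_cst].
  have H : dm x * bump (ln x / L) + m x * (dbump (ln x / L) / (L * x)) @[x --> q] -->
      dm q * bump (ln q / L) + m q * (dbump (ln q / L) / (L * q)).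
    apply: cvgD; apply: cvgM.
    + exact: cdm.
    + apply: (cvg_comp _ _ cl); apply: differentiable_continuous.
      by apply/derivable1_diffP; apply: ex_derive; exact: is_derive_bump.
    + exact: cm.
    + apply: cvgM; first by apply: (cvg_comp _ _ cl); exact: continuous_dbump.
      apply: cvgV; first by rewrite mulf_neq0// gt_eqF.
      by apply: cvgM; [exact: cvg_cst|exact: cvg_id].
  have -> : dcut m dm L q =
      dm q * bump (ln q / L) + m q * (dbump (ln q / L) / (L * q)).
    by rewrite /dcut q0.
  apply: cvg_trans H; apply: near_eq_cvg; near=> x.
  by rewrite /dcut ifT//; near: x; exact: lt_nbhsr.
Unshelve. all: by end_near. Qed.

Lemma cut_1_C1 L : 0 < L -> C1_with (cut (cst 1) L) (dcut (cst 1) (cst 0) L).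
Proof.
by move=> L0; apply: cut_C1 => // q _; exact: cvg_cst.
Qed.

Lemma cut_ln_C1 L : 0 < L ->
  C1_with (cut (@ln R) L) (dcut (@ln R) (@GRing.inv R) L).
Proof.
move=> L0; apply: cut_C1 => // q q0.
- exact: continuous_ln.
- by apply: inv_continuous; rewrite gt_eqF.
Qed.

Lemma cut_inv_C1 L : 0 < L ->
  C1_with (cut (@GRing.inv R) L) (dcut (@GRing.inv R) (fun q => - (q ^+ 2)^-1) L).
Proof.
move=> L0; apply: cut_C1 => [//|q q0|q q0|q q0].
- have q1 : q != 0 by rewrite gt_eqF.
  split; first exact: derivableV.
  by rewrite deriveV// derive_id /GRing.scale/= mulr1.
- by apply: inv_continuous; rewrite gt_eqF.
- apply: cvgN; apply: cvgV; first by rewrite expf_neq0// gt_eqF.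
  exact: exprn_continuous.
Qed.

End log_cutoff.

(** * Calculus along coordinate lines *)

Section C1_calculus.
Context (R : realType) (n : nat).
Implicit Types (w : Tup R n) (F G : Tup R n -> R) (j : 'I_n).

Definition upd w j (s : R) : Tup R n := [tuple if i == j then s else tnth w i | i < n].

Lemma upd_id w j : upd w j (tnth w j) = w.
Proof. by apply: eq_from_tnth => i; rewrite tnth_mktuple; case: eqP => // ->. Qed.

(* Stands in for continuity, there being no topology on tuples. *)
Definition line_continuous F :=
  [/\ measurable_fun setT F,
      forall B, exists C, forall w, cube n B w -> `|F w| <= C &
      forall w j, continuous (fun s => F (upd w j s))].

(** Just what coordinatewise integration uses: boundedness on cubes makes compactly supported fields
    integrable, and continuity along lines allows the fundamental theorem of calculus. *)
Definition C1_field F (dF : 'I_n -> Tup R n -> R) :=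
  [/\ line_continuous F, forall j, line_continuous (dF j) &
      forall w j, is_derive (tnth w j) 1 (fun s => F (upd w j s)) (dF j w)].

Lemma line_continuous_cst c : line_continuous (fun=> c).
Proof.
split => // [B|w j s]; first by exists `|c|.
exact: cvg_cst.
Qed.

Lemma line_continuousD F G : line_continuous F -> line_continuous G ->
  line_continuous (fun w => F w + G w).
Proof.
move=> [mF bF cF] [mG bG cG]; split; first exact: measurable_funD.
  move=> B; have [C FC] := bF B; have [C' GC] := bG B.
  exists (C + C') => w wB; rewrite (le_trans (ler_normD _ _))//.
  by rewrite lerD ?FC ?GC.
by move=> w j s; apply: cvgD; [exact: cF|exact: cG].
Qed.

Lemma line_continuousM F G : line_continuous F -> line_continuous G ->
  line_continuous (fun w => F w * G w).
Proof.
move=> [mF bF cF] [mG bG cG]; split; first exact: measurable_funM.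
  move=> B; have [C FC] := bF B; have [C' GC] := bG B.
  by exists (C * C') => w wB; rewrite normrM ler_pM ?FC ?GC.
by move=> w j s; apply: cvgM; [exact: cF|exact: cG].
Qed.

Lemma line_continuous_comp (h : R -> R) F : continuous h -> line_continuous F ->
  line_continuous (fun w => h (F w)).
Proof.
move=> ch [mF bF cF]; split.
- by apply: measurableT_comp => //; exact: continuous_measurable_fun.
- move=> B; have [C FC] := bF B.
  have [C0|C0] := leP (- C) C; last first.
    exists 0 => w wB; have := FC _ wB; have := normr_ge0 (F w).
    by move=> ? ?; exfalso; lra.
  have cnh : {within `[- C, C], continuous (fun x => `|h x|)}.
    by apply: continuous_subspaceT => x; apply: cvg_norm; exact: ch.
  have [c _ hc] := EVT_max C0 cnh.
  by exists `|h c| => w wB; apply: hc; rewrite in_itv/= -ler_norml FC.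
- by move=> w j s; apply: continuous_comp; [exact: cF|exact: ch].
Qed.

Lemma C1_cst c : C1_field (fun=> c) (fun _ _ => 0).
Proof.
split => [|j|w j]; [exact: line_continuous_cst|exact: line_continuous_cst|].
exact: is_derive_cst.
Qed.

Lemma C1D F G dF dG : C1_field F dF -> C1_field G dG ->
  C1_field (fun w => F w + G w) (fun j w => dF j w + dG j w).
Proof.
move=> [cF cdF FP] [cG cdG GP]; split => [|j|w j].
- exact: line_continuousD.
- exact: line_continuousD.
- exact: is_deriveD (FP w j) (GP w j).
Qed.

Lemma C1M F G dF dG : C1_field F dF -> C1_field G dG ->
  C1_field (fun w => F w * G w) (fun j w => dF j w * G w + F w * dG j w).
Proof.
move=> [cF cdF FP] [cG cdG GP]; split => [|j|w j].
- exact: line_continuousM.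
- by apply: line_continuousD; exact: line_continuousM.
- apply: is_derive_eq (is_deriveM (FP w j) (GP w j)) _.
  by rewrite upd_id /GRing.scale/= addrC [G w * _]mulrC.
Qed.

Lemma C1_comp (h dh : R -> R) F dF : C1_with h dh -> C1_field F dF ->
  C1_field (fun w => h (F w)) (fun j w => dh (F w) * dF j w).
Proof.
move=> [hP cdh] [cF cdF FP]; have ch : continuous h.
  move=> x; apply: differentiable_continuous.
  by apply/derivable1_diffP; apply: ex_derive; exact: hP.
split => [|j|w j].
- exact: line_continuous_comp.
- by apply: line_continuousM => //; exact: line_continuous_comp.
- have := @is_derive1_comp _ h (fun s => F (upd w j s)) (tnth w j) _ _ (hP _) (FP w j).
  by rewrite upd_id.
Qed.

Lemma eq_C1 F G dF dG : F =1 G -> (forall j, dF j =1 dG j) ->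
  C1_field F dF -> C1_field G dG.
Proof.
move=> /funext -> dFG; have -> // : dF = dG.
by apply/funext => j; apply/funext => w; exact: dFG.
Qed.

Lemma C1_prod (I : finType) (F : I -> Tup R n -> R) dF :
  (forall i, C1_field (F i) (dF i)) ->
  C1_field (fun w => \prod_i F i w)
    (fun j w => \sum_i dF i j w * \prod_(k | k != i) F k w).
Proof.
move=> CF; have : uniq (index_enum I) by exact: index_enum_uniq.
elim: (index_enum I) => [_|i s IH /= /andP[si /IH {}IH]].
  apply: eq_C1 (C1_cst 1) => [w|j w]; by rewrite big_nil.
apply: eq_C1 (C1M (CF i) IH) => [w|j w]; first by rewrite big_cons.
rewrite big_cons big_cons eqxx /=; congr (_ * _ + _).
  rewrite [LHS]big_seq [RHS]big_seq_cond; apply: eq_bigl => k.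
  by case: eqP => [->|]; rewrite ?andbF ?andbT// (negbTE si).
rewrite mulr_sumr [LHS]big_seq [RHS]big_seq; apply: eq_bigr => k ks.
rewrite big_cons ifT; last by apply: contraNneq si => ->.
by rewrite mulrCA.
Qed.

Lemma affine_upd (a : 'I_n -> R) b w j s :
  \sum_i a i * tnth (upd w j s) i + b =
    a j * s + (\sum_(i | i != j) a i * tnth w i + b).
Proof.
rewrite (bigD1 j)//= tnth_mktuple eqxx -addrA; congr (_ + (_ + _)).
by apply: eq_bigr => i ij; rewrite tnth_mktuple (negbTE ij).
Qed.

Lemma line_continuous_affine (a : 'I_n -> R) b :
  line_continuous (fun w => \sum_i a i * tnth w i + b).
Proof.
split; first exact: measurable_fun_affine.
- move=> B; exists (\sum_i `|a i| * B + `|b|) => w wB.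
  rewrite (le_trans (ler_normD _ _))// lerD// (le_trans (ler_norm_sum _ _ _))//.
  by apply: ler_sum => i _; rewrite normrM ler_wpM2l// wB.
- move=> w j; under eq_fun do rewrite affine_upd; move=> s.
  apply: cvgD; last exact: cvg_cst.
  by apply: cvgM; [exact: cvg_cst|exact: cvg_id].
Qed.

Lemma C1_affine (a : 'I_n -> R) b :
  C1_field (fun w => \sum_i a i * tnth w i + b) (fun j _ => a j).
Proof.
split => [|j|w j]; [exact: line_continuous_affine|exact: line_continuous_cst|].
apply: (@is_derive_quadratic_bound _ _ _ _ 0) => h.
rewrite mul0r normr_le0; apply/eqP.
rewrite !affine_upd; ring.
Qed.

(** The complement of the cube is open along line [j]: a coordinate exceeding [B] still does after a
    small move, whether it is coordinate [j] or another. *)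
Lemma C1_derive_eq0 F dF B w j : C1_field F dF ->
  (forall w, ~ cube n B w -> F w = 0) -> ~ cube n B w -> dF j w = 0.
Proof.
move=> [_ _ FP] F0 /existsNP[i /negP]; rewrite -ltNge => Bi.
have [_ <-] := FP w j.
rewrite -[RHS](derive_cst (0 : R) (tnth w j) (1 : R)).
have nB : \forall s \near tnth w i, B < `|s|.
  have /cvgr_gt : `|s| @[s --> tnth w i] --> `|tnth w i| by apply: cvg_norm; exact: cvg_id.
  exact.
apply: near_eq_derive; have [ij|ij] := eqVneq i j; near=> s.
  apply: F0 => /(_ i); apply/negP; rewrite -ltNge tnth_mktuple ij eqxx.
  by near: s; rewrite -ij.
by apply: F0 => /(_ i); apply/negP; rewrite -ltNge tnth_mktuple (negbTE ij).
Unshelve. all: by end_near. Qed.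

End C1_calculus.

(** * Integrating a partial derivative along its own coordinate *)

Section coordinate_integration.
Context (R : realType).

Definition ins n (j : 'I_n.+1) (s : R) (t : Tup R n) : Tup R n.+1 :=
  [tuple if unlift j i is Some k then tnth t k else s | i < n.+1].

Lemma tnth_ins n (j : 'I_n.+1) s (t : Tup R n) : tnth (ins j s t) j = s.
Proof. by rewrite tnth_mktuple unlift_none. Qed.

Lemma upd_ins n (j : 'I_n.+1) s s' (t : Tup R n) : upd (ins j s t) j s' = ins j s' t.
Proof.
apply: eq_from_tnth => i; rewrite !tnth_mktuple.
by case: unliftP => [k ->|->]; rewrite ?eqxx// eq_sym (negbTE (neq_lift _ _)).
Qed.

Lemma ins_ord0 n s (t : Tup R n) : ins ord0 s t = tuple_cons (s, t).
Proof.
apply: eq_from_tnth => i; rewrite tnth_mktuple.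
by case: unliftP => [k ->|->]; rewrite ?tnthS.
Qed.

Lemma ins_lift n (j : 'I_n.+1) s s0 (t : Tup R n) :
  ins (lift ord0 j) s (tuple_cons (s0, t)) = tuple_cons (s0, ins j s t).
Proof.
apply: eq_from_tnth => i; rewrite tnth_mktuple.
have [i' ->|->] := unliftP ord0 i; last first.
  have [k /(congr1 val)|/(congr1 val)] := unliftP (lift ord0 j) (@ord0 n.+1) => //=.
  move=> k0; have -> : k = ord0; last by [].
  by apply/val_inj; move: k0; rewrite /= /fintype.bump; lia.
rewrite [RHS]tnthS tnth_mktuple.
have [k|] := unliftP j i'.
  move=> ->; have -> : lift ord0 (lift j k) = lift (lift ord0 j) (lift ord0 k).
    by apply/val_inj; rewrite /= /fintype.bump; lia.
  by rewrite liftK [LHS]tnthS.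
by move=> ->; rewrite unlift_none.
Qed.

Lemma measurable_ins n (j : 'I_n.+1) :
  measurable_fun setT (fun z : Tup R n * RT R => ins j z.2 z.1).
Proof.
apply/measurable_fun_tnthP => i /=.
rewrite (_ : _ \o _ = fun z : Tup R n * RT R =>
    if unlift j i is Some k then tnth z.1 k else z.2); last first.
  by apply/funext => z /=; rewrite tnth_mktuple.
case: (unlift j i) => [k|]; last exact: measurable_snd.
exact: (measurable_fun_tnth k measurable_fst).
Qed.

(** Tonelli with coordinate [j] innermost; the induction keeps the first coordinate outermost. *)
Lemma ge0_integral_ins n (j : 'I_n.+1) (f : Tup R n.+1 -> \bar R) :
  measurable_fun setT f -> (forall w, 0 <= f w)%E ->
  (\int[Leb R n.+1]_w f w =
   \int[Leb R n]_t \int[lebesgue_measure]_s f (ins j s t))%E.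
Proof.
elim: n j f => [|n IH] j f mf f0.
  rewrite ge0_integral_tuple_cons//; apply: eq_integral => t _.
  by apply: eq_integral => s _; rewrite (ord1 j) ins_ord0.
have [j' ->|->] := unliftP ord0 j; last first.
  rewrite ge0_integral_tuple_cons//; apply: eq_integral => t _.
  by apply: eq_integral => s _; rewrite ins_ord0.
rewrite ge0_integral_tuple_cons'//.
rewrite [RHS]ge0_integral_tuple_cons'; last 2 first.
- apply: (measurable_fun_fubini_tonelli_F
    (fun z : Tup R n.+1 * RT R => f (ins (lift ord0 j') z.2 z.1))) => //.
  by apply: measurableT_comp => //; exact: measurable_ins.
- by move=> t; exact: integral_ge0.
apply: eq_integral => s0 _; rewrite (IH j')//.
  by apply: eq_integral => t _; apply: eq_integral => s _; rewrite ins_lift.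
apply: measurableT_comp => //; apply: (measurableT_comp (@measurable_tuple_cons _ _ _)).
exact: pair1_measurable.
Qed.

End coordinate_integration.

Section integral_C1.
Context (R : realType).

Lemma integral_derive_eq0 (G g : R -> R) (K : R) : 0 < K ->
  (forall s : R, is_derive s 1 G (g s)) -> continuous g ->
  (forall s : R, K <= `|s| -> G s = 0 /\ g s = 0) ->
  lebesgue_measure.-integrable setT (EFin \o g) /\
  (\int[lebesgue_measure]_s (g s)%:E = 0)%E.
Proof.
move=> K0 GP cg G0; have mg : measurable_fun setT g by exact: continuous_measurable_fun.
have ig : lebesgue_measure.-integrable `[- K, K] (EFin \o g).
  apply: continuous_compact_integrable; first exact: segment_compact.
  exact: continuous_subspaceT.
have E : (g \_ `[- K, K] = g)%R.
  apply/funext => s; rewrite patchE; case: ifPn => //.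
  rewrite mem_setE in_itv/= -ler_norml -ltNge => /ltW sK.
  by rewrite (G0 s sK).2.
have E' : (EFin \o g) \_ `[- K, K] = EFin \o g.
  by rewrite -[in RHS]E restrict_EFin.
split.
  have mI : @measurable _ (RT R) `[- K, K] by exact: measurable_itv.
  by have := (integrable_mkcond (mu := @lebesgue_measure R) (EFin \o g) mI).1 ig; rewrite E'.
transitivity (\int[lebesgue_measure]_(s in `[(- K)%R, K]) (g s)%:E)%E.
  by rewrite [RHS]integral_mkcond -/(EFin \o g) E'.
rewrite (@continuous_FTC2 _ g G).
- by rewrite (G0 K _).1 ?(G0 (- K) _).1 ?sube0 ?normrN// ger0_norm// ltW.
- lra.
- exact: continuous_subspaceT.
- have cG s : {for s, continuous G}.
    apply: differentiable_continuous; apply/derivable1_diffP.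
    by apply: ex_derive; exact: GP.
  split => [s _||]; first by apply: ex_derive; exact: GP.
    by apply: cvg_at_right_filter; exact: cG.
  by apply: cvg_at_left_filter; exact: cG.
- by move=> s _; rewrite derive1E; have [_ ->] := GP s.
Qed.

(** Integrable because bounded with support in a cube; the integral vanishes already on each line
    parallel to axis [j]. *)
Lemma integral_C1_derive n F dF (B : R) (j : 'I_n) : C1_field F dF ->
  (forall w, ~ cube n B w -> F w = 0) ->
  (Leb R n).-integrable setT (EFin \o dF j) /\
  (\int[Leb R n]_w (dF j w)%:E = 0)%E.
Proof.
case: n F dF j => [|n] F dF j CF F0; first by case: j.
have [_ cdF FP] := CF; have [mdF bdF cdFj] := cdF j.
have dF0 w : ~ cube n.+1 B w -> dF j w = 0 by move=> wB; exact: (C1_derive_eq0 j CF F0).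
have [C FC] := bdF B.
have iF : (Leb R n.+1).-integrable setT (EFin \o dF j).
  apply: (@le_integrable _ _ _ _ _ _ _ (fun w => (`|C| * \1_(cube n.+1 B) w)%:E)) => //.
  - exact/measurable_EFinP.
  - move=> w _ /=; rewrite lee_fin [leRHS]ger0_norm ?mulr_ge0// indicE.
    case: (boolP (w \in cube n.+1 B)) => wB.
      by rewrite mulr1 (le_trans (FC w _)) ?ler_norm//; move: wB; rewrite inE.
    by rewrite mulr0 dF0 ?normr0//; move: wB; rewrite notin_setE.
  - apply/integrableP; split.
      apply/measurable_EFinP; apply: measurable_funM => //.
      by apply: measurable_indic; exact: measurable_cube.
    under eq_integral do rewrite gee0_abs ?lee_fin ?mulr_ge0// EFinM.
    rewrite ge0_integralZl//; last first.
      by apply/measurable_EFinP; apply: measurable_indic; exact: measurable_cube.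
    rewrite integral_indic//; last exact: measurable_cube.
    by rewrite setIT lte_mul_pinfty//; exact: cube_lty.
split=> //; rewrite integralE.
have mEF : measurable_fun setT (EFin \o dF j) by exact/measurable_EFinP.
rewrite !(ge0_integral_ins j)//; last 2 first.
- exact: measurable_funeneg.
- exact: measurable_funepos.
(* Tonelli is applied to the positive and negative parts separately, so it suffices that their
   integrals agree on every line. *)
suff H t : (\int[lebesgue_measure]_s ((fun w => (dF j w)%:E)^\+ (ins j s t)) =
   \int[lebesgue_measure]_s ((fun w => (dF j w)%:E)^\- (ins j s t)))%E.
  under eq_integral do rewrite H.
  rewrite subee// -(ge0_integral_ins j); last 2 first.
  - exact: measurable_funeneg.
  - by [].
  exact: integrable_neg_fin_num.
pose K := `|B| + 1.
have [ig Ig] : lebesgue_measure.-integrable setT (EFin \o (fun s => dF j (ins j s t))) /\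
    (\int[lebesgue_measure]_s (dF j (ins j s t))%:E = 0)%E.
  apply: (@integral_derive_eq0 (fun s => F (ins j s t)) _ K).
  - by rewrite ltr_wpDl.
  - move=> s; have := FP (ins j s t) j; rewrite tnth_ins.
    by under eq_fun do rewrite upd_ins.
  - by have := cdFj (ins j 0 t) j; under eq_fun do rewrite upd_ins.
  - move=> s Ks; have nB : ~ cube n.+1 B (ins j s t).
      move=> /(_ j); rewrite tnth_ins; move: Ks; rewrite /K.
      by have := ler_norm B; lra.
    by rewrite F0// dF0.
move: Ig; rewrite integralE => /eqP; rewrite sube_eq ?add0e.
- move=> /eqP H. apply: (eq_trans _ (eq_trans H _)); apply: eq_integral => z _; rewrite ?funeposE ?funenegE //.
- exact: integrable_pos_fin_num.
- by rewrite fin_num_adde_defl//; exact: integrable_neg_fin_num.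
Qed.

End integral_C1.

(** * Stokes' theorem with the logarithmic cutoff *)

Section stokes.
Context (R : realType) (n : nat) (J : 'M[R]_n).
Hypothesis JJ : J *m J = - 1%:M.
Local Notation mu := (Leb R n).

Definition hess (p : caff R n) (i j : 'I_n) : R :=
  2 * (crow p 0 j * crow p 0 i + (crow p *m J) 0 j * (crow p *m J) 0 i).

Lemma hessC p i j : hess p i j = hess p j i.
Proof. by rewrite /hess [crow p 0 j * _]mulrC [(_ *m _) 0 j * _]mulrC. Qed.

Lemma C1_reX (p : caff R n) : C1_field (reX p) (fun j _ => crow p 0 j).
Proof. exact: C1_affine. Qed.

Lemma C1_imX (p : caff R n) : C1_field (imX J p) (fun j _ => (crow p *m J) 0 j).
Proof. exact: C1_affine. Qed.

Lemma C1_sqn (p : caff R n) : C1_field (sqn J p) (fun j w => dsqn J p w j).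
Proof.
apply: eq_C1 (C1D (C1M (C1_reX p) (C1_reX p)) (C1M (C1_imX p) (C1_imX p))) => [w|j w].
  by rewrite /sqn !expr2.
by rewrite /dsqn; ring.
Qed.

Lemma C1_dsqn (p : caff R n) i : C1_field (fun w => dsqn J p w i) (fun j _ => hess p i j).
Proof.
have C2 := C1_cst n (2 : R).
apply: eq_C1 (C1M C2 (C1D (C1M (C1_reX p) (C1_cst n (crow p 0 i)))
   (C1M (C1_imX p) (C1_cst n ((crow p *m J) 0 i))))) => [w|j w].
  by [].
by rewrite /hess; ring.
Qed.

Variables (K : finType) (p : K -> caff R n).
Let q k w := sqn J (p k) w.
Let D : set (Tup R n) := [set w | forall k, q k w != 0].
(** Makes the cutoff at large q compactly supported in w. *)
Hypothesis q_bounded : forall C, exists B, forall w, (forall k, q k w <= C) -> cube n B w.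
Variables (a b : K) (r : 'I_n) (e : 'I_n -> K).

Let repl (x : K) (i : 'I_n) : K := if i == r then x else e i.
Let l k w := ln (q k w).
Let dets k w := \det (\matrix_(i, j) dlog J (p (repl k i)) w j).

Section cutoff_identity.
Variables (L : R) (L0 : 0 < L).

(** Cut off in this way, ln q, 1 and 1 / q become C^1 across the zeros of q. In [y], slot r carries
    no 1 / q, since the derivatives of [u] and [v] provide the one for that slot. *)
Let u w k := cut (@ln R) L (q k w).
Let du w k := dcut (@ln R) (@GRing.inv R) L (q k w).
Let v w k := cut (cst 1) L (q k w).
Let dv w k := dcut (cst 1) (cst 0) L (q k w).
Let y w i := if i == r then 1 else cut (@GRing.inv R) L (q (e i) w).

Let V w := \prod_k v w k.
Let Y w := \prod_i y w i.
Let mx w (x : K) := \matrix_(i, j) dsqn J (p (repl x i)) w j.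

Let integrand w :=
  du w a * (u w b * (V w * Y w)) * \det (mx w a) +
  u w a * (du w b * (V w * Y w)) * \det (mx w b) +
  \sum_k u w a * (u w b * (dv w k * (\prod_(k' | k' != k) v w k') * Y w)) *
    \det (mx w k).

(* For every permutation s, the compactly supported product of u a, u b, V, Y and
   the partial derivatives of q (e i) in the coordinate s i, for i != r, is
   differentiated in the coordinate s r.  In the signed sum the Hessian terms
   cancel: exchange the values of s at i and r. *)
Lemma integral_cutoff :
  mu.-integrable setT (EFin \o integrand) /\
  (\int[mu]_w (integrand w)%:E = 0)%E.
Proof.
have Cu k : C1_field (u ^~ k) (fun j w => du w k * dsqn J (p k) w j).
  exact: C1_comp (cut_ln_C1 L0) (C1_sqn (p k)).
have Cv k : C1_field (v ^~ k) (fun j w => dv w k * dsqn J (p k) w j).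
  exact: C1_comp (cut_1_C1 L0) (C1_sqn (p k)).
pose dy w i := if i == r then 0 else
  dcut (@GRing.inv R) (fun q => - (q ^+ 2)^-1) L (q (e i) w).
have Cy i : C1_field (y ^~ i) (fun j w => dy w i * dsqn J (p (e i)) w j).
  rewrite /y /dy; case: eqP => _.
    by apply: eq_C1 (C1_cst n (1 : R)) => // j w; rewrite mul0r.
  exact: C1_comp (cut_inv_C1 L0) (C1_sqn (p (e i))).
have CV := C1_prod Cv; have CY := C1_prod Cy.
have CPsi := C1M (Cu a) (C1M (Cu b) (C1M CV CY)).
(* Slot r is left empty: its partial derivative arises from differentiating the cut-off product. *)
pose G (s : {perm 'I_n}) i w := if i == r then 1 else dsqn J (p (e i)) w (s i).
pose dG (s : {perm 'I_n}) i (j : 'I_n) (w : Tup R n) := if i == r then 0 else hess (p (e i)) (s i) j.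
have CG s i : C1_field (G s i) (dG s i).
  rewrite /G /dG; case: eqP => _; first exact: C1_cst.
  exact: C1_dsqn.
have CF s := C1M CPsi (C1_prod (CG s)).
have [B qB] := q_bounded (expR L).
have F0 s w : ~ cube n B w -> u w a * (u w b * (V w * Y w)) * \prod_i G s i w = 0.
  move=> wB; have [k qk] : exists k, expR L < q k w.
    by apply: contrapT => /forallNP H; apply/wB/qB => k; rewrite leNgt; apply/negP.
  suff -> : V w = 0 by rewrite mul0r !mulr0 mul0r.
  by rewrite /V (bigD1 k)//= [v w k](cut_large _ L0 (ltW qk)) mul0r.
pose dPsi j w := du w a * dsqn J (p a) w j * (u w b * (V w * Y w)) +
  u w a * (du w b * dsqn J (p b) w j * (V w * Y w) +
   u w b * ((\sum_k dv w k * dsqn J (p k) w j * \prod_(k' | k' != k) v w k') * Y w +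
    V w * \sum_i dy w i * dsqn J (p (e i)) w j * \prod_(i' | i' != i) y w i')).
pose dF (s : {perm 'I_n}) w := dPsi (s r) w * \prod_i G s i w + u w a * (u w b * (V w * Y w)) *
  \sum_i dG s i (s r) w * \prod_(k | k != i) G s k w.
have HF s : mu.-integrable setT (EFin \o dF s) /\ (\int[mu]_w (dF s w)%:E = 0)%E.
  exact: (integral_C1_derive (s r) (CF s) (F0 s)).
have DG w x : \sum_(s : {perm 'I_n}) (-1) ^+ s * (dsqn J (p x) w (s r) * \prod_i G s i w) =
    \det (mx w x).
  apply: eq_bigr => s _; congr (_ * _); rewrite [RHS](bigD1 r)//= mxE /repl eqxx.
  congr (_ * _); rewrite (bigD1 r)//= {1}/G eqxx mul1r.
  by apply: eq_bigr => i ir; rewrite mxE /G /repl (negbTE ir).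
(* Differentiating the factor 1 / q of slot i puts the differential of [e i] into slot r as well, so
   two rows agree. *)
have De w i : i != r -> \det (mx w (e i)) = 0.
  move=> ir; apply: (determinant_alternate ir) => j.
  by rewrite !mxE /repl eqxx (negbTE ir).
have Hess0 w i : \sum_(s : {perm 'I_n}) (-1) ^+ s * (dG s i (s r) w * \prod_(k | k != i) G s k w) = 0.
  have [->|ir] := eqVneq i r.
    by rewrite big1// => s _; rewrite /dG eqxx mul0r mulr0.
  set Z := \sum_s _; suff : Z = - Z by lra.
  rewrite {1}/Z (reindex_inj (mulgI (tperm i r))) /= -sumrN; apply: eq_bigr => s _.
  rewrite odd_permM odd_tperm ir /= signrN mulNr; congr (- (_ * (_ * _))).
    by rewrite /dG (negbTE ir) !permM tpermL tpermR hessC.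
  apply: eq_bigr => k ki; rewrite /G permM; case: eqVneq => // kr.
  by rewrite tpermD// eq_sym.
have E w : integrand w = \sum_(s : {perm 'I_n}) (-1) ^+ s * dF s w.
  rewrite /dF; under eq_bigr do rewrite mulrDr.
  rewrite big_split /= [X in _ = _ + X](_ : _ = 0) ?addr0; last first.
    under eq_bigr do rewrite mulrCA mulr_sumr.
    rewrite -mulr_sumr exchange_big /= big1 ?mulr0// => i _; exact: Hess0.
  pose c3 k := u w a * (u w b * (dv w k * (\prod_(k' | k' != k) v w k') * Y w)).
  pose c4 i := u w a * (u w b * (V w * (dy w i * \prod_(i' | i' != i) y w i'))).
  have -> : \sum_(s : {perm 'I_n}) (-1) ^+ s * (dPsi (s r) w * \prod_i G s i w) =
     du w a * (u w b * (V w * Y w)) * \det (mx w a) +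
     u w a * (du w b * (V w * Y w)) * \det (mx w b) +
     \sum_k c3 k * \det (mx w k) + \sum_i c4 i * \det (mx w (e i)).
    rewrite -!DG; under [X in _ + X + _]eq_bigr do rewrite -DG mulr_sumr.
    under [X in _ + X]eq_bigr do rewrite -DG mulr_sumr.
    rewrite exchange_big /= [X in _ + X]exchange_big /= !mulr_sumr -!big_split /=.
    apply: eq_bigr => s _; rewrite /dPsi.
    have -> : \sum_k dv w k * dsqn J (p k) w (s r) * \prod_(k' | k' != k) v w k' =
       \sum_k (dv w k * \prod_(k' | k' != k) v w k') * dsqn J (p k) w (s r).
      by apply: eq_bigr => k _; rewrite mulrAC.
    have -> : \sum_i dy w i * dsqn J (p (e i)) w (s r) * \prod_(i' | i' != i) y w i' =
       \sum_i (dy w i * \prod_(i' | i' != i) y w i') * dsqn J (p (e i)) w (s r).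
      by apply: eq_bigr => i _; rewrite mulrAC.
    have -> : \sum_k c3 k * ((-1) ^+ s * (dsqn J (p k) w (s r) * \prod_i G s i w)) =
       u w a * u w b * Y w * (-1) ^+ s * (\prod_i G s i w) *
       \sum_k (dv w k * \prod_(k' | k' != k) v w k') * dsqn J (p k) w (s r).
      rewrite mulr_sumr; apply: eq_bigr => k _; rewrite /c3.
      move: (u w a) (u w b) (dv w k) (\prod_(k' | _) _) (Y w) ((-1) ^+ s)
        (dsqn _ _ _ _) (\prod_i _) => x1 x2 x3 x4 x5 x6 x7 x8; ring.
    have -> : \sum_i c4 i * ((-1) ^+ s * (dsqn J (p (e i)) w (s r) * \prod_i0 G s i0 w)) =
       u w a * u w b * V w * (-1) ^+ s * (\prod_i G s i w) *
       \sum_i (dy w i * \prod_(i' | i' != i) y w i') * dsqn J (p (e i)) w (s r).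
      rewrite mulr_sumr; apply: eq_bigr => i _; rewrite /c4.
      move: (u w a) (u w b) (dy w i) (\prod_(i' | i' != i) _) (V w) ((-1) ^+ s)
        (dsqn _ _ _ _) (\prod_i0 _) => x1 x2 x3 x4 x5 x6 x7 x8; ring.
    move: (\sum_k _) (\sum_i _) (\prod_i _) ((-1) ^+ s) (V w) (Y w) (u w a) (u w b)
      (du w a) (du w b) (dsqn J (p a) w (s r)) (dsqn J (p b) w (s r)).
    move=> x1 x2 x3 x4 x5 x6 x7 x8 x9 x10 x11 x12; ring.
  rewrite [X in _ = _ + X]big1 ?addr0// => i _.
  have [->|ir] := eqVneq i r; last by rewrite De// mulr0.
  by rewrite /c4 /dy eqxx !(mul0r, mulr0).
have Ef : EFin \o integrand = (fun w => \sum_(s : {perm 'I_n}) ((-1) ^+ s)%:E * (dF s w)%:E)%E.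
  by apply/funext => w /=; rewrite E -sumEFin.
have iF (s : {perm 'I_n}) : mu.-integrable setT (fun w => ((-1) ^+ s)%:E * (dF s w)%:E)%E.
  by apply: integrableZl => //; exact: (HF s).1.
split; first by rewrite Ef; apply: integrable_sum => // s _; exact: iF.
rewrite -[LHS]/(\int[mu]_w ((EFin \o integrand) w))%E Ef integral_sum//.
rewrite big1// => s _; rewrite integralZl//; last exact: (HF s).1.
by rewrite (HF s).2 mule0.
Qed.

Let x k w := l k w / L.
Let bumps w := (\prod_k bump (x k w)) * \prod_(i | i != r) bump (x (e i) w).

(** [integrand] with the powers of q cancelled: each term is a bounded factor times a logarithmic
    form. In the last sum, 1 / L from the derivative of the cutoff has been joined to [l a w],
    giving [x a w]. *)
Let limiting w :=
  (bump (x a w) + x a w * dbump (x a w)) * bump (x b w) * bumps w * (l b w * dets a w) +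
  (bump (x b w) + x b w * dbump (x b w)) * bump (x a w) * bumps w * (l a w * dets b w) +
  \sum_k dbump (x k w) * (x a w * bump (x a w)) * bump (x b w) *
    ((\prod_(k' | k' != k) bump (x k' w)) * \prod_(i | i != r) bump (x (e i) w)) *
    (l b w * dets k w).

Lemma integral_limiting : measurable D ->
  mu.-integrable D (EFin \o limiting) /\ (\int[mu]_(w in D) (limiting w)%:E = 0)%E.
Proof.
move=> mD; have [iI I0] := integral_cutoff.
have ED w : D w -> integrand w = limiting w.
  move=> Dw; have q0 k : 0 < q k w by rewrite lt_neqAle eq_sym Dw sqn_ge0.
  have detY k : Y w * \det (mx w k) = q k w *
      ((\prod_(i | i != r) bump (x (e i) w)) * dets k w).
    have -> : mx w k = diag_mx (\row_i q (repl k i) w) *m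
        \matrix_(i, j) dlog J (p (repl k i)) w j.
      apply/matrixP => i j; rewrite mul_diag_mx !mxE /dlog mulrC divfK//; exact: Dw.
    rewrite det_mulmx det_diag -/(dets k w) mulrA (bigD1 r)//= /Y (bigD1 r)//=.
    rewrite /y eqxx mul1r mulrA; congr (_ * _); rewrite mxE /repl eqxx mulrCA.
    congr (_ * _); rewrite -big_split /=; apply: eq_bigr => i ir.
    by rewrite mxE (negbTE ir) /cut q0 mulrC mulrA divff ?mul1r// gt_eqF.
  have dE k : du w k = (q k w)^-1 * (bump (x k w) + x k w * dbump (x k w)).
    by rewrite /du /dcut q0 /x /l; field; rewrite !gt_eqF.
  have vE k : v w k = bump (x k w) by rewrite /v /cut q0 mul1r.
  have VE : V w = \prod_k bump (x k w) by exact: eq_bigr.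
  have uE k : u w k = l k w * bump (x k w) by rewrite /u /cut q0.
  have dvE k : dv w k = (q k w)^-1 * (dbump (x k w) / L).
    by rewrite /dv /dcut q0 mul0r add0r mul1r; field; rewrite !gt_eqF.
  have mulA1 (x1 x2 x3 x4 x5 : R) : x1 * (x2 * (x3 * x4)) * x5 = x1 * x2 * x3 * (x4 * x5).
    by ring.
  have mulA2 (x1 x2 x3 x4 x5 x6 : R) : x1 * (x2 * (x3 * x4 * x5)) * x6 = x1 * x2 * x3 * x4 * (x5 * x6).
    by ring.
  rewrite /integrand /limiting /bumps; congr (_ + _ + _).
  - rewrite mulA1 detY dE uE VE.
    move: (q0 a) => /lt0r_neq0; move: (x a w) (bump (x a w)) (dbump (x a w)) (bump (x b w))
      (\prod_k bump (x k w)) (\prod_(i | i != r) bump (x (e i) w)) (l b w) (dets a w) (q a w).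
    by move=> x1 x2 x3 x4 x5 x6 x7 x8 x9 x0; field.
  - rewrite mulA1 detY dE uE VE.
    move: (q0 b) => /lt0r_neq0; move: (x b w) (bump (x a w)) (dbump (x b w)) (bump (x b w))
      (\prod_k bump (x k w)) (\prod_(i | i != r) bump (x (e i) w)) (l a w) (dets b w) (q b w).
    by move=> x1 x2 x3 x4 x5 x6 x7 x8 x9 x0; field.
  apply: eq_bigr => k _; rewrite mulA2 detY !uE dvE (eq_bigr (fun k => bump (x k w)))// /x.
  move: (q0 k) => /lt0r_neq0; move: L0 => /lt0r_neq0.
  move: (bump (l a w / L)) (dbump (l k w / L)) (bump (l b w / L))
    (\prod_(k0 | k0 != k) bump (l k0 w / L)) (\prod_(i | i != r) bump (l (e i) w / L))
    (l b w) (dets k w) (l a w) (q k w) L.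
  by move=> x1 x2 x3 x4 x5 x6 x7 x8 x9 x10 x0 x11; field; rewrite x0 x11.
(* If some q vanishes, so do its cutoff and the derivative of that cutoff, and every term of
   [integrand] contains one of the two. *)
have EC w : ~ D w -> integrand w = 0.
  move=> /existsNP[k /negP]; rewrite negbK => /eqP qk.
  have qL : q k w <= expR (- L) by rewrite qk expR_ge0.
  have vk : v w k = 0 := (cut_eq0 (cst 1) (cst 0) L0 qL).1.
  have dvk : dv w k = 0 := (cut_eq0 (cst 1) (cst 0) L0 qL).2.
  have V0 : V w = 0 by rewrite /V (bigD1 k)//= vk mul0r.
  rewrite /integrand V0 !(mul0r, mulr0) !add0r big1// => k' _.
  have [->|kk] := eqVneq k' k; first by rewrite dvk !(mul0r, mulr0).
  by rewrite (bigD1 k) 1?eq_sym//= vk !(mul0r, mulr0).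
split.
  apply: (eq_integrable mD (EFin \o integrand)).
    by move=> w /set_mem Dw; rewrite /= ED.
  exact: integrableS iI.
rewrite -I0 [RHS](_ : _ = \int[mu]_(w in D) (integrand w)%:E)%E.
  by apply: eq_integral => w /set_mem Dw; rewrite ED.
rewrite [RHS]integral_mkcond; apply: eq_integral => w _; rewrite patchE.
by case: ifPn => //; rewrite notin_setE => /EC ->.
Qed.
End cutoff_identity.

Lemma cvg_bump (x : R) : [/\ bump (x / m.+1%:R) @[m --> \oo] --> (1 : R),
  dbump (x / m.+1%:R) @[m --> \oo] --> (0 : R) &
  x / m.+1%:R @[m --> \oo] --> (0 : R)].
Proof.
have xm : x / m.+1%:R @[m --> \oo] --> (0 : R).
  rewrite -(mulr0 x); apply: cvgM; first exact: cvg_cst.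
  exact: cvg_harmonic.
have cb : {for (0 : R), continuous (@bump R)}.
  by apply/differentiable_continuous/derivable1_diffP; case: (is_derive_bump (0 : R)).
split => //.
  by have := cvg_comp _ _ xm cb; rewrite (bump0 R).1.
by have := cvg_comp _ _ xm (@continuous_dbump R 0); rewrite (bump0 R).2.
Qed.
Lemma norm_mul_bump (x : R) : `|x * bump x| <= 1.
Proof.
have [x1|x1] := leP 1 `|x|; first by rewrite (bump_eq0 x1).1 mulr0 normr0.
by rewrite normrM [`|bump x|]ger0_norm ?bump_ge0// mulr_ile1 ?bump_ge0 ?bump_le1// ltW.
Qed.

Lemma prod_bump_itv (I : finType) (P : pred I) (F : I -> R) :
  0 <= \prod_(i | P i) bump (F i) <= 1.
Proof.
rewrite prodr_ge0 /=; last by move=> i _; exact: bump_ge0.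
by apply: prodr_ile1 => i _; rewrite bump_ge0 bump_le1.
Qed.

Lemma cvg_prod_bump (I : finType) (P : pred I) (F : I -> R) :
  (\prod_(i | P i) bump (F i / m.+1%:R)) @[m --> \oo] --> (1 : R).
Proof.
rewrite [X in _ --> X](_ : 1 = \prod_(i in I | P i) 1); last by rewrite big1_eq.
apply: cvg_big => [|i _]; first exact: mul_continuous.
by case: (cvg_bump (F i)).
Qed.

(** The integral of the differential of l_a l_b times the wedge of the other d log's, which is
    closed. Let L tend to infinity in the cutoff identity, by dominated convergence. *)
Theorem log_stokes : measurable D ->
  \int[mu]_(w in D) logform J (p b) (fun i => p (repl a i)) w +
  \int[mu]_(w in D) logform J (p a) (fun i => p (repl b i)) w = 0.
Proof.
move=> mD.
pose h k k' := logform J (p k) (fun i => p (repl k' i)).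
have ih k k' : mu.-integrable D (EFin \o h k k').
  by apply: integrable_logform => // w Dw; split; [exact: Dw|move=> i; exact: Dw].
pose x (m : nat) k w := l k w / m.+1%:R.
pose bumps m w := (\prod_k bump (x m k w)) * \prod_(i | i != r) bump (x m (e i) w).
pose f m w :=
  (bump (x m a w) + x m a w * dbump (x m a w)) * bump (x m b w) * bumps m w * h b a w +
  (bump (x m b w) + x m b w * dbump (x m b w)) * bump (x m a w) * bumps m w * h a b w +
  \sum_k dbump (x m k w) * (x m a w * bump (x m a w)) * bump (x m b w) *
    ((\prod_(k' | k' != k) bump (x m k' w)) * \prod_(i | i != r) bump (x m (e i) w)) *
    h b k w.
have If m : mu.-integrable D (EFin \o f m) /\ (\int[mu]_(w in D) (f m w)%:E = 0)%E.
  exact: (integral_limiting (ltr0Sn R m) mD).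
pose F w := h b a w + h a b w.
have iF : mu.-integrable D (EFin \o F).
  rewrite [EFin \o F](_ : _ = ((EFin \o h b a) \+ (EFin \o h a b))%E)//.
  exact: integrableD.
(* 5 bounds |bump + x dbump| by 1 + 4, and 4 bounds |dbump|; the remaining factors are at most 1. *)
pose g w := (5%:E * `|(h b a w)%:E| + 5%:E * `|(h a b w)%:E| +
  \sum_(k <- index_enum K) 4%:E * `|(h b k w)%:E|)%E.
have ig : mu.-integrable D g.
  apply: integrableD => //.
    by apply: integrableD => //; apply: integrableZl => //; apply: integrable_abse; exact: ih.
  by apply: integrable_sum => // k _; apply: integrableZl => //; apply: integrable_abse; exact: ih.
have fF w : D w -> f m w @[m --> \oo] --> F w.
  move=> _.
  have cb k : bump (x m k w) @[m --> \oo] --> (1 : R) by case: (cvg_bump (l k w)).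
  have cd k : dbump (x m k w) @[m --> \oo] --> (0 : R) by case: (cvg_bump (l k w)).
  have cx k : x m k w @[m --> \oo] --> (0 : R) by case: (cvg_bump (l k w)).
  have cB : bumps m w @[m --> \oo] --> (1 : R).
    rewrite -[X in _ --> X]mulr1; apply: cvgM; exact: cvg_prod_bump.
  have c1 k k' k'' : (bump (x m k w) + x m k w * dbump (x m k w)) * bump (x m k' w) *
     bumps m w * h k' k'' w @[m --> \oo] --> h k' k'' w.
    rewrite -[X in _ --> X]mul1r -[X in X * h _ _ _]mulr1 -[X in X * 1 * h _ _ _]mulr1.
    apply: cvgM; last exact: cvg_cst.
    apply: cvgM => //; apply: cvgM => //.
    rewrite -[X in _ --> X]addr0 -(mulr0 0); apply: cvgD => //; exact: cvgM.
  rewrite /F -[X in _ --> X]addr0; apply: cvgD; first by apply: cvgD; exact: c1.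
  rewrite [X in _ --> X](_ : 0 = \sum_(k in K) (0 : R)); last by rewrite big1_eq.
  apply: cvg_big => [|k _]; first exact: add_continuous.
  rewrite -(mul0r (h b k w)); apply: cvgM; last exact: cvg_cst.
  rewrite -(mul0r (1 * 1)); apply: cvgM; last by apply: cvgM; exact: cvg_prod_bump.
  rewrite -(mul0r 1); apply: cvgM => //.
  rewrite -(mul0r (0 * 1)); apply: cvgM => //; exact: cvgM.
have fg w m : D w -> (`|(f m w)%:E| <= g w)%E.
  move=> _.
  have b01 k : `|bump (x m k w)| <= 1 by rewrite ger0_norm ?bump_ge0 ?bump_le1.
  have p01 (I : finType) (P : pred I) (G : I -> R) : `|\prod_(i | P i) bump (G i)| <= 1.
    by have /andP[? ?] := prod_bump_itv P G; rewrite ger0_norm.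
  have B01 : `|bumps m w| <= 1.
    by rewrite normrM mulr_ile1.
  have d5 k k' k'' : `|(bump (x m k w) + x m k w * dbump (x m k w)) * bump (x m k' w) *
     bumps m w * h k' k'' w| <= 5 * `|h k' k'' w|.
    rewrite normrM ler_wpM2r// normrM -[leRHS]mulr1 ler_pM// normrM -[leRHS]mulr1 ler_pM//.
    rewrite (le_trans (ler_normD _ _))//.
    have := (norm_dbump (x m k w)).2; have := b01 k; lra.
  rewrite /g /=; under eq_bigr do rewrite -EFinM.
  rewrite sumEFin -!EFinM -!EFinD lee_fin.
  rewrite (le_trans (ler_normD _ _))// lerD//.
    by rewrite (le_trans (ler_normD _ _))// lerD.
  rewrite (le_trans (ler_norm_sum _ _ _))//; apply: ler_sum => k _.
  rewrite normrM ler_wpM2r// -[leRHS]mulr1 normrM ler_pM//; last by rewrite normrM mulr_ile1.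
  rewrite normrM -[leRHS]mulr1 ler_pM// normrM -[leRHS]mulr1 ler_pM//.
    exact: (norm_dbump _).1.
  exact: norm_mul_bump.
have [] := @dominated_convergence _ _ _ mu D mD (fun m => EFin \o f m) (EFin \o F) g _ _ _ ig.
- by move=> m; exact: measurable_int (If m).1.
- exact: measurable_int iF.
- by apply/aeW => w Dw; apply: cvg_EFin; [exact: nearW|exact: fF].
- by apply/aeW => w m; exact: fg.
move=> _ _.
rewrite [X in X @ _ --> _](_ : _ = cst 0%E); last by apply/funext => m; exact: (If m).2.
move/cvg_lim => /(_ (@ereal_hausdorff R)); rewrite lim_cst; last exact: ereal_hausdorff.
move=> F0; rewrite -RintegralD//; [|exact: ih|exact: ih].
by rewrite -[LHS]/(fine (\int[mu]_(w in D) (EFin \o F) w)%E) -F0.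
Qed.
End stokes.

(** * Alternating sums over edges *)

(** Both lists are strictly increasing and have the same members. *)
Lemma filter_neq_enum n (x : 'I_n.+1) :
  [seq y <- enum 'I_n.+1 | y != x] = [seq lift x i | i <- enum 'I_n].
Proof.
have lt_trans : transitive (fun i j : 'I_n.+1 => (i < j)%N) by move=> j i k; exact: ltn_trans.
apply: (@irr_sorted_eq _ _ lt_trans) => [i|||y]; first exact: ltnn.
- apply: sorted_filter => //; rewrite -(@sorted_map _ _ (@nat_of_ord n.+1) ltn) val_enum_ord.
  exact: iota_ltn_sorted.
- rewrite (@sorted_map _ _ (lift x)) (@eq_sorted _ _ (fun i j : 'I_n => (i < j)%N)).
    by rewrite -(@sorted_map _ _ (@nat_of_ord n) ltn) val_enum_ord iota_ltn_sorted.
  by move=> i j; rewrite /= !ltnNge leq_bump2.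
rewrite mem_filter mem_enum andbT; apply/idP/mapP => [yx|[i _ ->]]; last first.
  by rewrite eq_sym neq_lift.
have [i ->|/eqP] := unliftP x y; last by rewrite (negbTE yx).
by exists i => //; rewrite mem_enum.
Qed.

Lemma nth_other_edges n (d : 'I_n.+2) (l : 'I_n.+1) (i : 'I_n) :
  nth (lift d l) (other_edges (lift d l) d) i = lift d (lift l i).
Proof.
rewrite /other_edges filter_predI filter_neq_enum filter_map.
rewrite (@eq_filter _ _ (fun j => j != l)); last by move=> j /=; rewrite (inj_eq lift_inj).
rewrite filter_neq_enum -map_comp (nth_map i) ?size_enum_ord//.
by rewrite /= nth_ord_enum.
Qed.

Lemma other_edgesC n (l d : 'I_n) : other_edges l d = other_edges d l.
Proof. by apply: eq_filter => e; rewrite andbC. Qed.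

Lemma perm_lift_perm n (s : {perm 'I_n.+1}) (x : 'I_n.+1) :
  exists t, s = lift_perm x (s x) t.
Proof.
have sP i : {j | s (lift x i) = lift (s x) j & unlift (s x) (s (lift x i)) = Some j}.
  by apply: unlift_some; rewrite (inj_eq perm_inj) neq_lift.
have tI : injective (fun i => s2val (sP i)).
  move=> i j; case: (sP i) => /= k ki _; case: (sP j) => /= k' kj _ E.
  by apply: (@lift_inj _ x); apply: (@perm_inj _ s); rewrite ki kj E.
exists (perm tI); apply/permP => y; have [i ->|->] := unliftP x y.
  by rewrite lift_perm_lift permE; case: (sP i).
by rewrite lift_perm_id.
Qed.

Definition subst_at (N : nat) (T : Type) (e : 'I_N -> T) (r : 'I_N) x i :=
  if i == r then x else e i.

Section alternating_sum.
Context (R : numDomainType) (N : nat).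

Variable I : 'I_N.+2 -> ('I_N -> 'I_N.+2) -> R.
Hypothesis I_swap : forall a b r e, I b (subst_at e r a) = - I a (subst_at e r b).

(** All N + 1 slots on an equal footing: slot 0 is the edge under the logarithm. *)
Let A (g : 'I_N.+1 -> 'I_N.+2) := I (g ord0) (fun i => g (lift ord0 i)).

Lemma alternating0 g i : i != ord0 -> A (fun j => g (tperm ord0 i j)) = - A g.
Proof.
have [r -> _|->] := unliftP ord0 i; last by rewrite eqxx.
rewrite /A tpermL; set e := fun i => g (lift ord0 i).
have := I_swap (g ord0) (g (lift ord0 r)) r e.
rewrite [X in - I _ X](_ : _ = e); last first.
  by apply/funext => j; rewrite /subst_at; case: eqP => // ->.
move=> <-; congr (I _ _); apply/funext => j; rewrite /subst_at; case: eqVneq => [->|jr].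
  by rewrite tpermR.
by rewrite tpermD// ?neq_lift// (inj_eq lift_inj) eq_sym.
Qed.

(** The hypothesis covers transpositions with slot 0; any other one, (i j), is the conjugate of (0
    j) by (0 i). *)
Lemma alternating_perm g (s : {perm 'I_N.+1}) : A (fun j => g (s j)) = (-1) ^+ s * A g.
Proof.
have tA (h : 'I_N.+1 -> 'I_N.+2) i j : i != j -> A (fun k => h (tperm i j k)) = - A h.
  move=> ij; have [i0|i0] := eqVneq i ord0; first by rewrite i0 alternating0// -i0 eq_sym.
  have [->|j0] := eqVneq j ord0; first by rewrite tpermC alternating0.
  have -> : (fun k => h (tperm i j k)) =
      (fun k => h (tperm ord0 i (tperm ord0 j (tperm ord0 i k)))).
    have E : tperm i j = (tperm ord0 j ^ tperm ord0 i)%g.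
      by rewrite tpermJ tpermL tpermD// eq_sym.
    by apply/funext => k; rewrite E /conjg tpermV !permM.
  rewrite (alternating0 (fun k => h (tperm ord0 i (tperm ord0 j k))))//.
  by rewrite (alternating0 (fun k => h (tperm ord0 i k)))// alternating0// opprK.
have [ts -> uts] := prod_tpermP s; elim: ts uts g => [|t ts IH] /=.
  by move=> _ g; rewrite big_nil odd_perm1 expr0 mul1r; congr A; apply/funext => j; rewrite perm1.
move=> /andP[tt uts] g; rewrite big_cons odd_permM odd_tperm tt addTb signrN mulNr.
pose s' := (\prod_(t0 <- ts) tperm t0.1 t0.2)%g.
rewrite -[RHS]/(- ((-1) ^+ s' * A g)) -IH// -(tA (fun k => g (s' k)) _ _ tt).
by congr A; apply/funext => j; rewrite permM.
Qed.

(* The value of I on all edges but x, up to sign. *)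
Let kappa (x : 'I_N.+2) := (-1) ^+ nat_of_ord x * A (lift x).

(** Restricted to the complement of x, [s] is a permutation [t] up to the increasing enumerations
    [lift], and the sign of [s] is that of [t] times the parity of x + s x. *)
Lemma alternating_lift (s : {perm 'I_N.+2}) (x : 'I_N.+2) :
  A (fun i => s (lift x i)) = (-1) ^+ (s (+) odd x) * kappa (s x).
Proof.
have [t st] := perm_lift_perm s x.
rewrite /kappa {1 2}st odd_lift_perm.
have -> : (fun i => lift_perm x (s x) t (lift x i)) = (fun i => lift (s x) (t i)).
  by apply/funext => i; rewrite lift_perm_lift.
rewrite alternating_perm mulrA; congr (_ * _).
rewrite -[X in _ = _ * X]signr_odd -signr_addb; congr ((-1) ^+ nat_of_bool _).
by move: (odd_perm t) (odd x) (odd (s x)) => [] [] [].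
Qed.

Lemma alternating_other_edges (l d : 'I_N.+2) : l != d ->
  let E (i : 'I_N) := nth l (other_edges l d) i in
  [/\ (-1) ^+ (l + d + (l < d)%N) * I l E = - kappa d,
    forall r, (-1) ^+ (l + d + (l < d)%N) * I l (subst_at E r d) = kappa (E r) &
    \sum_x kappa x = kappa d + kappa l + \sum_(r < N) kappa (E r)].
Proof.
have [l' -> _|->] := unliftP d l; last by rewrite eqxx.
set E := fun i => _; have EE : E = (fun i => lift d (lift l' i)).
  by apply/funext => i; rewrite /E nth_other_edges.
(* [s] lists all edges in the order d, l, then the remaining ones increasingly. *)
pose s := lift_perm ord0 d (lift_perm ord0 l' 1%g).
have s0 : s ord0 = d by rewrite /s lift_perm_id.
have s1 : s (lift ord0 ord0) = lift d l' by rewrite /s lift_perm_lift lift_perm_id.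
have sE i : s (lift ord0 (lift ord0 i)) = lift d (lift l' i).
  by rewrite /s !lift_perm_lift perm1.
(* If l' >= d, lifting adds 1 to l' and the comparison is false; otherwise the comparison is true
   and contributes the 1. *)
have sgn : (-1) ^+ (lift d l' + d + (lift d l' < d)%N) * (-1) ^+ odd_perm s = -1 :> R.
  have -> : (lift d l' + d + (lift d l' < d) = (l' + d).+1)%N.
    rewrite /= /fintype.bump; move: (nat_of_ord l') (nat_of_ord d) => i j.
    have [ji|ij] := leqP j i; last by rewrite add0n ij addn1.
    by rewrite add1n ltnNge (leq_trans ji (leqnSn i)) addn0.
  rewrite /s !odd_lift_perm odd_perm1 /= -signr_odd -signr_addb /= oddD.
  by move: (odd l') (odd d) => [] [].
split.
- rewrite EE -s1 (_ : (fun i => _) = (fun i => s (lift ord0 (lift ord0 i)))); last first.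
    by apply/funext => i; rewrite sE.
  rewrite -[I _ _]/(A (fun i => s (lift ord0 i))) alternating_lift s0 s1 addbF.
  by rewrite mulrA sgn mulN1r.
(* After the exchange of d and [E r], the list starts with the omitted edge [E r], and d stands in
   slot r. *)
- move=> r; pose t := (s * tperm (E r) d)%g.
  have Erd : E r != d by rewrite EE eq_sym neq_lift.
  have El i : lift d l' != E i by rewrite EE (inj_eq lift_inj) neq_lift.
  have -> : I (lift d l') (subst_at E r d) = A (fun i => t (lift ord0 i)).
    have t1 : t (lift ord0 ord0) = lift d l'.
      by rewrite permM s1 tpermD ?neq_lift// eq_sym.
    rewrite /A t1; congr (I _ _); apply/funext => i.
    rewrite permM sE /subst_at; case: eqVneq => [->|ir].
      by rewrite [lift d _](_ : _ = E r) ?tpermL// EE.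
    rewrite tpermD ?neq_lift ?EE//; by rewrite !(inj_eq lift_inj) eq_sym.
  rewrite alternating_lift permM s0 tpermR odd_permM odd_tperm Erd addbT addbF.
  by rewrite signrN mulNr mulrN mulrA sgn mulN1r opprK.
rewrite (bigD1_ord d)//= -addrA; congr (_ + _); rewrite (bigD1_ord l')//=; congr (_ + _).
by apply: eq_bigr => i _; rewrite EE.
Qed.

(** On the left, each omitted edge d' occurs once for each of the N + 1 choices of l'; on the right,
    the bracket contains every omitted edge exactly once. *)
Lemma alternating_edge_sumS (l d : 'I_N.+2) : l != d ->
  let E (i : 'I_N) := nth l (other_edges l d) i in
  \sum_(l' < N.+2) \sum_(d' < N.+2 | d' != l')
    (-1) ^+ (l' + d' + (l' < d')%N) * I l' (fun i : 'I_N => nth l' (other_edges l' d') i) =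
  N.+1%:R * ((-1) ^+ (l + d + (l < d)%N) *
    (I l E - \sum_(r < N) I l (subst_at E r d) -
     (I d E - \sum_(r < N) I d (subst_at E r d)))).
Proof.
move=> ld E; have kappaE (l' d' : 'I_N.+2) : d' != l' ->
    (-1) ^+ (l' + d' + (l' < d')%N) * I l' (fun i : 'I_N => nth l' (other_edges l' d') i) = - kappa d'.
  by rewrite eq_sym => /alternating_other_edges[].
under eq_bigr do under eq_bigr do rewrite kappaE//.
have [El Er sumE] := alternating_other_edges ld.
have dl : d != l by rewrite eq_sym.
have Ed : (-1) ^+ (l + d + (l < d)%N) * I d E = kappa l.
  have [Ed _ _] := alternating_other_edges dl.
  have sgn : (-1) ^+ (l + d + (l < d)%N) = - (-1) ^+ (d + l + (d < l)%N) :> R.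
    rewrite -signr_odd -[in RHS]signr_odd -signrN; congr (_ ^+ _).
    rewrite !oddD [odd d (+) _]addbC -addbN; congr (nat_of_bool (_ (+) _)).
    by case: (ltngtP l d) ld => // /val_inj ->; rewrite eqxx.
  rewrite sgn mulNr; apply: oppr_inj; rewrite opprK -Ed; congr (_ * I _ _).
  apply/funext => i; rewrite /E other_edgesC; apply: set_nth_default.
  by rewrite size_other_edges.
(* Here d occupies both slot 0 and slot r, and antisymmetry forces 0. *)
rewrite (_ : \sum_r I d _ = 0) ?subr0; last first.
  rewrite big1// => r _; apply/eqP.
  by rewrite -eqNr -I_swap.
have -> : (-1) ^+ (l + d + (l < d)%N) *
    (I l E - \sum_(r < N) I l (subst_at E r d) - I d E) = - \sum_x kappa x.
  rewrite !mulrBr Ed El mulr_sumr (eq_bigr _ (fun r _ => Er r)) sumE !opprD.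
  by rewrite addrAC.
rewrite (exchange_big_dep xpredT)//= mulrN mulr_natl -sumrMnl -sumrN; apply: eq_bigr => x _.
rewrite sumr_const -mulNrn; congr (_ *+ _).
rewrite (eq_card (_ : _ =i predC1 x)) ?cardC1 ?card_ord// => y.
by rewrite inE eq_sym.
Qed.
End alternating_sum.

Theorem alternating_edge_sum (R : numDomainType) (N ne : nat)
    (I : 'I_ne -> ('I_N -> 'I_ne) -> R) : ne = N.+2 ->
    (forall a b r e, I b (subst_at e r a) = - I a (subst_at e r b)) ->
  forall l d : 'I_ne, l != d -> let E (i : 'I_N) := nth l (other_edges l d) i in
  \sum_(l' < ne) \sum_(d' < ne | d' != l')
    (-1) ^+ (l' + d' + (l' < d')%N) * I l' (fun i : 'I_N => nth l' (other_edges l' d') i) =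
  N.+1%:R * ((-1) ^+ (l + d + (l < d)%N) *
    (I l E - \sum_(r < N) I l (subst_at E r d) -
     (I d E - \sum_(r < N) I d (subst_at E r d)))).
Proof. by move=> neN; subst ne; exact: alternating_edge_sumS. Qed.

(** By multilinearity, since every term with two rows equal to [v] vanishes. The induction subtracts
    [v] from one more row at a time. *)
Lemma det_sub_row (R : comPzRingType) (N : nat) (u : 'I_N -> 'I_N -> R) (v : 'I_N -> R) :
  \det (\matrix_(i, j) (u i j - v j)) =
  \det (\matrix_(i, j) u i j) - \sum_r \det (\matrix_(i, j) subst_at u r v i j).
Proof.
pose M (k : nat) (u : 'I_N -> 'I_N -> R) := \matrix_(i, j) (u i j - (i < k)%:R * v j).
suff H k (u' : 'I_N -> 'I_N -> R) : (k <= N)%N -> \det (M k u') = \det (\matrix_(i, j) u' i j) -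
    \sum_(r < N | (r < k)%N) \det (\matrix_(i, j) subst_at u' r v i j).
  rewrite (_ : \matrix_(i, j) (u i j - v j) = M N u); last first.
    by apply/matrixP => i j; rewrite !mxE ltn_ord mul1r.
  by rewrite H//; congr (_ - _); apply: eq_bigl => r; rewrite ltn_ord.
elim: k u' => [|k IH] u' kN.
  rewrite big1// subr0; congr (\det _); apply/matrixP => i j.
  by rewrite !mxE mul0r subr0.
pose k' := Ordinal kN; pose uk := subst_at u' k' v.
have Hk (i : 'I_N) : i != k' -> (i < k.+1)%N = (i < k)%N.
  by rewrite ltnS leq_eqVlt -val_eqE /= => /negbTE ->.
have -> : \det (M k.+1 u') = 1 * \det (M k u') + (- 1) * \det (M k uk).
  apply: (determinant_multilinear (i0 := k')).
  - by apply/rowP => j; rewrite !mxE /uk /subst_at eqxx ltnSn ltnn mul0r mul1r !subr0 mul1r mulN1r.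
  - apply/matrixP => i j; rewrite !mxE Hk//; by rewrite eq_sym neq_lift.
  - apply/matrixP => i j; rewrite !mxE /uk /subst_at Hk 1?eq_sym ?neq_lift//.
    by rewrite (negbTE (neq_lift _ _)).
(* Row k' is already [v] in [uk], so a further replacement repeats it. *)
rewrite !IH 1?ltnW// [X in _ + -1 * (_ - X)]big1; last first.
  move=> r rk; have rk' : r != k' by rewrite -val_eqE /= ltn_eqF.
  apply: (determinant_alternate rk') => j.
  by rewrite !mxE /uk /subst_at !eqxx eq_sym (negbTE rk').
rewrite [in RHS](bigD1 k')/= ?ltnSn// -/uk mul1r subr0 mulN1r opprD addrA addrAC.
congr (_ - _ - _); apply: eq_bigl => r; have [->|rk] := eqVneq r k'.
  by rewrite ltnn andbF.
by rewrite andbT Hk.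
Qed.

(** * The chart of Z_n *)

Lemma is_diff_ln (R : realType) (V : normedModType R) (f df : V -> R) z :
  is_diff z f df -> 0 < f z -> is_diff z (fun x => ln (f x)) (fun v => df v / f z).
Proof.
move=> fz f0; have lnP := is_derive1_ln f0.
have dln : differentiable (@ln R) (f z) by apply/derivable1_diffP; case: lnP.
have H : is_diff (f z) (@ln R) (fun h => h / f z).
  apply: DiffDef => //; rewrite diff1E//; apply/funext => h.
  by rewrite derive1E; case: lnP => _ ->.
exact: (is_diff_eq (is_diff_comp fz H)).
Qed.

Section slice_chart.
Context (R : realType) (n : nat).
Local Notation N := (n.-1).*2.
Local Notation config := 'M[R]_(n.+1, 2).

(** On covectors dx goes to dy and dy to - dx, so the row of the real part of a holomorphic affine
    function goes to that of its imaginary part. *)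
Definition rot_mx : 'M[R]_N :=
  \matrix_(i, j) if odd i then - (i == j.+1 :> nat)%:R else (j == i.+1 :> nat)%:R.

Lemma rot_mx_sqr : rot_mx *m rot_mx = - 1%:M.
Proof.
apply/matrixP => i k; rewrite !mxE; have iN := ltn_ord i.
have [oi|ei] := boolP (odd i).
  have jN : (i.-1 < N)%N by rewrite (leq_ltn_trans (leq_pred _)).
  have i0 : i = i.-1.+1 :> nat by case: (nat_of_ord i) oi.
  rewrite (bigD1 (Ordinal jN))//= !mxE oi /= -i0 eqxx.
  have -> : odd i.-1 = false by move: oi; rewrite {1}i0 /= => /negbTE.
  rewrite big1 ?addr0; last first.
    move=> j /eqP jE; rewrite !mxE oi {1}i0 eqSS [_ == _](_ : _ = false) ?oppr0 ?mul0r//.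
    by apply/eqP => ij; apply: jE; apply: val_inj.
  by rewrite mulNr mul1r -val_eqE /= eq_sym.
have jN : (i.+1 < N)%N.
  rewrite ltn_neqAle iN andbT; apply: contra ei => /eqP E.
  by move: (congr1 odd E); rewrite /= odd_double => /negbFE.
rewrite (bigD1 (Ordinal jN))//= !mxE (negbTE ei) /= eqxx (negbTE ei) /= eqSS.
rewrite big1 ?addr0; last first.
  move=> j /eqP jE; rewrite !mxE (negbTE ei) [_ == _](_ : _ = false) ?mul0r//.
  by apply/eqP => ij; apply: jE; apply: val_inj.
by rewrite mul1r.
Qed.

(** Re z_u is coordinate 2 u - 4 of w; vertices 0 and 1 have zero rows and are fixed at 0 and 1. *)
Definition vertex_caff (u : 'I_n.+1) : caff R N :=
  Caff (\row_j (u.*2 == j.+4)%:R) (u == 1%N :> nat)%:R 0.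

Definition edge_caff (k : 'I_n.+1 * 'I_n.+1) : caff R N :=
  let a := vertex_caff k.1 in let b := vertex_caff k.2 in
  Caff (crow a - crow b) (cre a - cre b) (cim a - cim b).

Lemma vertex_caff_rot u j : (crow (vertex_caff u) *m rot_mx) 0 j = (u.*2.+1 == j.+4)%:R.
Proof.
rewrite mxE /=; have uN := ltn_ord u; have jN := ltn_ord j.
have [u2|u2] := ltnP u 2.
  rewrite big1 => [|i _]; first by case: (nat_of_ord u) u2 => [|[]].
  by rewrite mxE; case: (nat_of_ord u) u2 => [|[|]]//; rewrite mul0r.
have iN : (u.*2 - 4 < N)%N by move: u2 uN; move: (nat_of_ord u) => m; lia.
rewrite (bigD1 (Ordinal iN))//= !mxE big1 => [|i /eqP iE]; last first.
  rewrite mxE [_ == _](_ : _ = false) ?mul0r//; apply/eqP => E.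
  by apply: iE; apply: val_inj; rewrite /= E; lia.
rewrite addr0 /= oddB ?odd_double/=; last by lia.
have -> : (u.*2 == (u.*2 - 4).+4) = true by apply/eqP; lia.
by rewrite mul1r; congr (_%:R); congr nat_of_bool; apply/eqP/eqP; lia.
Qed.

Lemma sum_slice (w : N.-tuple R) (m : nat) :
  \sum_(j < N) (m == j.+4)%:R * tnth w j + (m == 2)%:R = nth 0 [:: 0, 0, 1, 0 & w] m :> R.
Proof.
case: m => [|[|[|[|m]]]]; try by rewrite big1 ?add0r// => j _; rewrite mul0r.
have [mN|mN] := ltnP m N.
  rewrite (bigD1 (Ordinal mN))//= eqxx mul1r big1 ?addr0 => [|i iE].
    by rewrite (tnth_nth 0).
  rewrite !eqSS [_ == _](_ : _ = false) ?mul0r//; apply/eqP => E.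
  by move/eqP: iE; apply; apply: val_inj; rewrite /= E.
rewrite /= nth_default ?size_tuple// big1 ?addr0// => j _.
by rewrite !eqSS gtn_eqF ?mul0r// (leq_trans (ltn_ord j)).
Qed.

Lemma reX_vertex u w : reX (vertex_caff u) w = slice w u ord0.
Proof.
rewrite mxE addn0 -sum_slice /reX /=; congr (_ + _).
  by apply: eq_bigr => j _; rewrite mxE.
by case: (nat_of_ord u) => [|[|]].
Qed.

Lemma imX_vertex u w : imX rot_mx (vertex_caff u) w = slice w u ord_max.
Proof.
rewrite mxE addn1 -sum_slice /imX; congr (_ + _).
  by apply: eq_bigr => j _; rewrite vertex_caff_rot.
by case: (nat_of_ord u) => [|[|]].
Qed.

Lemma reX_edge k w : reX (edge_caff k) w = slice w k.1 ord0 - slice w k.2 ord0.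
Proof.
rewrite -!reX_vertex /reX opprD addrACA -sumrB; congr (_ + _).
by apply: eq_bigr => j _; rewrite !mxE mulrBl.
Qed.

Lemma imX_edge k w :
  imX rot_mx (edge_caff k) w = slice w k.1 ord_max - slice w k.2 ord_max.
Proof.
rewrite -!imX_vertex /imX opprD addrACA -sumrB; congr (_ + _).
by apply: eq_bigr => j _; rewrite mulmxBl !mxE mulrBl.
Qed.
End slice_chart.

Section chart_differentials.
Context (R : realType) (n : nat).
Local Notation N := (n.-1).*2.
Local Notation config := 'M[R]_(n.+1, 2).
Implicit Type k : 'I_n.+1 * 'I_n.+1.

Definition dist2 k (z : config) : R :=
  (z k.1 ord0 - z k.2 ord0) ^+ 2 + (z k.1 ord_max - z k.2 ord_max) ^+ 2.

Lemma edge_sqnormE (G : edge_ordered_graph n.+1 (2 * n)) e z :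
  edge_sqnorm G e z = dist2 (src G e, tgt G e) z.
Proof. by rewrite /edge_sqnorm -add_Re2_Im2. Qed.

Lemma dist2_slice k w : dist2 k (slice w) = sqn (rot_mx R n) (edge_caff R k) w.
Proof. by rewrite /sqn reX_edge imX_edge. Qed.

Lemma dist2_eq0 k z : (dist2 k z == 0) = (Defs.point z k.1 == Defs.point z k.2).
Proof.
rewrite /dist2 paddr_eq0 ?sqr_ge0// !sqrf_eq0 !subr_eq0.
by rewrite /Defs.point eq_complex.
Qed.

Definition ddist2 k (z v : config) : R :=
  2 * ((z k.1 ord0 - z k.2 ord0) * (v k.1 ord0 - v k.2 ord0) +
       (z k.1 ord_max - z k.2 ord_max) * (v k.1 ord_max - v k.2 ord_max)).

Lemma is_diff_dist2 k z : is_diff z (dist2 k) (ddist2 k z).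
Proof.
have dc (i : 'I_n.+1) c : is_diff z (fun x : config => x i c) (fun v => v i c).
  apply: DiffDef; first exact: differentiable_coord.
  have @f : {linear config -> R}.
    by exists (fun x : config => x i c); do 2![eexists]; do ?[constructor];
       rewrite ?mxE// => ? *; rewrite ?mxE//; move=> ?; rewrite !mxE.
  by rewrite (_ : (fun _ => _) = f)// diff_lin//; exact: coord_continuous.
have ds c : is_diff z (fun x : config => (x k.1 c - x k.2 c) ^+ 2)
    (fun v => 2 * ((z k.1 c - z k.2 c) * (v k.1 c - v k.2 c))).
  apply: (is_diff_eq (is_diffX 1 (is_diffB (dc k.1 c) (dc k.2 c)))).
  by apply/funext => v; rewrite mulrA.
apply: (is_diff_eq (is_diffD (ds ord0) (ds ord_max))).
by apply/funext => v; rewrite /ddist2 mulrDr.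
Qed.

Lemma ddist2_slice k w j :
  ddist2 k (slice w) (@slice_frame R n j) = dsqn (rot_mx R n) (edge_caff R k) w j.
Proof.
rewrite /ddist2 /dsqn reX_edge imX_edge /edge_caff/= mulmxBl.
have rB (A B : 'rV[R]_N) : (A - B) 0 j = A 0 j - B 0 j by rewrite !mxE.
have rV u := @vertex_caff_rot R n u j.
rewrite !rB -[in X in _ + _ * (X - _)]/(crow (vertex_caff R k.1)) rV.
by rewrite -[in X in _ + _ * (_ - X)]/(crow (vertex_caff R k.2)) rV !slice_frameE !addn0 !addn1 !mxE.
Qed.

Lemma function_d_ln (G : edge_ordered_graph n.+1 (2 * n)) e w j :
  edge_sqnorm G e (slice w) != 0 ->
  function_d (fun x => ln (edge_sqnorm G e x)) (slice w) (@slice_frame R n j) =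
  dlog (rot_mx R n) (edge_caff R (src G e, tgt G e)) w j.
Proof.
rewrite edge_sqnormE => e0; have {}e0 : 0 < dist2 (src G e, tgt G e) (slice w).
  by rewrite lt_neqAle eq_sym e0 dist2_slice sqn_ge0.
rewrite /function_d; under eq_fun do rewrite edge_sqnormE.
rewrite (diff_val (is_diff_def := is_diff_ln (is_diff_dist2 _ _) e0)).
by rewrite /dlog ddist2_slice dist2_slice.
Qed.

Lemma function_d_ln_div (G : edge_ordered_graph n.+1 (2 * n)) e d w j :
  edge_sqnorm G e (slice w) != 0 -> edge_sqnorm G d (slice w) != 0 ->
  function_d (fun x => ln (edge_sqnorm G e x / edge_sqnorm G d x))
    (slice w) (@slice_frame R n j) =
  dlog (rot_mx R n) (edge_caff R (src G e, tgt G e)) w j -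
  dlog (rot_mx R n) (edge_caff R (src G d, tgt G d)) w j.
Proof.
rewrite !edge_sqnormE; set ke := (src G e, _); set kd := (src G d, _) => e0 d0.
have qe : 0 < dist2 ke (slice w) by rewrite lt_neqAle eq_sym e0 dist2_slice sqn_ge0.
have qd : 0 < dist2 kd (slice w) by rewrite lt_neqAle eq_sym d0 dist2_slice sqn_ge0.
rewrite /function_d; under eq_fun do rewrite !edge_sqnormE -/ke -/kd.
have dV : is_diff (slice w) (fun z => (dist2 kd z)^-1)
    (fun v => - (dist2 kd (slice w)) ^- 2 * ddist2 kd (slice w) v).
  have [dd dE] := is_diff_dist2 kd (slice w).
  apply: DiffDef; first exact: differentiableV.
  by rewrite diffV// dE.
have q0 : 0 < dist2 ke (slice w) * (dist2 kd (slice w))^-1 by rewrite divr_gt0.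
have := is_diff_ln (is_diffM (is_diff_dist2 ke (slice w)) dV) q0.
move=> [_ /(congr1 (fun f => f (slice_frame R j))) dE]; rewrite [LHS]dE.
rewrite /dlog -!ddist2_slice -!dist2_slice.
move: (lt0r_neq0 qe) (lt0r_neq0 qd).
rewrite -[((_ + _) : config -> R) _]/(dist2 ke (slice w) * (- dist2 kd (slice w) ^- 2 * ddist2 kd (slice w) _) +
  (dist2 kd (slice w))^-1 * ddist2 ke (slice w) _)
  -[((_ * _) : config -> R) _]/(dist2 ke (slice w) / dist2 kd (slice w)).
move: (dist2 ke _) (dist2 kd _) (ddist2 ke _ _) (ddist2 kd _ _) => x y dx dy x0 y0.
by field; rewrite x0 y0.
Qed.

Lemma distinct_pointsE w : distinct_points (slice w) <->
  forall k : {k : 'I_n.+1 * 'I_n.+1 | k.1 != k.2},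
    sqn (rot_mx R n) (edge_caff R (val k)) w != 0.
Proof.
split=> [dw [[u v] /= uv]|dw u v E].
  by rewrite -dist2_slice dist2_eq0 (inj_eq dw).
apply/eqP; apply: contraT => uv.
by have := dw (exist _ (u, v) uv); rewrite -dist2_slice dist2_eq0 E eqxx.
Qed.

(** Vertex 0 sits at the origin, so its distances bound all coordinates; x^2 <= C implies |x| <= C +
    1. *)
Lemma distances_bounded (C : R) : exists B, forall w : N.-tuple R,
  (forall k : {k : 'I_n.+1 * 'I_n.+1 | k.1 != k.2},
    sqn (rot_mx R n) (edge_caff R (val k)) w <= C) -> cube N B w.
Proof.
exists (C + 1) => w wC j.
have jn : ((j./2).+2 < n.+1)%N.
  by move: (nat_of_ord j) (ltn_ord j) => k; lia.
have u0 : Ordinal jn != ord0 by [].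
have := wC (exist _ (Ordinal jn, ord0) u0); rewrite /sqn reX_edge imX_edge /=.
rewrite ![slice w ord0 _]mxE /= !subr0 !mxE /= => H.
have {H} : tnth w j ^+ 2 <= C.
  apply: le_trans H; rewrite (tnth_nth 0) addn0 addn1.
  have := odd_double_half j; case: (odd j) => /= E.
    by rewrite -[in leLHS]E add1n lerDr sqr_ge0.
  by rewrite -[in leLHS]E add0n lerDl sqr_ge0.
rewrite -real_normK ?num_real//; have := normr_ge0 (tnth w j); nra.
Qed.
End chart_differentials.

Lemma Rintegral_sum d (T : measurableType d) (R : realType) (mu : {measure set T -> \bar R})
    (D : set T) (I : Type) (s : seq I) (P : pred I) (f : I -> T -> R) :
  measurable D -> (forall i, mu.-integrable D (EFin \o f i)) ->
  mu.-integrable D (EFin \o (fun x => \sum_(i <- s | P i) f i x)) /\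
  \int[mu]_(x in D) (\sum_(i <- s | P i) f i x) = \sum_(i <- s | P i) \int[mu]_(x in D) f i x.
Proof.
move=> mD fi; elim: s => [|i s [IH1 IH2]].
  split; first by under eq_fun do rewrite big_nil; exact: integrable0.
  under eq_Rintegral do rewrite big_nil; rewrite big_nil.
  by rewrite Rintegral_cst// mul0r.
rewrite big_cons; case: ifPn => Pi; last first.
  by split; [under eq_fun do rewrite big_cons (negbTE Pi)|
     under eq_Rintegral do rewrite big_cons (negbTE Pi)].
split.
  under eq_fun do rewrite big_cons Pi.
  rewrite [X in _.-integrable _ X](_ : _ = ((EFin \o f i) \+
    (EFin \o (fun x => (\sum_(i <- s | P i) f i x)%R)))%E)//.
  exact: integrableD.
under eq_Rintegral do rewrite big_cons Pi.
by rewrite RintegralD// IH2.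
Qed.

(** * The integrals attached to a graph *)

Section graph_integrals.
Context (R : realType) (n : nat) (G : edge_ordered_graph n.+1 (2 * n)).
Hypothesis hG : loopless G.
Local Notation N := (n.-1).*2.
Local Notation J := (rot_mx R n).
Local Notation mu := (Leb R N).

Let ends (e : 'I_(2 * n)) := (src G e, tgt G e).
Let edge e := edge_caff R (ends e).

Definition distinct_slice : set (Tup R N) := [set w | distinct_points (slice w)].
Local Notation D := distinct_slice.

(** The domain excludes every collision of vertices, so the cutoff has to involve all pairs, joined
    by an edge or not. *)
Let K : finType := {k : 'I_n.+1 * 'I_n.+1 | k.1 != k.2}.
Let pK (k : K) := edge_caff R (val k).
Let edgeK e : K := exist (fun k : 'I_n.+1 * 'I_n.+1 => k.1 != k.2) (ends e) (hG e).

Let DE : D = [set w | forall k, sqn J (pK k) w != 0].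
Proof. by apply/seteqP; split => w; rewrite /D /= => /distinct_pointsE. Qed.

Lemma measurable_distinct_slice : measurable D.
Proof.
rewrite DE (_ : [set w | _] = \bigcap_(k in [set: K]) ~` (sqn J (pK k) @^-1` [set 0])).
  apply: fin_bigcap_measurable => // k _; apply: measurableC.
  rewrite -[X in measurable X]setTI.
  by apply: measurable_sqn => //; exact: measurable_set1.
by apply/seteqP; split => w /= H k; [move=> _; apply/eqP; exact: H|apply/eqP; exact: H].
Qed.

Let sqn_edge w e : D w -> sqn J (edge e) w != 0.
Proof. by rewrite DE => /(_ (edgeK e)). Qed.

Let L a (e : 'I_N -> 'I_(2 * n)) := logform J (edge a) (fun i => edge (e i)).
Let I a e := \int[mu]_(w in D) L a e w.

Lemma integrable_edge_form a e : mu.-integrable D (EFin \o L a e).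
Proof.
apply: integrable_logform; first exact: rot_mx_sqr.
  exact: measurable_distinct_slice.
by move=> w Dw; split=> [|i]; exact: sqn_edge.
Qed.

Lemma edge_integral_swap a b r e : I b (subst_at e r a) = - I a (subst_at e r b).
Proof.
apply/eqP; rewrite -addr_eq0; apply/eqP.
have stokes (S : set (Tup R N)) : S = [set w | forall k, sqn J (pK k) w != 0] -> measurable S ->
    \int[mu]_(w in S) logform J (pK (edgeK b))
      (fun i => pK (subst_at (fun i => edgeK (e i)) r (edgeK a) i)) w +
    \int[mu]_(w in S) logform J (pK (edgeK a))
      (fun i => pK (subst_at (fun i => edgeK (e i)) r (edgeK b) i)) w = 0.
  move=> ->; exact: (log_stokes (rot_mx_sqr R n) (@distances_bounded R n)).
have pE x : (fun i => pK (subst_at (fun i => edgeK (e i)) r (edgeK x) i)) =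
    (fun i => edge (subst_at e r x i)).
  by apply/funext => i; rewrite /subst_at; case: eqP.
have := stokes _ DE measurable_distinct_slice.
by rewrite !pE.
Qed.

Let E (l d : 'I_(2 * n)) (i : 'I_N) := nth l (other_edges l d) i.

Lemma wedge_ln w l d : D w ->
  ln (edge_sqnorm G l (slice w)) *
  wedge_except l d (fun e => function_d (fun x => ln (edge_sqnorm G e x))) (slice w)
    (@slice_frame R n) = L l (E l d) w.
Proof.
move=> Dw; rewrite edge_sqnormE dist2_slice; congr (_ * \det _).
apply/matrixP => i j; rewrite !mxE function_d_ln//.
by rewrite edge_sqnormE dist2_slice; exact: sqn_edge.
Qed.

Definition quotient_form l d : Defs.form R n N := fun z v =>
  ln (edge_sqnorm G l z / edge_sqnorm G d z) * wedge_except l d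
    (fun e => function_d (fun x => ln (edge_sqnorm G e x / edge_sqnorm G d x))) z v.

Lemma wedge_ln_div w l d : D w ->
  wedge_except l d (fun e => function_d
      (fun x => ln (edge_sqnorm G e x / edge_sqnorm G d x))) (slice w) (@slice_frame R n) =
  \det (\matrix_(i, j) (dlog J (edge (E l d i)) w j - dlog J (edge d) w j)).
Proof.
move=> Dw; congr (\det _); apply/matrixP => i j; rewrite !mxE function_d_ln_div//.
  by rewrite edge_sqnormE dist2_slice; exact: sqn_edge.
by rewrite edge_sqnormE dist2_slice; exact: sqn_edge.
Qed.

(** Expanding both the logarithm of the quotient and the determinant of differences turns the form
    into finitely many logarithmic forms, each integrable by itself. *)
Lemma quotient_formE w l d : D w -> quotient_form l d (slice w) (@slice_frame R n) =
  L l (E l d) w - \sum_(r < N) L l (subst_at (E l d) r d) w -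
  (L d (E l d) w - \sum_(r < N) L d (subst_at (E l d) r d) w).
Proof.
move=> Dw; rewrite /quotient_form wedge_ln_div// det_sub_row.
have q0 e : sqn J (edge e) w \is Num.pos.
  by rewrite posrE lt_neqAle eq_sym sqn_edge// sqn_ge0.
rewrite !edge_sqnormE !dist2_slice (ln_div (q0 l) (q0 d)) mulrBl.
have sumE a (A : R) : ln (sqn J (edge a) w) * (A - \sum_r \det (\matrix_(i, j)
     subst_at (fun i j => dlog J (edge (E l d i)) w j) r (dlog J (edge d) w) i j)) =
    ln (sqn J (edge a) w) * A - \sum_(r < N) L a (subst_at (E l d) r d) w.
  rewrite mulrBr mulr_sumr; congr (_ - _); apply: eq_bigr => r _.
  by congr (_ * \det _); apply/matrixP => i j; rewrite !mxE /subst_at; case: eqP.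
by rewrite !sumE.
Qed.

Lemma Z_integral_quotient l d : Z_integral (quotient_form l d) =
  I l (E l d) - \sum_(r < N) I l (subst_at (E l d) r d) -
  (I d (E l d) - \sum_(r < N) I d (subst_at (E l d) r d)).
Proof.
have mD := measurable_distinct_slice.
have iL := integrable_edge_form.
transitivity (\int[mu]_(w in D) (L l (E l d) w - \sum_(r < N) L l (subst_at (E l d) r d) w -
  (L d (E l d) w - \sum_(r < N) L d (subst_at (E l d) r d) w))).
  by apply: eq_Rintegral => w /set_mem Dw; exact: quotient_formE.
have iS a : mu.-integrable D (EFin \o (fun w => \sum_(r < N) L a (subst_at (E l d) r d) w)).
  by apply: (Rintegral_sum _ _ mD (fun r => iL a (subst_at (E l d) r d))).1.
have iB a : mu.-integrable D (EFin \o (fun w => L a (E l d) w -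
    \sum_(r < N) L a (subst_at (E l d) r d) w)).
  rewrite [X in _.-integrable _ X](_ : _ = ((EFin \o L a (E l d)) \-
    (EFin \o (fun w => (\sum_(r < N) L a (subst_at (E l d) r d) w)%R)))%E)//.
  exact: integrableB.
have IS a : \int[mu]_(w in D) (\sum_(r < N) L a (subst_at (E l d) r d) w) =
    \sum_(r < N) I a (subst_at (E l d) r d).
  by apply: (Rintegral_sum _ _ mD (fun r => iL a (subst_at (E l d) r d))).2.
have IB a : \int[mu]_(w in D) (L a (E l d) w - \sum_(r < N) L a (subst_at (E l d) r d) w) =
    I a (E l d) - \sum_(r < N) I a (subst_at (E l d) r d).
  by rewrite RintegralB ?IS.
by rewrite (RintegralB mD (iB l) (iB d)) !IB.
Qed.

Lemma Z_integral_RW : Z_integral (RW_form G) =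
  \sum_(l < 2 * n) \sum_(d < 2 * n | d != l) (-1) ^+ (l + d + (l < d)%N) * I l (E l d).
Proof.
have mD := measurable_distinct_slice.
have iL := integrable_edge_form.
transitivity (\int[mu]_(w in D) (\sum_(l < 2 * n) \sum_(d < 2 * n | d != l)
    (-1) ^+ (l + d + (l < d)%N) * L l (E l d) w)).
  apply: eq_Rintegral => w /set_mem Dw; apply: eq_bigr => l _; apply: eq_bigr => d _.
  by rewrite -mulrA; congr (_ * _); exact: wedge_ln.
pose f (l d : 'I_(2 * n)) w := (-1) ^+ (l + d + (l < d)%N) * L l (E l d) w.
have fi l d : mu.-integrable D (EFin \o f l d).
  rewrite [X in _.-integrable _ X](_ : _ =
    (fun w => ((-1) ^+ (l + d + (l < d)%N))%R%:E * (EFin \o L l (E l d)) w)%E)//.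
  exact: integrableZl.
have H (l : 'I_(2 * n)) := Rintegral_sum (index_enum 'I_(2 * n)) (fun d => d != l) mD (fi l).
rewrite (Rintegral_sum _ _ mD (fun l => (H l).1)).2.
by apply: eq_bigr => l _; rewrite (H l).2; apply: eq_bigr => d _; rewrite RintegralZl.
Qed.

Lemma Z_integral_RW_quotient (l d : 'I_(2 * n)) : (0 < n)%N -> l != d ->
  Z_integral (RW_form G) =
  (2 * n - 1)%N%:R * ((-1) ^+ (l + d + (l < d)%N) * Z_integral (quotient_form l d)).
Proof.
move=> n0 ld; have nE : (2 * n = N.+2)%N by lia.
rewrite Z_integral_RW Z_integral_quotient (alternating_edge_sum nE edge_integral_swap ld).
by congr (_%:R * _); lia.
Qed.

(** The matrix kills the vector [nu], a motion inside the slice that turns every edge at the same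
    rate and changes no edge length. *)
Lemma det_quotient_disconnected w l d : (1 < n)%N -> ~~ connected_graph G -> D w ->
  \det (\matrix_(i, j) (dlog J (edge (E l d i)) w j - dlog J (edge d) w j)) = 0.
Proof.
move=> n1 Gc Dw.
have Gsym : connect_sym (Defs.adjacent G).
  apply: sym_connect_sym => u v /=; apply: eq_existsb => e.
  by rewrite orbC.
pose t u : R := (~~ connect (Defs.adjacent G) ord0 u)%:R.
have t0 : t ord0 = 0 by rewrite /t connect0.
have te e : t (src G e) = t (tgt G e).
  rewrite /t (@same_connect_r _ _ Gsym (src G e) (tgt G e))//.
  by apply: connect1; apply/existsP; exists e; rewrite !eqxx.
pose i1 : 'I_n.+1 := inord 1.
have i1E : i1 = 1%N :> nat by rewrite inordK // ltnS ltnW.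
pose x u := slice w u ord0; pose y u := slice w u ord_max.
(* The velocity i (t u - t i1 z_u): what is not connected to [ord0] is translated by i, and a
   rotation about 0 keeps the point [i1] at 1. *)
pose nu : N.-tuple R := [tuple let u := inord (j./2).+2 in
  if odd j then t u - t i1 * x u else t i1 * y u | j < N].
have x0 : x ord0 = 0 by rewrite /x mxE.
have y0 : y ord0 = 0 by rewrite /y mxE.
have x1 : x i1 = 1 by rewrite /x mxE i1E.
have y1 : y i1 = 0 by rewrite /y mxE i1E.
have slice_nu u : slice nu u ord0 = (u == 1%N :> nat)%:R + t i1 * y u /\
    slice nu u ord_max = t u - t i1 * x u.
  rewrite !mxE addn0 addn1; case: u => -[|[|k]] uk.
  - have -> : Ordinal uk = ord0 by exact: val_inj.
    by rewrite x0 y0 t0 !mulr0 subr0 addr0.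
  - have -> : Ordinal uk = i1 by apply: val_inj; rewrite /= i1E.
    by rewrite x1 y1 mulr0 mulr1 subrr addr0 i1E.
  have k1 : (k.*2.+1 < N)%N by lia.
  have -> : Ordinal uk = inord k.+2 by apply: val_inj; rewrite /= inordK.
  have nuE j (jN : (j < N)%N) : nth 0 nu j = let u := inord (j./2).+2 in
      if odd j then t u - t i1 * x u else t i1 * y u.
    rewrite -[j]/(nat_of_ord (Ordinal jN)) -tnth_nth [in LHS]/nu.
    exact: (tnth_mktuple _ (Ordinal jN)).
  rewrite inordK// !doubleS /= nuE 1?ltnW// nuE// /= odd_double /= doubleK uphalf_double.
  by rewrite add0r.
have crow_nu k : \sum_j crow (edge_caff R k) 0 j * tnth nu j = t i1 * (y k.1 - y k.2).
  apply: (addIr (cre (edge_caff R k))); rewrite -[LHS]/(reX _ nu) reX_edge.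
  by rewrite (slice_nu k.1).1 (slice_nu k.2).1 /=; ring.
have crowJ_nu k : \sum_j (crow (edge_caff R k) *m J) 0 j * tnth nu j =
    t k.1 - t k.2 - t i1 * (x k.1 - x k.2).
  apply: (addIr (cim (edge_caff R k))); rewrite -[LHS]/(imX J _ nu) imX_edge.
  by rewrite (slice_nu k.1).2 (slice_nu k.2).2 /=; ring.
(* [t] agrees at both ends of an edge, so z_e moves by - i t i1 z_e, orthogonally to itself. *)
have dlog_nu e : \sum_j tnth nu j * dlog J (edge e) w j = 0.
  have -> : \sum_j tnth nu j * dlog J (edge e) w j = 2 * (reX (edge e) w *
      (\sum_j crow (edge e) 0 j * tnth nu j) + imX J (edge e) w *
      (\sum_j (crow (edge e) *m J) 0 j * tnth nu j)) / sqn J (edge e) w.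
    rewrite !mulr_sumr -big_split /= mulr_sumr mulr_suml; apply: eq_bigr => j _.
    by rewrite /dlog /dsqn; ring.
  rewrite crow_nu crowJ_nu reX_edge imX_edge /= te subrr sub0r -/(x _) -/(x _) -/(y _) -/(y _).
  by rewrite (_ : _ + _ = 0) ?mulr0 ?mul0r//; ring.
(* If the velocity vanished, either t i1 = 0, so [t] would be 0 everywhere and G connected, or t i1
   = 1 and every z_u = t u would be 0 or 1, so vertex 2 would collide with vertex 0 or 1. *)
have nu0 : \row_j tnth nu j != 0.
  apply/eqP => /rowP nu0; have {}nu0 j : tnth nu j = 0 by have := nu0 j; rewrite !mxE.
  have xy u : u != ord0 -> t i1 * y u = 0 /\ t u = t i1 * x u.
    move=> _; have := crow_nu (u, ord0); have := crowJ_nu (u, ord0).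
    rewrite !big1 => [|j _|j _]; rewrite ?nu0 ?mulr0//= x0 y0 t0 !subr0 => xE yE.
    by split => //; apply/eqP; rewrite -subr_eq0 -xE.
  have [t1|t1] := eqVneq (t i1) 0.
    move/negP: Gc; apply; apply/forallP => u; apply/forallP => v.
    have C0 z : connect (Defs.adjacent G) ord0 z.
      have [->|z0] := eqVneq z ord0; first exact: connect0.
      have := (xy z z0).2; rewrite t1 mul0r /t => /eqP; rewrite pnatr_eq0 eqb0 negbK//.
    by apply: connect_trans (C0 v); rewrite Gsym C0.
  pose i2 : 'I_n.+1 := inord 2.
  have i2E : i2 = 2 :> nat by rewrite inordK// ltnS.
  have i20 : i2 != ord0 by rewrite -val_eqE /= i2E.
  have [/eqP yi2 xi2] := xy i2 i20; move: yi2; rewrite mulf_eq0 (negbTE t1) /= => /eqP y2.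
  have {}t1 : t i1 = 1 by move: t1; rewrite /t; case: connect; rewrite ?eqxx.
  rewrite t1 mul1r in xi2.
  have inj u : x i2 = x u -> y u = 0 -> i2 = u.
    by move=> xu yu; apply: Dw; rewrite /Defs.point -/(x _) -/(x _) -/(y _) -/(y _) xu y2 yu.
  move: xi2; rewrite {1}/t; case: connect => /= xi2.
    by move/eqP: i20; apply; apply: inj; rewrite // x0 -xi2.
  have /(congr1 (@nat_of_ord _)) : i2 = i1 by apply: inj; rewrite // x1 -xi2.
  by rewrite i1E i2E.
apply/eqP; rewrite -det_tr; apply/det0P; exists (\row_j tnth nu j) => //.
apply/rowP => i; rewrite !mxE.
transitivity (\sum_j (tnth nu j * dlog J (edge (E l d i)) w j - tnth nu j * dlog J (edge d) w j)).
  by apply: eq_bigr => j _; rewrite !mxE mulrBr.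
by rewrite sumrB !dlog_nu subr0.
Qed.

Lemma Z_integral_disconnected l d : (1 < n)%N -> ~~ connected_graph G ->
  Z_integral (quotient_form l d) = 0.
Proof.
move=> n1 Gc; rewrite -[LHS]/(\int[mu]_(w in D) quotient_form l d (slice w) (@slice_frame R n)).
transitivity (\int[mu]_(w in D) (0 : R)); last first.
  by rewrite Rintegral_cst ?mul0r//; exact: measurable_distinct_slice.
apply: eq_Rintegral => w /set_mem Dw.
by rewrite /quotient_form wedge_ln_div// det_quotient_disconnected// mulr0.
Qed.
End graph_integrals.

Local Open Scope complex_scope.

Theorem proposition1p13 (R : realType) (n : nat) (hn : (3 <= n)%N)
    (G : edge_ordered_graph n.+1 (2 * n)) (hG : loopless G)
    (l d : 'I_(2 * n)) (hld : l != d) :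
  RW_integral R G =
  (2 * n - 1)%N%:R * ((-1) ^+ (l + d + (l < d)) / (0 +i* (2 * pi)) ^+ n.-1)
  * (Z_integral (fun z v =>
       ln (edge_sqnorm G l z / edge_sqnorm G d z)
       * wedge_except l d
           (fun e => function_d
              (fun x => ln (edge_sqnorm G e x / edge_sqnorm G d x))) z v))%:C.
Proof.
rewrite /RW_integral -/(quotient_form G l d); case: ifPn => Gc; last first.
  by rewrite (Z_integral_disconnected R hG _ _ (ltnW hn) Gc) mulr0.
rewrite (Z_integral_RW_quotient R hG (ltnW (ltnW hn)) hld) !rmorphM rmorph_nat rmorph_sign.
by rewrite mulrCA -!mulrA; congr (_ * _); rewrite mulrCA.
Qed.
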